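(* Let $Y=(Y_t)_{t\ge 0}$ be a regular, time-homogeneous diffusion on a filtered probability space $(\Omega,\mathcal F,\mathbb F=\{\mathcal F_t\}_{t\ge0},\mathbb P)$, with state space an interval $I$ and initial value $Y_0=y$ in the interior of $I$. Suppose that $\mathcal F_0$ is sufficiently rich as to include a continuous random variable, and that the process $Y$ is independent of this random variable. Suppose that $V:\mathcal T\to\mathbb R$ is law invariant, i.e. there is a function $H:Q(\mathcal T)\to\mathbb R$ such that $V(\tau)=H(\mathcal L(Y_\tau))$ for every $\tau\in\mathcal T$ (no quasi-convexity of $H$ is assumed). Then $$V_*(\mathcal T_T)\le V_*(\mathcal T_R)=V_*(\mathcal T).$$
   Context: Standing conventions. $Y$ is a continuous strong Markov process with respect to $\mathbb F$. It is assumed that there is a (continuous) strictly increasing function $s$ (a scale function) such that $X=s(Y)$ is a local martingale. $\bar I$ denotes the closure of $I$, taken in $[-\infty,\infty]$. $\mathcal L(Z)$ denotes the law of $Z$, and $\mathcal P(\Gamma)$ denotes the set of probability measures on $\Gamma$. Stopping times: $\mathcal T$ is the class of all $\mathbb F$-stopping times $\tau$ (the value $+\infty$ is allowed) such that $\lim_{t\uparrow\infty}Y_{t\wedge\tau}$ exists almost surely in $\bar I$; on $\{\tau=\infty\}$, $Y_\tau$ denotes this limit. (If $s(I)=\mathbb R$, this means that $\mathcal T$ is the set of almost surely finite stopping times.) For $a\le y\le b$ with $a,b\in\bar I$, let $\tau_{a,b}=\inf\{u\ge0: Y_u\notin(a,b)\}$, with $\inf\emptyset=\infty$. The set of pure threshold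 stopping times is $\mathcal T_T=\mathcal T\cap\{\tau_{a,b}: a\le y\le b,\ a,b\in\bar I\}$. Let $\mathcal D=([-\infty,y]\cap\bar I)\times([y,\infty]\cap\bar I)$. By the richness assumption on $\mathcal F_0$, for each $\zeta\in\mathcal P(\mathcal D)$ there is an $\mathcal F_0$-measurable random vector $(A_\zeta,B_\zeta)$, independent of $Y$, with law $\zeta$; set $\tau_\zeta=\inf\{u\ge0:Y_u\notin(A_\zeta,B_\zeta)\}$. The set of randomized threshold rules is $\mathcal T_R=\mathcal T\cap\{\tau_\zeta:\zeta\in\mathcal P(\mathcal D)\}$. For $\mathcal S\subseteq\mathcal T$: $Q(\mathcal S)=\{\mathcal L(Y_\tau):\tau\in\mathcal S\}$ and $V_*(\mathcal S)=\sup_{\tau\in\mathcal S}V(\tau)$. *)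

(* Defs.v *)
From HB Require Import structures.
From mathcomp Require Import all_boot all_order all_algebra.
From mathcomp Require Import all_classical all_reals all_analysis.
From mathcomp Require Import measurable_realfun.

Set Implicit Arguments.
Unset Strict Implicit.
Unset Printing Implicit Defensive.

Import Order.TTheory GRing.Theory Num.Theory.
Import numFieldNormedType.Exports.

Local Open Scope classical_set_scope.
Local Open Scope ring_scope.

(* Time is a real number t with 0 <= t; a random time takes values in \bar R,
   the value +oo being allowed. *)

(* Continuous paths on [0, oo). The values of a path at negative times are
   irrelevant: neither continuity nor the sigma-algebra below depends on them. *)
Record cpath (R : realType) := CPath {
  cpath_fun :> R -> R ;
  cpath_cont : {within [set t : R | 0 <= t], continuous cpath_fun} }.

Lemma const_path_subproof (R : realType) (c : R) :
  {within [set t : R | 0 <= t], continuous (fun _ : R => c)}.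
Proof. by apply: continuous_subspaceT; exact: cst_continuous. Qed.

Definition const_path (R : realType) (c : R) : cpath R :=
  CPath (@const_path_subproof R c).

HB.instance Definition _ (R : realType) := gen_eqMixin (cpath R).
HB.instance Definition _ (R : realType) := gen_choiceMixin (cpath R).
HB.instance Definition _ (R : realType) :=
  isPointed.Build (cpath R) (const_path 0).

Definition cylinders (R : realType) : set (set (cpath R)) :=
  [set E | exists t : R, exists2 B : set R, 0 <= t /\ measurable B &
           E = [set w : cpath R | B (w t)] ].

Notation path_space R := (g_sigma_algebraType (@cylinders R)).

Lemma shift_path_subproof (R : realType) (r : R) (w : cpath R) :
  {within [set t : R | 0 <= t], continuous (fun t => w (Num.max r 0 + t))}.
Proof.
have r0 : 0 <= Num.max r 0 by rewrite le_max lexx orbT.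
apply/subspace_continuousP => x /= x0.
have /subspace_continuousP cw := @cpath_cont R w.
apply: (cvg_trans _ (cw _ (addr_ge0 r0 x0))).
move=> A /= [e e0 eA]; exists e => //= t xt t0; apply: eA; last exact: addr_ge0.
by move: xt; rewrite /ball /= opprD addrACA subrr add0r.
Qed.

(* The path t |-> w (r + t), for r >= 0 (negative r are truncated to 0). *)
Definition shift_path (R : realType) (r : R) (w : cpath R) : cpath R :=
  CPath (@shift_path_subproof R r w).

(* min (t, r) for a finite time t and a possibly infinite time r >= 0. *)
Definition min_time (R : realType) (t : R) (r : \bar R) : R :=
  fine (mine t%:E r).

Definition measurable_wrt d' (T : Type) (T' : measurableType d')
    (G : set (set T)) (f : T -> T') : Prop :=
  forall B : set T', measurable B -> G (f @^-1` B).

Definition independent d d1 d2 (T : measurableType d) (T1 : measurableType d1)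
    (T2 : measurableType d2) (R : realType) (P : probability T R)
    (f : T -> T1) (g : T -> T2) : Prop :=
  forall (B : set T1) (C : set T2), measurable B -> measurable C ->
    P (f @^-1` B `&` g @^-1` C) = (P (f @^-1` B) * P (g @^-1` C))%E.

(* The law of X, as a set function on the measurable sets. Non-measurable sets
   are given the value 0, so that equality of laws is Leibniz equality. *)
Definition law d d' (T : measurableType d) (T' : measurableType d')
    (R : realType) (P : probability T R) (X : T -> T') : set T' -> \bar R :=
  (pushforward P X) \_ measurable.

Section stochastic_basis.
Context d (T : measurableType d) (R : realType).
Implicit Types (P : probability T R) (F : R -> set (set T)).
Implicit Types (tau : T -> \bar R) (M : R -> T -> R).

Definition filtration F : Prop :=
  (forall t, 0 <= t -> sigma_algebra setT (F t) /\ F t `<=` measurable) /\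
  (forall u t, 0 <= u -> u <= t -> F u `<=` F t).

Definition stopping_time F tau : Prop :=
  (forall w, (0 <= tau w)%E) /\
  (forall t, 0 <= t -> F t [set w | (tau w <= t%:E)%E]).

Definition stopped_events F tau : set (set T) :=
  [set G | measurable G /\
           forall t, 0 <= t -> F t (G `&` [set w | (tau w <= t%:E)%E])].

(* The conditional expectation identity E[M_t | F_u] = M_u is spelled out by
   integrating over the events of F_u. *)
Definition martingale P F M : Prop :=
  [/\ forall t, 0 <= t -> measurable_wrt (F t) (M t),
      forall t, 0 <= t -> P.-integrable setT (fun w => (M t w)%:E) &
      forall u t G, 0 <= u -> u <= t -> F u G ->
        (\int[P]_(w in G) (M t w)%:E = \int[P]_(w in G) (M u w)%:E)%E].

Definition local_martingale P F M : Prop :=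
  (forall t, 0 <= t -> measurable_wrt (F t) (M t)) /\
  exists tau : nat -> T -> \bar R,
    [/\ forall n, stopping_time F (tau n),
        {ae P, forall w, {homo (fun n => tau n w) : m n / (m <= n)%N >-> (m <= n)%E}},
        {ae P, forall w, tau n w @[n --> \oo] --> +oo%E} &
        forall n, martingale P F
          (fun t w => M (min_time t (tau n w)) w - M 0 w)].

End stochastic_basis.

Section diffusion.
Context d (T : measurableType d) (R : realType) (P : probability T R).
Variables (F : R -> set (set T)) (I : set R) (y : R).
Variables (Y : T -> path_space R) (k : R.-pker R ~> path_space R).
Implicit Types (tau : T -> \bar R).

(* k x is the law P^x of the diffusion started from x, for x in I (its values
   at points x outside I play no role). The law of the path after a stopping
   time tau, given F_tau and on {tau < oo}, is k (Y_tau): the same kernel serves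
   all tau, which is time-homogeneity. *)
Definition strong_markov : Prop :=
  forall tau G (E : set (path_space R)), stopping_time F tau ->
    stopped_events F tau G -> measurable E ->
    (P (G `&` [set w | tau w < +oo]
          `&` [set w | E (shift_path (fine (tau w)) (Y w))]) =
     \int[P]_(w in G `&` [set w | tau w < +oo]) k (Y w (fine (tau w))) E)%E.

(* The target z may be a boundary point belonging to I, the starting point x is
   interior. *)
Definition regular : Prop :=
  forall x z, I^° x -> I z ->
    (0 < k x [set w : cpath R | exists2 t : R, 0 <= t & w t = z]%R)%E.

Record regular_diffusion : Prop := RegularDiffusion {
  state_interval : is_interval I ;
  start_interior : I^° y ;
  starts_at : forall w, Y w 0 = y ;
  state_values : forall w t, 0 <= t -> I (Y w t) ;
  diffusion_adapted : forall t, 0 <= t -> measurable_wrt (F t) (fun w => Y w t) ;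
  kernel_start : forall x, I x -> {ae k x, forall w : cpath R, w 0 = x} ;
  kernel_values : forall x, I x ->
    {ae k x, forall w : cpath R, forall t : R, 0 <= t -> I (w t)} ;
  diffusion_strong_markov : strong_markov ;
  diffusion_regular : regular }.

Definition has_scale : Prop :=
  exists s : R -> R,
    [/\ {within I, continuous s},
        {in I &, {homo s : x z / x < z}} &
        local_martingale P F (fun t w => s (Y w t))].

(* F_0 carries a random variable with a continuous distribution function, i.e.
   without atoms, that is independent of the process Y. *)
Definition rich : Prop :=
  exists U : T -> R,
    [/\ measurable_wrt (F 0) U,
        forall u, P (U @^-1` [set u]) = 0%E &
        independent P Y U].

Definition state_closure : set (\bar R) := closure (EFin @` I).

Definition admissible tau : Prop :=
  stopping_time F tau /\
  {ae P, forall w, exists2 l : \bar R, state_closure l &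
     (Y w (min_time t (tau w)))%:E @[t --> +oo] --> l}.

(* The random variable Y_tau; on {tau = oo} it is the limit of Y at infinity. *)
Definition stopped_value tau (w : T) : \bar R :=
  if tau w is t%:E then (Y w t)%:E else lim ((Y w t)%:E @[t --> +oo]).

Definition exit_time (a b : T -> \bar R) (w : T) : \bar R :=
  ereal_inf [set t%:E | t in [set t : R |
    0 <= t /\ ~ (a w < (Y w t)%:E < b w)%E]].

Definition pure_threshold tau : Prop :=
  admissible tau /\
  exists a b : \bar R,
    [/\ state_closure a, state_closure b, (a <= y%:E <= b)%E &
        tau = exit_time (cst a) (cst b)].

Definition threshold_pairs : set (\bar R * \bar R) :=
  [set ab | [/\ state_closure ab.1, (ab.1 <= y%:E)%E,
                state_closure ab.2 & (y%:E <= ab.2)%E]].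

Definition randomizes (zeta : probability (\bar R * \bar R)%type R)
    (AB : T -> \bar R * \bar R) : Prop :=
  [/\ measurable_wrt (F 0) AB, independent P Y AB &
      law P AB = zeta \_ measurable].

(* A fixed choice (A_zeta, B_zeta) of a random vector randomizing zeta; it does
   randomize zeta as soon as some vector does. *)
Definition thresholds (zeta : probability (\bar R * \bar R)%type R) :
    T -> \bar R * \bar R :=
  xget (cst (y%:E, y%:E)) [set AB | randomizes zeta AB].

Definition randomized_time (zeta : probability (\bar R * \bar R)%type R) :
    T -> \bar R :=
  exit_time (fun w => (thresholds zeta w).1) (fun w => (thresholds zeta w).2).

Definition randomized_threshold tau : Prop :=
  admissible tau /\
  exists2 zeta : probability (\bar R * \bar R)%type R,
    zeta threshold_pairs = 1%E & tau = randomized_time zeta.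

(* V is only meaningful on admissible times, H on their laws; the values
   elsewhere are irrelevant. *)
Definition law_invariant (V : (T -> \bar R) -> R) : Prop :=
  exists H : (set (\bar R) -> \bar R) -> R,
    forall tau, admissible tau -> V tau = H (law P (stopped_value tau)).

End diffusion.

Definition optimal_value (T : Type) (R : realType) (V : (T -> \bar R) -> R)
    (S : set (T -> \bar R)) : \bar R :=
  ereal_sup [set (V tau)%:E | tau in S].

(* Main.v *)
(* It suffices to match the law of Y_tau, for each admissible tau, by a
   randomized threshold rule. Write X for the value Y_tau.

   A path of Y is almost surely either recurrent or convergent to an end point
   of I, so the exit value of Y from (a, b) is a or b. Optional stopping of the
   local martingale s(Y) shows that a has probability p(a) / (p(a) + p(b)), where
   p(z) = 1 / |s(z) - s(y)| and s is extended to the closure of I.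

   If s is infinite at both end points, every level of I is reached almost surely,
   and X is matched by a threshold distributed as X, paired with the end point on
   the other side of y. Otherwise, let m be the larger of the integrals of
   1/p(X) over {X < y} and {X > y}. Optional stopping at tau shows that they are
   finite, and that they can differ only if the end point on the side of the
   smaller one has infinite scale, i.e. p = 0 there. Normalizing by m, and
   filling up the smaller one with mass at that end point, gives size-biased laws
   for a lower threshold f(U) and an upper threshold g(U). Tilting the law of U
   by the density m (p(f(U)) + p(g(U))) cancels the denominator of the exit
   probability and the size bias, so that X is matched on {X <> y}; the event
   {X = y} is matched by the pair (y, y). All laws are realized as functions of
   the one variable U by the quantile transform, whose input has no atoms. *)

From HB Require Import structures.
Require Import Defs.
From mathcomp Require Import all_boot all_order all_algebra.
From mathcomp Require Import all_classical all_reals all_analysis.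
From mathcomp Require Import measurable_realfun.
From mathcomp Require Import ring lra.

Set Implicit Arguments.
Unset Strict Implicit.
Unset Printing Implicit Defensive.

Import Order.TTheory GRing.Theory Num.Theory.
Import numFieldNormedType.Exports.

Local Open Scope classical_set_scope.
Local Open Scope ring_scope.

(** * First passage times of continuous paths *)

(** The exit law of (a, b) couples a and b through its denominator p(a) + p(b). The tilt decouples
    them: under a density proportional to p(a) + p(b), the mass sent to a is proportional to p(a)
    alone. So only the laws of the two thresholds matter, not their coupling, and both may be
    functions of the same U. The tilted law of U is itself realized by a transform q of U: the final
    pair is (f(q(U)), g(q(U))), and an atom of q(U) at +oo, a value never taken by U, encodes the
    pair (y, y).

    Neither completeness nor right-continuity of the filtration is available. Stopping times are
    therefore first passages to closed sets, for which {sigma <= t} is an exact event of [F t], and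
    path events are reduced to rational times.

    An exit may never happen while the path converges to an end that is not a state. The side of the
    exit is hence described by an event, [reaches_left], which makes sense for finite and infinite
    thresholds, whether attained or only approached. *)

Section sigma_algebra_facts.
Context (T : Type) (G : set (set T)).
Hypothesis sG : sigma_algebra setT G.

Lemma salgebra0 : G set0. Proof. by case: sG. Qed.

Lemma salgebraC A : G A -> G (~` A).
Proof. by case: sG => _ h _ /h; rewrite setTD. Qed.

Lemma salgebraT : G setT.
Proof. by rewrite -setC0; exact/salgebraC/salgebra0. Qed.

Lemma salgebra_bigcup (A : nat -> set T) :
  (forall n, G (A n)) -> G (\bigcup_n A n).
Proof. by case: sG => _ _; exact. Qed.

Lemma salgebra_bigcap (A : nat -> set T) :
  (forall n, G (A n)) -> G (\bigcap_n A n).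
Proof.
move=> GA; rewrite -(setCK (\bigcap_n A n)) setC_bigcap.
apply: salgebraC; apply: salgebra_bigcup => n.
exact/salgebraC.
Qed.

Lemma salgebraU A B : G A -> G B -> G (A `|` B).
Proof.
move=> GA GB; rewrite -bigcup2E; apply: salgebra_bigcup => -[|[|n]] //=.
exact: salgebra0.
Qed.

Lemma salgebraI A B : G A -> G B -> G (A `&` B).
Proof.
move=> GA GB; rewrite -(setCK (A `&` B)) setCI; apply: salgebraC.
by apply: salgebraU; exact: salgebraC.
Qed.

Lemma salgebra_bigcup_rat (A : rat -> set T) :
  (forall q, G (A q)) -> G (\bigcup_q A q).
Proof.
move=> GA.
rewrite (_ : \bigcup_q A q = \bigcup_n
    (if unpickle n is Some q then A q else set0)).
  apply: salgebra_bigcup => n.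
  by case: unpickle => [q|]; [exact: GA|exact: salgebra0].
apply/seteqP; split=> [w [q _ Aw]|w [n _]].
  by exists (pickle q); [exact: I|rewrite pickleK; exact: Aw].
by case: (unpickle n) => [q Aw|[]]; exists q.
Qed.

End sigma_algebra_facts.

Section rational_grid.
Context (R : realType).
Implicit Types (r t u : R).

(** Projection onto [r, t]. It turns rationals into times of [r, t] even if this interval is a
    single irrational point, and later truncates random variables at the levels -K and K. *)
Definition clamp r t u : R := Num.max r (Num.min t u).

Lemma clamp_itv r t u : r <= t -> r <= clamp r t u <= t.
Proof. by move=> rt; rewrite /clamp le_max lexx ge_max rt ge_min lexx. Qed.

Lemma clamp_id r t u : r <= u <= t -> clamp r t u = u.
Proof. by move=> /andP[ru ut]; rewrite /clamp min_r// max_r. Qed.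

Lemma clamp_lipschitz r t u v : `|clamp r t u - clamp r t v| <= `|u - v|.
Proof.
rewrite /clamp ler_norml; have := ler_norm (u - v).
have := ler_norm (v - u); rewrite (distrC v u) => ? ?.
by case: (leP t u) => ?; case: (leP t v) => ?;
  repeat (case: (leP r) => ?); lra.
Qed.

Lemma dist_lt (a b e : R) : `|a - b| < e -> a < b + e /\ b < a + e.
Proof. by rewrite ltr_norml => /andP[? ?]; split; lra. Qed.

Lemma rat_dense r (e : R) : 0 < e -> exists q : rat, `|r - ratr q| < e.
Proof.
move=> e0; have /rat_in_itvoo[q] : r < r + e by lra.
rewrite in_itv/= => /andP[rq qr]; exists q; rewrite ltr_norml; lra.
Qed.

End rational_grid.

Section first_passage.
Context (R : realType).

Lemma within_itv_ball (r t : R) (f : R -> R) (u e : R) :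
  {within `[r, t], continuous f} -> r <= u <= t -> 0 < e ->
  exists2 d : R, 0 < d & forall v, r <= v <= t -> `|u - v| < d -> `|f u - f v| < e.
Proof.
move=> /subspace_continuousP cf urt e0.
have := cf u; rewrite /= in_itv/= => /(_ urt) /cvgrPdist_lt /(_ _ e0).
rewrite near_withinE near_simpl => -[d d0 dP]; exists d => // v vrt uv.
by apply: dP => //; rewrite in_itv.
Qed.

(** By continuity, a visit to the nonpositive reals makes [phi] smaller than every 1/(n+1) at
    clamped rational times; conversely the minimum over the compact [r, t] is attained and lies
    below all these values. This writes the event with countably many times of [r, t]. It is stated
    for a general process [phi], so that random thresholds can be handled too. *)
Lemma hit_sigma_algebra (T : Type) (G : set (set T)) (phi : R -> T -> R) (r t : R) :
  sigma_algebra setT G -> r <= t ->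
  (forall w, {within `[r, t], continuous (phi^~ w)}) ->
  (forall u, r <= u <= t -> measurable_wrt G (phi u)) ->
  G [set w | exists2 u, r <= u <= t & phi u w <= 0].
Proof.
move=> sG rt cphi mphi.
rewrite (_ : [set w | _] = \bigcap_n \bigcup_(q : rat)
   [set w | phi (clamp r t (ratr q)) w < n.+1%:R^-1]).
  apply: salgebra_bigcap => // n; apply: salgebra_bigcup_rat => // q.
  have := mphi _ (clamp_itv (ratr q) rt) `]-oo, n.+1%:R^-1[%classic.
  rewrite (_ : _ @^-1` _ = [set w | phi (clamp r t (ratr q)) w < n.+1%:R^-1]).
    by apply; exact: measurable_itv.
  by apply/seteqP; split=> w /=; rewrite in_itv.
apply/seteqP; split=> w /=.
  move=> [u urt pu] n _.
  have n0 : 0 < n.+1%:R^-1 :> R by rewrite invr_gt0.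
  have [e e0 eP] := within_itv_ball (cphi w) urt n0.
  have [q qe] := rat_dense u e0; exists q => //=.
  have := eP _ (clamp_itv (ratr q) rt); rewrite -{1}(clamp_id urt).
  move=> /(_ (le_lt_trans (clamp_lipschitz _ _ _ _) qe)).
  by move=> /dist_lt[_ h]; apply: (lt_le_trans h); rewrite gerDr.
move=> h; have [u urt umin] := EVT_min rt (cphi w).
move: urt; rewrite in_itv /= => urt.
exists u => //; rewrite leNgt; apply/negP => pu.
have [n /= ltn] : exists n, n.+1%:R^-1 < phi u w.
  have := @near_infty_natSinv_lt R (PosNum pu); move=> [N _ /(_ N (leqnn N))].
  by exists N.
have [q _ /= pq] := h n I.
have := lt_trans (le_lt_trans (umin _ (clamp_itv (ratr q) rt)) pq) ltn.
by rewrite ltxx.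
Qed.

(** The infimum of a closed set is attained. This is why a first passage to a closed set at time at
    most t is decided by the path up to t, with no look into the immediate future. *)
Lemma ereal_inf_closed_le (S : set R) (t : R) :
  closed S -> (forall u, S u -> 0 <= u) ->
  (ereal_inf (EFin @` S) <= t%:E)%E <-> exists2 u, S u & u <= t.
Proof.
move=> cS S0; split=> [|[u Su ut]]; last first.
  by apply: (@le_trans _ _ u%:E) => //; apply: ereal_inf_lbound; exists u.
move=> inft.
have [S1|S1] := pselect (exists u, S u); last first.
  have S00 : S = set0 by apply/seteqP; split=> // u Su; case: S1; exists u.
  by move: inft; rewrite S00 image_set0 ereal_inf0.
have lbS : has_lbound S by exists 0 => u /S0.
have hinf : has_inf S by split.
exists (inf S).
  suff : closure S (inf S) by move/closure_id : cS => <-.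
  move=> B /nbhs_ballP[e /= e0 eB].
  have [u Su ue] := inf_adherent e0 hinf; exists u; split => //; apply: eB.
  have infu := ge_inf lbS Su.
  have : `|inf S - u| < e by rewrite ltr_norml; lra.
  exact.
by move: inft; rewrite ereal_inf_EFin // lee_fin.
Qed.

End first_passage.

Section paths.
Context (R : realType).
Implicit Types (w : cpath R) (r t u : R) (f : R -> R).

Lemma cpath_within w r t : 0 <= r -> {within `[r, t], continuous w}.
Proof.
move=> r0; apply: continuous_subspaceW (@cpath_cont R w) => u /=.
by rewrite in_itv/= => /andP[ru _]; exact: le_trans ru.
Qed.

(** Freezing the path at negative times gives a function continuous on the whole line, to which
    results on global continuity apply. *)
Lemma cpath_ext_continuous w : continuous (fun u => w (Num.max u 0)).
Proof.
move=> x; have /subspace_continuousP cw := @cpath_cont R w.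
have x0 : 0 <= Num.max x 0 by rewrite le_max lexx orbT.
apply/cvgrPdist_lt => e e0.
have := cw _ x0; move/cvgrPdist_lt => /(_ _ e0).
rewrite near_withinE near_simpl => -[d d0 dP].
exists d => // v xv; apply: dP; last by rewrite /= le_max lexx orbT.
apply: le_lt_trans xv.
(* [max] with 0 is a [clamp] whose upper bound is exceeded by neither x nor v, hence it is
   1-Lipschitz. *)
by have := clamp_lipschitz 0 (Num.max x v) x v;
  rewrite /clamp !min_r ?le_max ?lexx ?orbT// !(maxC 0).
Qed.

(** Information in the path up to time t, on path space. Its events pull back into [F t] for every
    filtration to which Y is adapted. *)
Definition past t : set (set (cpath R)) :=
  <<s [set E | exists u (B : set R), [/\ 0 <= u, u <= t, measurable B &
    E = [set w : cpath R | B (w u)] ] ] >>.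

Lemma past_salgebra t : sigma_algebra setT (past t).
Proof. exact: smallest_sigma_algebra. Qed.

Lemma past_eval t u : 0 <= u <= t -> measurable_wrt (past t) (fun w => w u : R).
Proof.
move=> /andP[u0 ut] B mB; apply: sub_sigma_algebra; exists u, B; split => //.
Qed.

Lemma past_measurable t : past t `<=` @measurable _ (path_space R).
Proof.
apply: smallest_sub; first exact: sigma_algebra_measurable.
move=> _ [u [B [u0 _ mB ->]]]; apply: sub_sigma_algebra.
by exists u; exists B.
Qed.

(** Closed targets are encoded as sublevel sets f <= 0 of a continuous f: a point ([reach]), a
    compact interval ([dist_itv]), or the complement of an open interval ([outside]). *)
Definition hits (f : R -> R) r t : set (cpath R) :=
  [set w | exists2 u, r <= u <= t & f (w u) <= 0].

Definition hits_after (f : R -> R) r : set (cpath R) :=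
  [set w | exists2 u, r <= u & f (w u) <= 0].

Lemma comp_within (f : R -> R) (g : R -> R) (A : set R) :
  continuous f -> {within A, continuous g} ->
  {within A, continuous (fun x => f (g x))}.
Proof.
move=> cf /subspace_continuousP cg; apply/subspace_continuousP => x Ax.
by apply: (cvg_comp _ _ (cg x Ax)); exact: cf.
Qed.

Lemma hits_past (f : R -> R) r t : continuous f -> 0 <= r -> past t (hits f r t).
Proof.
move=> cf r0; have sp := past_salgebra t.
have [rt|tr] := leP r t; last first.
  rewrite (_ : hits f r t = set0); first exact: salgebra0.
  by apply/seteqP; split=> // w [u /andP[ru ut]]; have := lt_le_trans tr (le_trans ru ut); rewrite ltxx.
apply: (@hit_sigma_algebra _ _ _ (fun u w => f (w u))) => //.
  by move=> w; apply: comp_within => //; exact: cpath_within.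
move=> u /andP[ru ut] B mB.
apply: (@past_eval t u _ (f @^-1` B)); first by rewrite ut (le_trans r0).
rewrite -[X in measurable X]setTI; apply: continuous_measurable_fun => //.
Qed.

Lemma hits_measurable (f : R -> R) r t : continuous f -> 0 <= r ->
  @measurable _ (path_space R) (hits f r t).
Proof. by move=> cf r0; apply: (@past_measurable t); exact: hits_past. Qed.

Lemma hits_afterE (f : R -> R) r : hits_after f r = \bigcup_(n : nat) hits f r n%:R.
Proof.
apply/seteqP; split=> w.
  move=> [u ru fu].
  exists (Num.truncn u).+1 => //; exists u => //; rewrite ru ltW//.
  exact: truncnS_gt.
by move=> [n _ [u /andP[ru _] fu]]; exists u.
Qed.

Lemma hits_after_measurable (f : R -> R) r : continuous f -> 0 <= r ->
  @measurable _ (path_space R) (hits_after f r).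
Proof.
move=> cf r0; rewrite hits_afterE; apply: bigcupT_measurable => n.
exact: hits_measurable.
Qed.

Lemma hits_after_shift (f : R -> R) r w : 0 <= r ->
  hits_after f 0 (shift_path r w) <-> hits_after f r w.
Proof.
move=> r0; split=> -[u u0] /=.
  rewrite max_l// => fu; exists (r + u) => //; lra.
by move=> fu; exists (u - r); [lra|rewrite /= max_l// addrC subrK].
Qed.

Definition passage (f : R -> R) r w : \bar R :=
  ereal_inf (EFin @` [set u | r <= u /\ f (w u) <= 0]).

Lemma passage_closed (f : R -> R) r w : continuous f -> 0 <= r ->
  closed [set u | r <= u /\ f (w u) <= 0].
Proof.
move=> cf r0.
rewrite (_ : [set u | _] = [set u | r <= u] `&`
    (fun u => f (w (Num.max u 0))) @^-1` [set v | v <= 0]).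
  apply: closedI; first exact: closed_ge.
  apply: preimage_closed; last exact: closed_le.
  move=> u _; apply: (@continuous_comp _ _ _ (fun u => w (Num.max u 0)) f).
    exact: cpath_ext_continuous.
  exact: cf.
by apply/seteqP; split=> u /= [ru]; rewrite max_l// (le_trans r0).
Qed.

Lemma passage_le (f : R -> R) r w t : continuous f -> 0 <= r ->
  (passage f r w <= t%:E)%E <-> hits f r t w.
Proof.
move=> cf r0.
have := @ereal_inf_closed_le _ _ t (@passage_closed f r w cf r0) => ->.
  split=> [[u [ru fu] ut]|[u /andP[ru ut] fu]]; last by exists u.
  by exists u => //; rewrite ru.
by move=> u [ru _]; exact: le_trans ru.
Qed.

Lemma passage_ge (f : R -> R) r w : (r%:E <= passage f r w)%E.
Proof. by apply: le_ereal_inf_tmp => _ [u [ru _] <-]; rewrite lee_fin. Qed.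

Lemma passage_fin (f : R -> R) r w : continuous f -> 0 <= r -> (passage f r w < +oo)%E ->
  [/\ passage f r w = (fine (passage f r w))%:E, r <= fine (passage f r w) &
      f (w (fine (passage f r w))) <= 0].
Proof.
move=> cf r0; have := passage_ge f r w; case E : (passage f r w) => [u| |] //= ru _.
have /(passage_le _ _ cf r0) [v /andP[rv vu] fv] : (passage f r w <= u%:E)%E.
  by rewrite E.
have uv : u <= v.
  rewrite -lee_fin -E; apply: ereal_inf_lbound; exists v => //.
have <- : v = u by apply/eqP; rewrite eq_le uv vu.
by split.
Qed.

Lemma passage_ltyP (f : R -> R) r w : continuous f -> 0 <= r ->
  (passage f r w < +oo)%E <-> hits_after f r w.
Proof.
move=> cf r0; split.
  move=> /(passage_fin cf r0)[_ h1 h2]; by exists (fine (passage f r w)).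
move=> [u ru fu]; apply: (@le_lt_trans _ _ u%:E); last exact: ltry.
by apply: ereal_inf_lbound; exists u.
Qed.

End paths.

(** The integral of a nonnegative function is a supremum over simple functions below it, hence
    monotone without measurability. It is applied to the integrand of the strong Markov property,
    whose measurability as a function of w has not been established. *)
Lemma le_integral_nonmeasurable d (T : measurableType d) (R : realType)
    (mu : {measure set T -> \bar R}) (D : set T) (f g : T -> \bar R) :
  (forall x, D x -> 0 <= f x)%E -> (forall x, D x -> f x <= g x)%E ->
  (\int[mu]_(x in D) f x <= \int[mu]_(x in D) g x)%E.
Proof.
move=> f0 fg; rewrite !ge0_integralE//; last first.
  by move=> x Dx; exact: le_trans (f0 x Dx) (fg x Dx).
apply: le_ereal_sup => _ [h hf <-]; exists h => // x.
apply: le_trans (hf x) _; rewrite !patchE; case: ifPn => // /set_mem.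
exact: fg.
Qed.

Lemma ae_forall_nat d (T : measurableType d) (R : realType)
    (mu : {measure set T -> \bar R}) (Q : nat -> T -> Prop) :
  (forall n, {ae mu, forall x, Q n x}) -> {ae mu, forall x, forall n, Q n x}.
Proof.
move=> h; have := @negligible_bigcup _ _ _ mu (fun n => ~` (Q n)) h.
apply: negligibleS => x; rewrite /setC /= => /existsNP[n nQ].
by exists n.
Qed.

(** * Recurrent and convergent paths *)

Section path_geometry.
Context (R : realType).
Implicit Types (w : cpath R) (I : set R).

Definition dist_itv (c e : R) : R -> R := fun v => Num.max (c - v) (v - e).

Lemma dist_itv_le0 (c e v : R) : (dist_itv c e v <= 0) = (c <= v <= e).
Proof. by rewrite /dist_itv ge_max !subr_le0. Qed.

Lemma dist_itv_continuous (c e : R) : continuous (dist_itv c e).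
Proof.
move=> v; apply: (@continuous_max _ _ (fun v => c - v) (fun v => v - e)).
  by apply: cvgB; [exact: cvg_cst|exact: cvg_id].
by apply: cvgB; [exact: cvg_id|exact: cvg_cst].
Qed.

Definition reach (z : R) : R -> R := dist_itv z z.

Lemma reach_le0 (z v : R) : (reach z v <= 0) = (v == z).
Proof. by rewrite dist_itv_le0 eq_le andbC. Qed.

Lemma reach_continuous (z : R) : continuous (reach z).
Proof. exact: dist_itv_continuous. Qed.

Lemma hits_reachP (z r : R) w :
  hits_after (reach z) r w <-> exists2 u, r <= u & w u = z.
Proof.
by split=> -[u ru]; [rewrite reach_le0 => /eqP|move/eqP; rewrite -reach_le0];
  exists u.
Qed.

Lemma path_ivt w (r t x : R) : 0 <= r -> r <= t ->
  (w r <= x <= w t \/ w t <= x <= w r) -> exists2 u, r <= u <= t & w u = x.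
Proof.
move=> r0 rt h; have [|u] := @IVT R w r t x rt (@cpath_within R w r t r0).
  by rewrite ge_min le_max; case: h => /andP[-> ->]; rewrite ?orbT.
by rewrite in_itv /= => urt wu; exists u.
Qed.

Lemma interior_itvP I (z : R) : is_interval I ->
  I° z <-> exists v1 v2, [/\ I v1, I v2, v1 < z & z < v2].
Proof.
move=> itvI; split.
  move=> /nbhs_ballP[e /= e0 eI]; exists (z - e / 2), (z + e / 2).
  have e20 : 0 < e / 2 by rewrite divr_gt0.
  split; [apply: eI|apply: eI|lra|lra]; rewrite /ball /= ltr_norml; lra.
move=> [v1 [v2 [I1 I2 z1 z2]]].
apply/nbhs_ballP; exists (Num.min (z - v1) (v2 - z)) => /=.
  by rewrite lt_min !subr_gt0 z1.
move=> v; rewrite /ball /= lt_min => /andP[/dist_lt[h1 h2] /dist_lt[h3 h4]].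
by apply: (itvI _ _ I1 I2); rewrite /=; apply/andP; split; lra.
Qed.

Definition visits_io (f : R -> R) : set (cpath R) :=
  [set w | forall n : nat, hits_after f n%:R w].

Definition recurrent_path I : set (cpath R) :=
  [set w | forall z, I z -> visits_io (reach z) w].

(** Convergence to the left end, phrased with interior levels so that an end at -oo is included. An
    end that belongs to I must moreover be reached at a finite time. *)
Definition path_to_left_end I : set (cpath R) := [set w : cpath R |
  (forall a, I° a -> exists n : nat, forall u, n%:R <= u -> w u < a) /\
  (forall a, I a -> (forall v, I v -> a <= v) -> hits_after (reach a) 0 w)].

Definition path_to_right_end I : set (cpath R) := [set w : cpath R |
  (forall b, I° b -> exists n : nat, forall u, n%:R <= u -> b < w u) /\
  (forall b, I b -> (forall v, I v -> v <= b) -> hits_after (reach b) 0 w)].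

(* A countable dense set of levels, together with the end points of I. *)
Definition levels I (y : R) (n : nat) : R :=
  match unpickle n : option (rat + bool)%type with
  | Some (inl q) => ratr q
  | Some (inr b) => if b then inf I else sup I
  | None => y
  end.

Lemma levels_rat I y q : exists n, levels I y n = ratr q.
Proof.
exists (pickle (inl q : (rat + bool)%type)).
by rewrite /levels pickleK.
Qed.

Lemma levels_inf I y : exists n, levels I y n = inf I.
Proof.
exists (pickle (inr true : (rat + bool)%type)).
by rewrite /levels pickleK.
Qed.

Lemma levels_sup I y : exists n, levels I y n = sup I.
Proof.
exists (pickle (inr false : (rat + bool)%type)).
by rewrite /levels pickleK.
Qed.

Lemma inf_minimal I (a : R) : I a -> (forall v, I v -> a <= v) -> inf I = a.
Proof.
move=> Ia aI; apply/eqP; rewrite eq_le; apply/andP; split.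
  by apply: ge_inf => //; exists a.
by apply: lb_le_inf => //; exists a.
Qed.

Lemma sup_maximal I (b : R) : I b -> (forall v, I v -> v <= b) -> sup I = b.
Proof.
move=> Ib bI; apply/eqP; rewrite eq_le; apply/andP; split.
  by apply: ge_sup => //; exists b.
by apply: ub_le_sup => //; exists b.
Qed.

Lemma interior_rat I (v z : R) : is_interval I -> I v -> I° z -> v < z ->
  exists q : rat, [/\ v < ratr q, ratr q < z & I° (ratr q)].
Proof.
move=> itvI Iv /(interior_itvP _ itvI)[v1 [v2 [I1 I2 h1 h2]]] vz.
have /rat_in_itvoo[q] := vz; rewrite in_itv /= => /andP[vq qz].
by exists q; split => //; apply/(interior_itvP _ itvI); exists v, v2; split => //; lra.
Qed.

Lemma interior_rat_gt I (v z : R) : is_interval I -> I v -> I° z -> z < v ->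
  exists q : rat, [/\ z < ratr q, ratr q < v & I° (ratr q)].
Proof.
move=> itvI Iv /(interior_itvP _ itvI)[v1 [v2 [I1 I2 h1 h2]]] vz.
have /rat_in_itvoo[q] := vz; rewrite in_itv /= => /andP[vq qz].
by exists q; split => //; apply/(interior_itvP _ itvI); exists v1, v; split => //; lra.
Qed.

(** The three transfer hypotheses concern countably many levels only, so that they can hold almost
    surely together. If one interior rational level is visited at arbitrarily large times, all
    levels are, and the path is recurrent. Otherwise the path finally leaves every band between y
    and an interior rational level; by continuity it stays on one side and passes every level
    there. *)
Lemma path_dichotomy I (y : R) w : is_interval I -> I° y ->
  (forall t, 0 <= t -> I (w t)) ->
  (forall n, I (levels I y n) -> levels I y n <= y ->
    visits_io (dist_itv (levels I y n) y) w ->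
    visits_io (reach (levels I y n)) w) ->
  (forall n, I (levels I y n) -> y <= levels I y n ->
    visits_io (dist_itv y (levels I y n)) w ->
    visits_io (reach (levels I y n)) w) ->
  (forall n m, I° (levels I y n) -> I (levels I y m) ->
    visits_io (reach (levels I y n)) w -> visits_io (reach (levels I y m)) w) ->
  [\/ recurrent_path I w, path_to_left_end I w | path_to_right_end I w].
Proof.
move=> itvI Iy Iw down up all.
have [rec|nrec] := pselect (recurrent_path I w); first by constructor 1.
(* A level z that is not an end point lies between two rational levels of I. Both are visited at
   arbitrarily large times, so z is crossed in between. End points of I are themselves among the
   [levels]. *)
have nint q : I° (ratr q) -> ~ visits_io (reach (ratr q)) w.
  have [n <-] := levels_rat I y q => Iq wq; apply: nrec => z Iz.
  have wall m := all n m Iq ^~ wq.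
  have wrat r : I (ratr r) -> visits_io (reach (ratr r)) w.
    by have [m <-] := levels_rat I y r => /wall.
  have [zmin|/existsNP[v1 /not_implyP[I1 /negP]]] :=
      pselect (forall v, I v -> z <= v).
    by rewrite -(inf_minimal Iz zmin); have [m mE] := levels_inf I y;
      rewrite -mE; apply: wall; rewrite mE (inf_minimal Iz zmin).
  rewrite -ltNge => v1z.
  have [zmax|/existsNP[v2 /not_implyP[I2 /negP]]] :=
      pselect (forall v, I v -> v <= z).
    by rewrite -(sup_maximal Iz zmax); have [m mE] := levels_sup I y;
      rewrite -mE; apply: wall; rewrite mE (sup_maximal Iz zmax).
  rewrite -ltNge => v2z j; apply/hits_reachP.
  have /rat_in_itvoo[q1] := v1z; rewrite in_itv/= => /andP[vq1 q1z].
  have /rat_in_itvoo[q2] := v2z; rewrite in_itv/= => /andP[zq2 q2v].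
  have /wrat/(_ j)/hits_reachP[u1 ju1 wu1] : I (ratr q1).
    by apply: (itvI _ _ I1 Iz); apply/andP; split; lra.
  have /wrat/(_ (Num.truncn u1).+1)/hits_reachP[u2 ju2 wu2] : I (ratr q2).
    by apply: (itvI _ _ Iz I2); apply/andP; split; lra.
  have u12 : u1 <= u2 by rewrite (le_trans _ ju2)// ltW// truncnS_gt.
  have u10 : 0 <= u1 by rewrite (le_trans _ ju1).
  have [|u /andP[uu1 _] wu] := @path_ivt w u1 u2 z u10 u12.
    by left; rewrite wu1 wu2 !ltW.
  by exists u => //; exact: le_trans uu1.
have away_left q : I° (ratr q) -> ratr q <= y ->
    exists n : nat, forall u, n%:R <= u -> w u < ratr q \/ y < w u.
  move=> Iq qy.
  have : ~ visits_io (dist_itv (ratr q) y) w.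
    have [n nE] := levels_rat I y q.
    have := down n; rewrite nE => h io; apply: (nint _ Iq).
    exact: h (interior_subset Iq) qy io.
  move=> /existsNP[n nn]; exists n => u nu.
  have [|h1] := ltP (w u) (ratr q); first by left.
  have [|h2] := ltP y (w u); first by right.
  by exfalso; apply: nn; exists u => //; rewrite dist_itv_le0 h1.
have away_right q : I° (ratr q) -> y <= ratr q ->
    exists n : nat, forall u, n%:R <= u -> w u < y \/ ratr q < w u.
  move=> Iq qy.
  have : ~ visits_io (dist_itv y (ratr q)) w.
    have [n nE] := levels_rat I y q.
    have := up n; rewrite nE => h io; apply: (nint _ Iq).
    exact: h (interior_subset Iq) qy io.
  move=> /existsNP[n nn]; exists n => u nu.
  have [|h1] := ltP (w u) y; first by left.
  have [|h2] := ltP (ratr q) (w u); first by right.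
  by exfalso; apply: nn; exists u => //; rewrite dist_itv_le0 h1.
have /(interior_itvP _ itvI)[v1 [v2 [I1 I2 v1y yv2]]] := Iy.
have [q1 [vq1 q1y Iq1]] := interior_rat itvI I1 Iy v1y.
have [q2 [yq2 q2v Iq2]] := interior_rat_gt itvI I2 Iy yv2.
have [n1 away1] := away_left _ Iq1 (ltW q1y).
have [n2 away2] := away_right _ Iq2 (ltW yq2).
pose N := maxn n1 n2.
have N1 (u : R) : N%:R <= u -> n1%:R <= u.
  by apply: le_trans; rewrite ler_nat leq_maxl.
have N2 (u : R) : N%:R <= u -> n2%:R <= u.
  by apply: le_trans; rewrite ler_nat leq_maxr.
(* From time N on, the path avoids the closed band from q1 to q2. It cannot jump over it, so its
   side at time N decides its side for ever. *)
have side u : N%:R <= u -> w u < ratr q1 \/ ratr q2 < w u.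
  move=> Nu; have [|?] := away1 _ (N1 _ Nu); first by left.
  by have [?|] := away2 _ (N2 _ Nu); [lra|right].
have N0 : 0 <= N%:R :> R by [].
have [wN|wN] := side _ (lexx _).
- constructor 2; have left u : N%:R <= u -> w u < ratr q1.
    move=> Nu; have [//|wu] := side _ Nu.
    have [|v /andP[Nv _] wv] := @path_ivt w N%:R u (ratr q1) N0 Nu.
      by left; rewrite !ltW//; lra.
    by have [] := side _ Nv; rewrite wv; lra.
  split=> [a Ia|a Ia amin].
    have /(interior_itvP _ itvI)[a1 [a2 [J1 J2 a1a aa2]]] := Ia.
    have [ay|ya] := ltP (ratr q1) a.
      by exists N => u /left; lra.
    have [q' [aq' q'a Iq']] := interior_rat itvI J1 Ia a1a.
    have q'q1 : ratr q' < ratr q1 :> R by lra.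
    have [n away] := away_left _ Iq' (ltW (lt_trans q'q1 q1y)).
    exists (maxn n N) => u nu.
    have /away : n%:R <= u by apply: le_trans nu; rewrite ler_nat leq_maxl.
    have /left : N%:R <= u by apply: le_trans nu; rewrite ler_nat leq_maxr.
    by move=> ? []; lra.
  have [n nE] := levels_inf I y; have aE := inf_minimal Ia amin.
  have := down n; rewrite nE aE => /(_ Ia (amin _ (interior_subset Iy))).
  (* If the left end a is a state, the path, being finally below y, stays in the band [a, y]; the
     transfer hypothesis for that band makes it reach a. *)
  suff io : visits_io (dist_itv a y) w by move=> /(_ io 0%N).
  move=> j; exists (Num.max j%:R N%:R); first by rewrite le_max lexx.
  have NM : N%:R <= Num.max j%:R N%:R :> R by rewrite le_max lexx orbT.
  rewrite dist_itv_le0; have := left _ NM.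
  have /amin : I (w (Num.max j%:R N%:R)) by apply: Iw; exact: le_trans NM.
  by move=> -> ?; apply: ltW; lra.
- constructor 3; have right u : N%:R <= u -> ratr q2 < w u.
    move=> Nu; have [wu|//] := side _ Nu.
    have [|v /andP[Nv _] wv] := @path_ivt w N%:R u (ratr q1) N0 Nu.
      by right; rewrite !ltW//; lra.
    by have [] := side _ Nv; rewrite wv; lra.
  split=> [a Ia|a Ia amax].
    have /(interior_itvP _ itvI)[a1 [a2 [J1 J2 a1a aa2]]] := Ia.
    have [ay|ya] := ltP a (ratr q2).
      by exists N => u /right; lra.
    have [q' [aq' q'a Iq']] := interior_rat_gt itvI J2 Ia aa2.
    have yq' : y <= ratr q' by lra.
    have [n away] := away_right _ Iq' yq'.
    exists (maxn n N) => u nu.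
    have /away : n%:R <= u by apply: le_trans nu; rewrite ler_nat leq_maxl.
    have /right : N%:R <= u by apply: le_trans nu; rewrite ler_nat leq_maxr.
    by move=> ? []; lra.
  have [n nE] := levels_sup I y; have aE := sup_maximal Ia amax.
  have := up n; rewrite nE aE => /(_ Ia (amax _ (interior_subset Iy))).
  suff io : visits_io (dist_itv y a) w by move=> /(_ io 0%N).
  move=> j; exists (Num.max j%:R N%:R); first by rewrite le_max lexx.
  have NM : N%:R <= Num.max j%:R N%:R :> R by rewrite le_max lexx orbT.
  rewrite dist_itv_le0; have := right _ NM.
  have /amax : I (w (Num.max j%:R N%:R)) by apply: Iw; exact: le_trans NM.
  by move=> -> ?; rewrite andbT ltW//; lra.
Qed.

End path_geometry.

Lemma kernel_setC d d' (X : measurableType d) (Z : measurableType d')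
    (R : realType) (k : R.-pker X ~> Z) x (A : set Z) :
  measurable A -> k x (~` A) = (1 - k x A)%E.
Proof.
move=> mA; have kA1 : (k x A <= 1)%E.
  by rewrite -(prob_kernel (s := k) x) le_measure ?inE.
have kAfin : k x A \is a fin_num.
  by rewrite ge0_fin_numE//; apply: le_lt_trans kA1 _; exact: ltry.
rewrite -(prob_kernel (s := k) x) -(setUv A) measureU//; last 2 first.
- exact: measurableC.
- exact: setICr.
by rewrite addeAC subee// add0e.
Qed.

(** * Almost sure behaviour of the paths of the diffusion *)

Section diffusion_paths.
Context d (T : measurableType d) (R : realType) (P : probability T R).
Variables (F : R -> set (set T)) (I : set R) (y : R).
Variables (Y : T -> path_space R) (k : R.-pker R ~> path_space R).
Hypothesis filF : filtration F.
Hypothesis diffY : regular_diffusion P F I y Y k.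

Lemma filtration_salgebra t : 0 <= t -> sigma_algebra setT (F t).
Proof. by move=> t0; have [/(_ t t0)[]] := filF. Qed.

Lemma filtration_measurable t A : 0 <= t -> F t A -> measurable A.
Proof. by move=> t0; have [/(_ t t0)[_ +] _] := filF; exact. Qed.

Lemma past_adapted t E : 0 <= t -> past t E -> F t (Y @^-1` E).
Proof.
move=> t0; have sF := filtration_salgebra t0.
move: E; apply: smallest_sub; [|move=> _ [u [B [u0 ut mB ->]]]]; last first.
  have [_ incF] := filF; apply: (incF u t u0 ut).
  exact: (diffusion_adapted diffY u0).
  split => [|A FA|A FA] /=.
  - by rewrite preimage_set0; exact: salgebra0 sF.
  - by rewrite setTD preimage_setC; exact: salgebraC sF _ FA.
  - by rewrite preimage_bigcup; exact: salgebra_bigcup sF _ FA.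
Qed.

Lemma measurable_diffusion : measurable_fun setT Y.
Proof.
move=> _ E mE; rewrite setTI.
have YE : @measurable _ (path_space R) `<=` [set E | measurable (Y @^-1` E)].
  apply: smallest_sub; last first.
    move=> _ [u [B [u0 mB] ->]].
    apply: (filtration_measurable u0).
    exact: (diffusion_adapted diffY u0).
  split => [|A FA|A FA] /=.
  - by rewrite preimage_set0.
  - by rewrite setTD preimage_setC; exact: measurableC.
  - by rewrite preimage_bigcup; exact: bigcupT_measurable.
exact: YE.
Qed.

Lemma measurable_path_event (E : set (path_space R)) :
  measurable E -> measurable (Y @^-1` E).
Proof. by move=> mE; rewrite -[_ @^-1` _]setTI; exact: measurable_diffusion. Qed.

Lemma passage_stopping f r : continuous f -> 0 <= r ->
  stopping_time F (fun w => passage f r (Y w)).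
Proof.
move=> cf r0; split=> [w|t t0].
  by apply: le_trans (passage_ge f r (Y w)); rewrite lee_fin.
rewrite (_ : [set w | _] = Y @^-1` (hits f r t)).
  by apply: past_adapted => //; exact: hits_past.
by apply/seteqP; split=> w /=; move/passage_le; apply.
Qed.

(** The passage time is at least r, so for t < r the event to be checked is empty, and for t >= r
    the path up to r is known. *)
Lemma past_stopped_events f r E : continuous f -> 0 <= r -> past r E ->
  stopped_events F (fun w => passage f r (Y w)) (Y @^-1` E).
Proof.
move=> cf r0 pE; split; first exact: measurable_path_event (past_measurable pE).
move=> t t0; have sF := filtration_salgebra t0.
have [_ st] := passage_stopping cf r0.
have [rt|tr] := leP r t.
  apply: salgebraI => //; last exact: st.
  by have [_ incF] := filF; apply: (incF r) => //; exact: past_adapted.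
rewrite (_ : _ `&` _ = set0); first exact: salgebra0 sF.
apply/seteqP; split=> // w [_ /= h].
have := le_trans (passage_ge f r (Y w)) h; rewrite lee_fin => /(lt_le_trans tr).
by rewrite ltxx.
Qed.

Lemma stopping_measurable tau : stopping_time F tau ->
  forall t, measurable [set w | (tau w <= t%:E)%E].
Proof.
move=> [tau0 stop] t; have [t0|t0] := leP 0 t.
  exact: filtration_measurable (stop t t0).
rewrite (_ : [set w | _] = set0)//; apply/seteqP; split=> // w /= h.
by have := le_trans (tau0 w) h; rewrite lee_fin leNgt t0.
Qed.

Lemma stopping_fin tau w : stopping_time F tau -> (tau w < +oo)%E ->
  tau w = (fine (tau w))%:E /\ 0 <= fine (tau w).
Proof. by move=> [tau0 _]; have := tau0 w; case: (tau w). Qed.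

Lemma stopping_measurable_fin tau : stopping_time F tau ->
  measurable [set w | (tau w < +oo)%E].
Proof.
move=> stop.
rewrite (_ : [set w | _] = \bigcup_(n : nat) [set w | (tau w <= n%:R%:E)%E]).
  by apply: bigcupT_measurable => n; exact: stopping_measurable.
apply/seteqP; split=> w /=.
  move=> /(stopping_fin stop)[tauE _].
  exists (Num.truncn (fine (tau w))).+1 => //=.
  by rewrite tauE lee_fin ltW// truncnS_gt.
by move=> [n _ /=] h; apply: le_lt_trans h _; exact: ltry.
Qed.

(** The hitting event of the path shifted by a random time is written with rational times q, tau <=
    q <= N, at which g is below 1/(n+1). The bound N, chosen before n, gives the compactness that
    produces an actual zero from approximate ones. *)
Lemma measurable_hits_after_stopping (g : R -> R) tau : continuous g ->
  stopping_time F tau ->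
  measurable [set w | (tau w < +oo)%E /\ hits_after g (fine (tau w)) (Y w)].
Proof.
move=> cg stop.
rewrite (_ : [set w | _] = \bigcup_(N : nat) \bigcap_(n : nat) \bigcup_(q : rat)
   ([set w | (tau w <= (ratr q)%:E)%E] `&`
   [set w | ((0 <= ratr q :> R) && (ratr q <= N%:R :> R)) /\ g (Y w (ratr q)) < n.+1%:R^-1])).
  apply: bigcupT_measurable => N; apply: bigcapT_measurable => n.
  apply: bigcupT_measurable_rat => q.
  apply: measurableI; first exact: stopping_measurable.
  have [q0|q0] := boolP ((0 <= ratr q :> R) && (ratr q <= N%:R :> R)); last first.
    rewrite (_ : [set w | _] = set0)//; apply/seteqP; split=> // w /=.
    by case.
  have /andP[q00 _] := q0.
  have mg : measurable (g @^-1` `]-oo, n.+1%:R^-1[).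
    rewrite -[X in measurable X]setTI; apply: continuous_measurable_fun => //.
  have := diffusion_adapted diffY q00 mg => /(filtration_measurable q00).
  congr measurable; apply/seteqP; split=> w /=; rewrite in_itv/=.
    by move=> ?; split.
  by case.
apply/seteqP; split=> w /=.
  move=> [/(stopping_fin stop)]; move: (fine _) => s [te s0] [u su gu].
  (* The integer part plus 2 leaves room after u for a rational time in (u, u + 1). *)
  exists (Num.truncn u).+2 => // n _.
  have u0 := le_trans s0 su.
  have n0 : 0 < n.+1%:R^-1 :> R by rewrite invr_gt0.
  have ut : u < (Num.truncn u).+1%:R by exact: truncnS_gt.
  have tt : (Num.truncn u).+2%:R = (Num.truncn u).+1%:R + 1 :> R by rewrite -natr1.
  have cgw : {within `[0, (Num.truncn u).+2%:R], continuous (fun v => g (Y w v))}.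
    by apply: comp_within => //; exact: cpath_within.
  have [|e e0 eP] := within_itv_ball (u := u) cgw _ n0; first lra.
  have /rat_in_itvoo[q] : u < u + Num.min e 1 by rewrite ltrDl lt_min e0 ltr01.
  rewrite in_itv/= => /andP[uq qe].
  have [qe1 q1] : ratr q < u + e /\ ratr q < u + 1 :> R.
    by split; apply: (lt_le_trans qe); rewrite lerD2l ge_min lexx ?orbT.
  exists q => //; split=> /=; first by rewrite te lee_fin; lra.
  have q01 : 0 <= (ratr q : R) <= (Num.truncn u).+2%:R by rewrite tt; lra.
  split => //; have : `|u - ratr q| < e by rewrite ltr_norml; lra.
  by move=> /(eP _ q01)/dist_lt[_ h]; apply: (lt_le_trans h); rewrite gerDr.
move=> [N _ hN].
have [q _ /= [tq [/andP[q0 qN] _]]] := hN 0%N Logic.I.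
have tfin : (tau w < +oo)%E by apply: le_lt_trans tq _; exact: ltry.
split => //; have [te t0] := stopping_fin stop tfin.
move: tq te t0; move: (fine _) => s tq te s0.
move: tq; rewrite te lee_fin => sq; have sN := le_trans sq qN.
have [v vsN vmin] := EVT_min sN (comp_within cg (@cpath_within R (Y w) s N%:R s0)).
move: vsN; rewrite in_itv/= => /andP[sv vN].
exists v => //; rewrite leNgt; apply/negP => pu.
have [n /= ltn] : exists n, n.+1%:R^-1 < g (Y w v).
  by have := @near_infty_natSinv_lt R (PosNum pu); move=> [M _ /(_ M (leqnn M))]; exists M.
have [p _ /= [sp [/andP[_ pN] gp]]] := hN n Logic.I; move: sp; rewrite te lee_fin => sp.
have /vmin h : ratr p \in `[s, N%:R] by rewrite in_itv/= sp.
by have := lt_trans (le_lt_trans h gp) ltn; rewrite ltxx.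
Qed.

Lemma shifted_hits (g : R -> R) tau : stopping_time F tau ->
  [set w | (tau w < +oo)%E] `&`
    [set w | hits_after g 0 (shift_path (fine (tau w)) (Y w))] =
  [set w | (tau w < +oo)%E /\ hits_after g (fine (tau w)) (Y w)].
Proof.
move=> stop; apply/seteqP; split=> w [/= h1 h2]; split=> //;
  by apply/(hits_after_shift g (Y w) (stopping_fin stop h1).2).
Qed.

(* If g is reached with probability at least delta from every point of a set K,
   a path cannot visit K at arbitrarily large times and avoid g from some time
   on: the conditional probability of that event, seen from the first visit of
   K after n, tends to 1 and is at most 1 - delta. *)
Lemma recurrence_transfer (f g : R -> R) (delta : R) :
  continuous f -> continuous g -> 0 < delta ->
  (forall x, I x -> f x <= 0 -> (delta%:E <= k x (hits_after g 0))%E) ->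
  {ae P, forall w, visits_io f (Y w) -> visits_io g (Y w)}.
Proof.
move=> cf cg delta0 kfg.
suff h (r : nat) : {ae P, forall w, visits_io f (Y w) ->
    hits_after g r%:R (Y w)}.
  by have := ae_forall_nat h; apply: filterS => w hw hf r; exact: hw.
(* On [B n] the target g is avoided between r and n + r, and f <= 0 occurs after n + r. These events
   decrease to the exceptional event N. The bound P N <= (1 - delta) P (B n), valid for all n,
   passes to the limit as P N <= (1 - delta) P N, which forces P N = 0. *)
pose B n := Y @^-1` ((~` hits g r%:R (n + r)%:R) `&` hits_after f (n + r)%:R).
have mB n : measurable (B n).
  apply: measurable_path_event; apply: measurableI.
    by apply: measurableC; exact: hits_measurable.
  exact: hits_after_measurable.
pose N := \bigcap_n B n.
have mN : measurable N by exact: bigcapT_measurable.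
have key n : (P N <= (1 - delta)%:E * P (B n))%E.
  pose m : R := (n + r)%:R.
  (* The strong Markov property is used at the first visit of {f <= 0} after m = n + r. The past
     event, no visit of g up to m, belongs to the stopped events because that visit comes after
     m. *)
  have m0 : 0 <= m by [].
  pose sigma w := passage f m (Y w).
  have stop : stopping_time F sigma by exact: passage_stopping.
  have ev : stopped_events F sigma (Y @^-1` (~` hits g r%:R m)).
    apply: past_stopped_events => //; apply: (salgebraC (past_salgebra m)).
    exact: hits_past.
  have mE : measurable (~` hits_after g 0 : set (path_space R)).
    by apply: measurableC; exact: hits_after_measurable.
  have := diffusion_strong_markov diffY stop ev mE.
  set A := _ `&` [set w | (sigma w < +oo)%E] => eqA.
  have AB : A = B n.
    apply/seteqP; split=> w [h1 h2]; split => //.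
      exact/(passage_ltyP _ cf m0).
    exact/(passage_ltyP _ cf m0).
  apply: (@le_trans _ _ (P (A `&`
      [set w | (~` hits_after g 0) (shift_path (fine (sigma w)) (Y w))]))).
    apply: le_measure; rewrite ?inE//.
      rewrite (_ : A `&` _ = A `\`
          [set w | (sigma w < +oo)%E /\ hits_after g (fine (sigma w)) (Y w)]).
        apply: measurableD; first by rewrite AB.
        exact: measurable_hits_after_stopping.
      rewrite -(shifted_hits _ stop); apply/seteqP; split=> w [Aw]; split => //.
        by case.
      by move=> h; apply: b; split => //; case: Aw.
    move=> w Nw; split; first by rewrite AB; exact: Nw.
    have [_ hf] := Nw n Logic.I.
    have /passage_fin := iffRL (passage_ltyP _ cf m0) hf => /(_ cf m0)[_ h1 _] /=.
    rewrite hits_after_shift; last exact: le_trans h1.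
    move=> [u su gu].
    have [hg _] := Nw (Num.truncn u).+1 Logic.I; apply: hg; exists u => //.
    apply/andP; split.
      apply: le_trans su; apply: le_trans h1.
      by rewrite /m ler_nat leq_addl.
    apply: (le_trans (ltW (truncnS_gt u))).
    by rewrite ler_nat leq_addr.
  rewrite eqA AB -[X in (_ <= X)%E](integral_cst P (mB n)).
  apply: le_integral_nonmeasurable => // w [_ Bw].
  have := iffRL (passage_ltyP _ cf m0) Bw => /(passage_fin cf m0)[_ h1 h2].
  rewrite kernel_setC; last exact: hits_after_measurable.
  rewrite EFinB leeB// kfg//.
  by apply: (state_values diffY); exact: le_trans h1.
have cvgB : P (B n) @[n --> \oo] --> P N.
  apply: nonincreasing_cvg_mu => //.
    by apply: le_lt_trans (probability_le1 _ (mB _)) _; exact: ltry.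
  apply/nonincreasing_seqP => n; apply/subsetPset => w [/= h1 [u nu fu]].
  have nn : (n + r)%:R <= (n.+1 + r)%:R :> R by rewrite ler_nat leq_add2r.
  split=> /=; last by exists u => //; exact: le_trans nu.
  apply: contra_not h1 => -[v /andP[rv vn] gv]; exists v => //.
  by rewrite rv/=; exact: le_trans nn.
have PN : (P N <= (1 - delta)%:E * P N)%E.
  have h : ((1 - delta)%:E * P (B n))%E @[n --> \oo] --> ((1 - delta)%:E * P N)%E.
    exact: cvgeZl.
  by apply: (cvge_ge _ h); exact: nearW.
exists N; split => //.
  move: PN; rewrite -(fineK (fin_num_measure P _ mN)) -EFinM lee_fin => PN.
  have : 0 <= fine (P N) by exact: fine_ge0.
  by move=> ?; congr (_%:E); nra.
move=> w /= /not_implyP[io ng] n _; split=> /=; last exact: io.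
by apply: contra_not ng => -[u /andP[ru _] gu]; exists u.
Qed.

(* A path from y to z passes through x. *)
Lemma kernel_reach_between (x z : R) : (y <= x <= z \/ z <= x <= y) ->
  (P (Y @^-1` hits_after (reach z) 0) <= k x (hits_after (reach z) 0))%E.
Proof.
move=> xyz; have cx := @reach_continuous R x; have cz := @reach_continuous R z.
have stop := passage_stopping cx (lexx 0).
pose sigma w := passage (reach x) 0 (Y w).
have ev : stopped_events F sigma setT.
  split=> // t t0; rewrite setTI; have [_] := stop; exact.
have mE := @hits_after_measurable R _ 0 cz (lexx 0).
have mS : measurable [set w | (sigma w < +oo)%E].
  rewrite (_ : [set w | _] = Y @^-1` hits_after (reach x) 0).
    by apply: measurable_path_event; exact: hits_after_measurable.
  by apply/seteqP; split=> w /=; move/passage_ltyP; apply.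
have := diffusion_strong_markov diffY stop ev mE; rewrite setTI => eqS.
have kx w : (sigma w < +oo)%E -> Y w (fine (sigma w)) = x.
  by move=> /(passage_fin cx (lexx 0))[_ _]; rewrite reach_le0 => /eqP.
apply: (@le_trans _ _ (P ([set w | (sigma w < +oo)%E] `&`
   [set w | hits_after (reach z) 0 (shift_path (fine (sigma w)) (Y w))]))).
  apply: le_measure; rewrite ?inE//.
  - exact: measurable_path_event.
  - rewrite shifted_hits//; exact: measurable_hits_after_stopping.
  move=> w /= /hits_reachP[u u0 wu].
  have [v /andP[v0 vu] wv] : exists2 v, 0 <= v <= u & Y w v = x.
    by apply: path_ivt => //; rewrite (starts_at diffY) wu.
  have hx : (passage (reach x) 0 (Y w) <= v%:E)%E.
    apply/(passage_le _ _ cx (lexx 0)); exists v; first by rewrite v0 lexx.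
    by rewrite reach_le0 wv.
  have fx : (passage (reach x) 0 (Y w) < +oo)%E by apply: le_lt_trans hx _; exact: ltry.
  have [e h1 h2] := passage_fin cx (lexx 0) fx.
  split => //; rewrite hits_after_shift//; apply/hits_reachP; exists u => //.
  by apply: le_trans vu; rewrite -lee_fin -e.
rewrite eqS (eq_integral (cst (k x (hits_after (reach z) 0)))); last first.
  by move=> w; rewrite inE => /kx ->.
rewrite integral_cst// -[X in (_ <= X)%E]mule1 lee_pmul//.
exact: probability_le1.
Qed.

(** The strong Markov property at the constant time 0. It carries regularity, a property of the
    kernel, over to Y. *)
Lemma diffusion_kernel_start (g : R -> R) : continuous g ->
  P (Y @^-1` hits_after g 0) = k y (hits_after g 0).
Proof.
move=> cg; have mE := @hits_after_measurable R g 0 cg (lexx 0).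
have stop : stopping_time F (cst 0%E).
  split=> // t t0; rewrite (_ : [set w | _] = setT).
    exact: (salgebraT (filtration_salgebra t0)).
  by apply/seteqP; split=> // w _ /=; rewrite lee_fin.
have ev : stopped_events F (cst 0%E) (setT : set T).
  split=> // t t0; rewrite setTI; have [_] := stop; exact.
have := diffusion_strong_markov diffY stop ev mE.
have -> : setT `&` [set w : T | (cst 0%E w < +oo :> \bar R)%E] = setT.
  by apply/seteqP; split=> // w _; split=> //=; exact: ltry.
rewrite setTI (eq_integral (cst (k y (hits_after g 0)))); last first.
  by move=> w _ /=; rewrite (starts_at diffY).
have := @integral_cst _ _ _ P setT measurableT (k y (hits_after g 0)).
have -> : (k y (hits_after g 0) * P setT = k y (hits_after g 0))%E.
  by rewrite -[RHS]mule1; congr (_ * _)%E; exact: probability_setT.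
move=> -> <-; congr (P _).
by apply/seteqP; split=> w /=; move/(hits_after_shift g (Y w) (lexx 0)).
Qed.

Lemma reach_eventE z : [set w : cpath R | exists2 t : R, 0 <= t & w t = z] =
  hits_after (reach z) 0.
Proof. by apply/seteqP; split=> w /=; move/hits_reachP. Qed.

Lemma diffusion_reach_gt0 z : I z -> (0 < P (Y @^-1` hits_after (reach z) 0))%E.
Proof.
move=> Iz; rewrite diffusion_kernel_start; last exact: reach_continuous.
rewrite -reach_eventE; apply: (diffusion_regular diffY) => //.
exact: start_interior diffY.
Qed.

(** The uniform lower bound [delta] required by [recurrence_transfer] has two sources. From every
    point between y and a level, the level is reached with at least the probability it has from y,
    by [kernel_reach_between]. From a single interior level, positivity is regularity itself. *)
Lemma ae_path_dichotomy :
  {ae P, forall w, [\/ recurrent_path I (Y w), path_to_left_end I (Y w) |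
                       path_to_right_end I (Y w)]}.
Proof.
pose L := levels I y.
have cd c e := @dist_itv_continuous R c e; have cr z := @reach_continuous R z.
have pos z : I z -> exists2 e : R, 0 < e &
    (e%:E <= P (Y @^-1` hits_after (reach z) 0))%E.
  move=> Iz; have := diffusion_reach_gt0 Iz.
  have mz : measurable (Y @^-1` hits_after (reach z) 0).
    by apply: measurable_path_event; exact: hits_after_measurable.
  rewrite -(fineK (fin_num_measure P _ mz)) lte_fin => p0.
  by eexists; [exact: p0|].
have down : {ae P, forall w, forall n, I (L n) -> L n <= y ->
    visits_io (dist_itv (L n) y) (Y w) -> visits_io (reach (L n)) (Y w)}.
  apply: ae_forall_nat => n.
  have [In|nIn] := pselect (I (L n)); last by apply: aeW => w /nIn.
  have [e e0 eP] := pos _ In.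
  have : {ae P, forall w, visits_io (dist_itv (L n) y) (Y w) ->
      visits_io (reach (L n)) (Y w)}.
    apply: (recurrence_transfer (cd _ _) (cr _) e0) => x Ix.
    rewrite dist_itv_le0 => /andP[h1 h2]; apply: le_trans eP _.
    by apply: kernel_reach_between; right; rewrite h1.
  by apply: filterS => w h _ _.
have up : {ae P, forall w, forall n, I (L n) -> y <= L n ->
    visits_io (dist_itv y (L n)) (Y w) -> visits_io (reach (L n)) (Y w)}.
  apply: ae_forall_nat => n.
  have [In|nIn] := pselect (I (L n)); last by apply: aeW => w /nIn.
  have [e e0 eP] := pos _ In.
  have : {ae P, forall w, visits_io (dist_itv y (L n)) (Y w) ->
      visits_io (reach (L n)) (Y w)}.
    apply: (recurrence_transfer (cd _ _) (cr _) e0) => x Ix.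
    rewrite dist_itv_le0 => /andP[h1 h2]; apply: le_trans eP _.
    by apply: kernel_reach_between; left; rewrite h1.
  by apply: filterS => w h _ _.
have all : {ae P, forall w, forall n m, I° (L n) -> I (L m) ->
    visits_io (reach (L n)) (Y w) -> visits_io (reach (L m)) (Y w)}.
  apply: ae_forall_nat => n; apply: ae_forall_nat => m.
  have [In|nIn] := pselect (I° (L n)); last by apply: aeW => w /nIn.
  have [Im|nIm] := pselect (I (L m)); last by apply: aeW => w _ /nIm.
  have := diffusion_regular diffY In Im; rewrite reach_eventE => k0.
  have kfin : k (L n) (hits_after (reach (L m)) 0) \is a fin_num.
    rewrite ge0_fin_numE//; apply: (@le_lt_trans _ _ 1%E); last exact: ltry.
    rewrite -(prob_kernel (s := k) (L n)) le_measure ?inE//.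
    exact: hits_after_measurable.
  have e0 : 0 < fine (k (L n) (hits_after (reach (L m)) 0)).
    by rewrite -lte_fin fineK.
  have : {ae P, forall w, visits_io (reach (L n)) (Y w) ->
      visits_io (reach (L m)) (Y w)}.
    apply: (recurrence_transfer (cr _) (cr _) e0) => x Ix.
    by rewrite reach_le0 => /eqP ->; rewrite fineK.
  by apply: filterS => w h _ _.
apply: filterS3 down up all => w h1 h2 h3.
apply: path_dichotomy h1 h2 h3; first exact: state_interval diffY.
  exact: start_interior diffY.
by move=> t t0; exact: (state_values diffY w t0).
Qed.

End diffusion_paths.

(** * Optional stopping *)

Section min_time.
Context (R : realType).
Implicit Types (t u : R) (r : \bar R).

Lemma min_timeE t r : 0 <= t -> (0 <= r)%E -> (min_time t r)%:E = mine t%:E r.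
Proof.
move=> t0; rewrite /min_time; case: r => [r| |]//= r0.
- by rewrite /mine; case: ifP.
- by rewrite /mine ltry.
Qed.

Lemma min_time_ge0 t r : 0 <= t -> (0 <= r)%E -> 0 <= min_time t r.
Proof. by move=> t0 r0; rewrite -lee_fin min_timeE// le_min r0 lee_fin t0. Qed.

Lemma min_time_lel t r : 0 <= t -> (0 <= r)%E -> min_time t r <= t.
Proof. by move=> t0 r0; rewrite -lee_fin min_timeE// ge_min lexx. Qed.

Lemma min_time_ler t r : 0 <= t -> (0 <= r)%E -> ((min_time t r)%:E <= r)%E.
Proof. by move=> t0 r0; rewrite min_timeE// ge_min lexx orbT. Qed.

Lemma min_time_idl t r : 0 <= t -> (t%:E <= r)%E -> min_time t r = t.
Proof.
move=> t0 tr; apply: EFin_inj; rewrite min_timeE//; first by rewrite min_l.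
by apply: le_trans tr.
Qed.

Lemma min_time_idr t u : 0 <= u -> u <= t -> min_time t u%:E = u.
Proof.
move=> u0 ut; apply: EFin_inj; rewrite min_timeE//; last exact: le_trans ut.
by rewrite min_r.
Qed.

Lemma min_timeAC t r r' : 0 <= t -> (0 <= r)%E -> (0 <= r')%E ->
  min_time (min_time t r) r' = min_time (min_time t r') r.
Proof.
move=> t0 r0 r'0; apply: EFin_inj.
by rewrite !min_timeE ?min_time_ge0// minAC.
Qed.

Lemma min_time_continuous r : (0 <= r)%E ->
  continuous (fun v : R => min_time (Num.max v 0) r).
Proof.
have maxc : continuous (fun v : R => Num.max v 0).
  move=> v; apply: (@continuous_max _ _ id (fun=> 0)); first exact: cvg_id.
  exact: cvg_cst.
case: r => [r| |]// r0.
- rewrite (_ : (fun v : R => _) = (fun v : R => Num.min (Num.max v 0) r)).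
    move=> v; apply: (@continuous_min R R (fun v : R => Num.max v 0) (fun=> r)).
      exact: maxc.
    exact: cvg_cst.
  apply/funext => v; apply: EFin_inj; rewrite min_timeE ?le_max ?lexx ?orbT//.
  by rewrite EFin_min.
- rewrite (_ : (fun v : R => _) = (fun v : R => Num.max v 0)); first exact: maxc.
  apply/funext => v; apply: EFin_inj; rewrite min_timeE ?le_max ?lexx ?orbT//.
  by rewrite min_l// leey.
Qed.

End min_time.

Lemma restrict_realE (T : Type) (R : realType) (f : T -> R) (D : set T) w :
  (f \_ D) w = if w \in D then f w else 0.
Proof. by rewrite patchE. Qed.

Section bounded_integrals.
Context d (T : measurableType d) (R : realType) (P : probability T R).
Implicit Types (f : T -> R).

Lemma integrable_bounded f C : measurable_fun setT f ->
  (forall w, `|f w| <= C) -> P.-integrable setT (EFin \o f).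
Proof.
move=> mf fC.
apply: (le_integrable measurableT _ _ (finite_measure_integrable_cst P C measurableT)).
  exact/measurable_EFinP.
by move=> w _ /=; rewrite lee_fin (le_trans (fC w))// ler_norm.
Qed.

Lemma cvg_Rintegral_bounded (f_ : nat -> T -> R) f C :
  (forall n, measurable_fun setT (f_ n)) -> measurable_fun setT f ->
  {ae P, forall w, f_ n w @[n --> \oo] --> f w} ->
  (forall n w, `|f_ n w| <= C) ->
  P.-integrable setT (EFin \o f) /\
  \int[P]_w f_ n w @[n --> \oo] --> \int[P]_w f w.
Proof.
move=> mf_ mf cvf fC.
have [|||||h1 _ h3] := @dominated_convergence _ _ _ P setT measurableT
  (fun n => EFin \o f_ n) (EFin \o f) (EFin \o cst C).
- by move=> n; exact/measurable_EFinP.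
- exact/measurable_EFinP.
- by apply: filterS cvf => w h _; apply: cvg_EFin => //; exact: nearW.
- exact: finite_measure_integrable_cst.
- by apply: aeW => w n _ /=; rewrite lee_fin.
split => //; apply: fine_cvg; move: h3.
by rewrite fineK//; exact: integrable_fin_num.
Qed.

Lemma Rintegral_partition (J : T -> nat) (n : nat) (h : nat -> T -> R) (G : set T) :
  (forall w, (J w < n)%N) -> (forall j, measurable [set w | J w = j]) ->
  (forall j, P.-integrable setT (EFin \o h j)) -> measurable G ->
  P.-integrable setT (EFin \o (fun w => h (J w) w)) /\
  \int[P]_(w in G) h (J w) w =
  \sum_(j < n) \int[P]_(w in G `&` [set w | J w = j]) h j w.
Proof.
move=> Jn mJ ih mG.
have E (B : set T) (w : T) : (((fun w => h (J w) w) \_ B) w)%:E =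
    (\sum_(j < n) ((h j \_ (B `&` [set w | J w = j])) w)%:E)%E.
  rewrite (bigD1 (Ordinal (Jn w)))//= big1 ?adde0.
    rewrite /patch; case: ifPn => wB; last first.
      case: ifPn => // ; rewrite inE => -[/mem_set]; by rewrite (negbTE wB).
    rewrite (_ : w \in _ = true)//; apply/mem_set; split => //; exact/set_mem.
  move=> j jJ; rewrite patchE; case: ifPn => //; rewrite inE => -[_ /= Jw].
  by move: jJ; rewrite -val_eqE /= Jw eqxx.
have ihB B j : measurable B -> P.-integrable setT
    (EFin \o (h j \_ (B `&` [set w | J w = j]))).
  move=> mB; have mBJ : measurable (B `&` [set w | J w = j]) by exact: measurableI.
  rewrite -restrict_EFin; apply/(integrable_mkcond _ mBJ).
  exact: integrableS (ih j).
split.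
  apply: (eq_integrable measurableT (fun w => \sum_(j < n)
     ((h j \_ (setT `&` [set w | J w = j])) w)%:E)%E).
    by move=> w _; rewrite -E patch_setT.
  by apply: integrable_sum => // j _; exact: ihB.
rewrite Rintegral_mkcond /Rintegral.
under eq_integral do rewrite E.
rewrite (integral_sum measurableT); last by move=> j; exact: ihB.
rewrite -sum_fine; last first.
  by move=> j _; apply: (integrable_fin_num measurableT); exact: ihB.
by apply: eq_bigr => j _; rewrite [in RHS]integral_mkcond restrict_EFin.
Qed.

End bounded_integrals.

Section optional_stopping.
Context d (T : measurableType d) (R : realType) (P : probability T R).
Variables (F : R -> set (set T)) (M : R -> T -> R).
Variables (sigma : T -> \bar R) (t : R).
Hypothesis filF : filtration F.
Hypothesis adM : forall u, 0 <= u -> measurable_wrt (F u) (M u).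
Hypothesis contM : forall w, continuous (fun v : R => M (Num.max v 0) w).
Hypothesis stop : stopping_time F sigma.
Hypothesis t0 : 0 <= t.

Definition grid N j : R := t * (j%:R / N.+1%:R).

Lemma grid_ge0 N j : 0 <= grid N j.
Proof. by rewrite mulr_ge0// divr_ge0. Qed.

Lemma grid_le N j : (j <= N.+1)%N -> grid N j <= t.
Proof.
by move=> jN; rewrite ler_piMr// ler_pdivrMr ?mul1r ?ler_nat// ltr0n.
Qed.

Lemma grid_last N : grid N N.+1 = t.
Proof. by rewrite /grid divff ?mulr1. Qed.

Lemma grid_succ N j : grid N j.+1 = grid N j + t / N.+1%:R.
Proof. by rewrite /grid -natr1 mulrDl mulrDr mul1r. Qed.

(** The second disjunct makes the last index N + 1 always count as passed, so that a time sigma > t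
    is rounded to the grid point t. *)
Definition passed N w j := (sigma w <= (grid N j)%:E)%E || (N < j)%N.

Lemma passed_ex N w : exists j, passed N w j.
Proof. by exists N.+1; rewrite /passed ltnSn orbT. Qed.

(** Rounding sigma up, never down, makes {grid index = j} an event of the sigma-algebra at the j-th
    grid time. *)
Definition grid_index N w : nat := ex_minn (passed_ex N w).

Lemma grid_indexP N w : passed N w (grid_index N w) /\
  forall j, passed N w j -> (grid_index N w <= j)%N.
Proof. by rewrite /grid_index; case: ex_minnP. Qed.

Lemma grid_index_lt N w : (grid_index N w < N.+2)%N.
Proof.
by rewrite ltnS; apply: (grid_indexP N w).2; rewrite /passed ltnSn orbT.
Qed.

Definition grid_time N w : R := grid N (grid_index N w).

Lemma sigma_ge0 w : (0 <= sigma w)%E. Proof. by case: stop. Qed.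

Lemma grid_time_itv N w :
  min_time t (sigma w) <= grid_time N w <= min_time t (sigma w) + t / N.+1%:R.
Proof.
have [pj jmin] := grid_indexP N w; apply/andP; split.
  move: pj; rewrite /passed => /orP[h|h].
    rewrite -lee_fin; apply: le_trans h.
    by apply: min_time_ler => //; exact: sigma_ge0.
  have -> : grid_time N w = t.
    rewrite /grid_time (_ : grid_index N w = N.+1) ?grid_last//.
    by apply/eqP; rewrite eqn_leq h andbT -ltnS grid_index_lt.
  by apply: min_time_lel => //; exact: sigma_ge0.
have mt0 := min_time_ge0 t0 (sigma_ge0 w).
have tN0 : 0 <= t / N.+1%:R by rewrite divr_ge0.
rewrite /grid_time; case E : (grid_index N w) => [|j].
  by rewrite /grid mul0r mulr0 addr_ge0.
rewrite grid_succ lerD2r -lee_fin min_timeE ?sigma_ge0// le_min lee_fin.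
rewrite grid_le/=; last by have := grid_index_lt N w; rewrite E => /ltnW.
have /negP : ~ passed N w j by move=> /jmin; rewrite E ltnn.
by rewrite /passed negb_or -ltNge => /andP[/ltW].
Qed.

Lemma cvg_grid_time w : grid_time N w @[N --> \oo] --> min_time t (sigma w).
Proof.
apply: (@squeeze_cvgr _ _ _ _ (fun=> min_time t (sigma w))
   (fun N => min_time t (sigma w) + t / N.+1%:R)).
- by apply: nearW => N; exact: grid_time_itv.
- exact: cvg_cst.
- rewrite -[X in _ --> X]addr0; apply: cvgD; first exact: cvg_cst.
  rewrite -(mulr0 t); apply: cvgM; first exact: cvg_cst.
  exact: cvg_harmonic.
Qed.

Definition grid_value N w : R := M (grid_time N w) w.

Lemma cvg_grid_value w :
  grid_value N w @[N --> \oo] --> M (min_time t (sigma w)) w.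
Proof.
have := @contM w (min_time t (sigma w)).
rewrite /continuous_at max_l; last exact: min_time_ge0 t0 (sigma_ge0 w).
move=> /(cvg_comp _ _ (@cvg_grid_time w)).
rewrite (_ : _ \o _ = fun N => grid_value N w)//.
by apply/funext => N /=; rewrite max_l// grid_ge0.
Qed.

Lemma adapted_measurable u : 0 <= u -> measurable_fun setT (M u).
Proof.
move=> u0 _ B mB; rewrite setTI; apply: (filtration_measurable filF u0).
exact: adM.
Qed.

Lemma grid_index_adapted N j : (j <= N.+1)%N ->
  F (grid N j) [set w | grid_index N w = j].
Proof.
move=> jN; have sF := filtration_salgebra filF (grid_ge0 N j).
have [_ incF] := filF; have [_ st] := stop.
have Fi i : (i <= j)%N -> F (grid N j) [set w | passed N w i].
  move=> ij; have [Ni|iN] := ltnP N i.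
    rewrite (_ : [set w | _] = setT); first exact: salgebraT.
    by apply/seteqP; split=> // w _; rewrite /= /passed Ni orbT.
  have -> : [set w | passed N w i] = [set w | (sigma w <= (grid N i)%:E)%E].
    by apply/seteqP; split=> w; rewrite /= /passed ltnNge iN orbF.
  apply: (incF (grid N i)); [exact: grid_ge0| |exact: st (grid_ge0 N i)].
  by rewrite ler_wpM2l// ler_wpM2r ?invr_ge0// ler_nat.
rewrite (_ : [set w | _] = [set w | passed N w j] `&`
    \bigcap_i (if (i < j)%N then ~` [set w | passed N w i] else setT)).
  apply: (salgebraI sF); first exact: Fi.
  apply: (salgebra_bigcap sF) => i; case: ifPn => ij.
    by apply: (salgebraC sF); apply: Fi; exact: ltnW.
  exact: salgebraT.
apply/seteqP; split=> w /=.
  move=> <-; have [h1 h2] := grid_indexP N w; split => // i _.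
  by case: ifPn => // ij /h2; rewrite leqNgt ij.
have [h1 h2] := grid_indexP N w; move=> [/h2 h3 h4]; apply/eqP.
rewrite eqn_leq h3 leqNgt; apply/negP => h5.
by have := h4 (grid_index N w) Logic.I; rewrite h5; exact.
Qed.

Lemma measurable_grid_index N j : measurable [set w | grid_index N w = j].
Proof.
have [jN|jN] := leqP j N.+1.
  exact: (filtration_measurable filF (grid_ge0 N j) (grid_index_adapted jN)).
rewrite (_ : [set w | _] = set0)//; apply/seteqP; split=> // w /= E.
by have := grid_index_lt N w; rewrite E ltnS leqNgt jN.
Qed.

Lemma measurable_grid_value N : measurable_fun setT (grid_value N).
Proof.
move=> _ B mB; rewrite setTI.
rewrite (_ : _ @^-1` _ = \bigcup_j ([set w | grid_index N w = j] `&`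
    M (grid N j) @^-1` B)).
  apply: bigcupT_measurable => j; apply: measurableI.
    exact: measurable_grid_index.
  by rewrite -[X in measurable X]setTI; exact: adapted_measurable (grid_ge0 N j) _ _ mB.
apply/seteqP; split=> w /=; first by move=> Bw; exists (grid_index N w).
by move=> [j _ [/= <-]].
Qed.

Lemma measurable_stopped : measurable_fun setT (fun w => M (min_time t (sigma w)) w).
Proof.
apply: measurable_fun_cvg measurable_grid_value _ => w _; exact: cvg_grid_value.
Qed.

Hypothesis martM : martingale P F M.

Lemma martingale_integrable u : 0 <= u -> P.-integrable setT (EFin \o M u).
Proof. by case: martM => _ h _; exact: h. Qed.

(* Doob's optional sampling for the times of the grid. *)
Lemma grid_value_integral N (G : set T) :
  (forall j, (j <= N.+1)%N -> F (grid N j) (G `&` [set w | grid_index N w = j])) ->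
  measurable G ->
  P.-integrable setT (EFin \o grid_value N) /\
  \int[P]_(w in G) grid_value N w = \int[P]_(w in G) M t w.
Proof.
move=> GF mG; have mJ := measurable_grid_index N; have Jn := grid_index_lt N.
have [h1 h2] := @Rintegral_partition _ _ _ P _ _ (fun j => M (grid N j)) _ Jn mJ
  (fun j => martingale_integrable (grid_ge0 N j)) mG.
have [h3 h4] := @Rintegral_partition _ _ _ P _ _ (fun j => M t) _ Jn mJ
  (fun j => martingale_integrable t0) mG.
split => //; rewrite h4 [LHS]h2; apply: eq_bigr => j _.
have jN : (j <= N.+1)%N by rewrite -ltnS.
have [_ _ hM] := martM; congr fine; apply/esym.
by apply: hM; [exact: grid_ge0|exact: grid_le|exact: GF].
Qed.

Lemma grid_value_expectation N :
  P.-integrable setT (EFin \o grid_value N) /\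
  \int[P]_w grid_value N w = \int[P]_w M 0 w.
Proof.
have [|//|h1 h2] := @grid_value_integral N setT.
  by move=> j jN; rewrite setTI; exact: grid_index_adapted.
split => //; rewrite h2; have [_ _ hM] := martM; congr fine.
apply: hM => //; exact: (salgebraT (filtration_salgebra filF (lexx 0))).
Qed.

Lemma integrable_restrict (f : T -> R) (G : set T) : measurable G ->
  P.-integrable setT (EFin \o f) -> P.-integrable setT (EFin \o (f \_ G)).
Proof.
move=> mG intf; rewrite -restrict_EFin; apply/(integrable_mkcond _ mG).
exact: integrableS intf.
Qed.

Lemma integrable_normr (f : T -> R) : P.-integrable setT (EFin \o f) ->
  P.-integrable setT (EFin \o (fun w => `|f w|)).
Proof. by move=> /integrable_abse. Qed.

(** One event for all grids, so that truncation errors are controlled uniformly in N. *)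
Definition tail (K : R) : set T := [set w | exists N, K < `|grid_value N w|].

Lemma measurable_above (f : T -> R) (K : R) : measurable_fun setT f ->
  measurable [set w | K < f w].
Proof.
move=> mf; rewrite (_ : [set w | _] = setT `&` f @^-1` `]K, +oo[).
  by apply: mf => //; exact: measurable_itv.
by rewrite setTI; apply/seteqP; split=> w /=; rewrite in_itv/= andbT.
Qed.

Lemma measurable_tail K : measurable (tail K).
Proof.
rewrite (_ : tail K = \bigcup_N [set w | K < `|grid_value N w|]).
  apply: bigcupT_measurable => N; apply: measurable_above.
  by apply: measurableT_comp => //; exact: measurable_grid_value.
by apply/seteqP; split=> w /=; [move=> [N]|move=> [N _]]; exists N.
Qed.

Lemma measurable_clamp (f : T -> R) (K : R) : measurable_fun setT f ->
  measurable_fun setT (fun w => clamp (- K) K (f w)).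
Proof.
move=> mf; apply: (measurable_maxr (f := fun=> - K)) => //.
exact: (measurable_minr (f := fun=> K)).
Qed.

(* Truncating the grid value at level K costs at most the integral of |M_t| over
   the tail event: the part above K is an event of the sigma-algebra of the grid
   time, on which the grid value and M_t have the same integral. *)
Lemma clipped_expectation (K : R) N : 0 <= K ->
  `|\int[P]_w M 0 w - \int[P]_w clamp (- K) K (grid_value N w)| <=
  \int[P]_(w in tail K) `|M t w|.
Proof.
move=> K0; have mD := measurable_grid_value N.
have [iD <-] := grid_value_expectation N.
have iMt := martingale_integrable t0.
have mclip := measurable_clamp K mD.
have iclip : P.-integrable setT
    (EFin \o (fun w => clamp (- K) K (grid_value N w))).
  apply: (@integrable_bounded _ _ _ P _ K mclip) => w.
  rewrite ler_norml; apply: clamp_itv; lra.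
have iB : P.-integrable setT
    (EFin \o (fun w => grid_value N w - clamp (- K) K (grid_value N w))).
  apply: (eq_integrable measurableT (fun w => (grid_value N w)%:E -
    (clamp (- K) K (grid_value N w))%:E)%E) => //.
  exact: integrableB.
have mtail := measurable_tail K.
have sameint B : measurable B ->
    \int[P]_(w in grid_value N @^-1` B) grid_value N w =
    \int[P]_(w in grid_value N @^-1` B) M t w.
  move=> mB; have [||//] := @grid_value_integral N (grid_value N @^-1` B).
    move=> j jN; have sF := filtration_salgebra filF (grid_ge0 N j).
    rewrite (_ : _ `&` _ = M (grid N j) @^-1` B `&` [set w | grid_index N w = j]).
      by apply: (salgebraI sF); [exact: adM (grid_ge0 N j) _ mB|
        exact: grid_index_adapted].
    by apply/seteqP; split=> w [/= + E]; rewrite /grid_value /grid_time E.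
  by rewrite -[X in measurable X]setTI; exact: mD.
have mpre B : measurable B -> measurable (grid_value N @^-1` B).
  by move=> mB; rewrite -[X in measurable X]setTI; exact: mD.
pose Gp := grid_value N @^-1` `]K, +oo[.
pose Gn := grid_value N @^-1` `]-oo, - K[.
have sGp : \int[P]_(w in Gp) grid_value N w = \int[P]_(w in Gp) M t w.
  by apply: sameint; exact: measurable_itv.
have sGn : \int[P]_(w in Gn) grid_value N w = \int[P]_(w in Gn) M t w.
  by apply: sameint; exact: measurable_itv.
have mGp : measurable Gp by apply: mpre; exact: measurable_itv.
have mGn : measurable Gn by apply: mpre; exact: measurable_itv.
have inGp w : (w \in Gp) = (K < grid_value N w).
  by apply/idP/idP => [/set_mem|h]; [|apply/mem_set];
    rewrite /Gp /= in_itv/= andbT.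
have inGn w : (w \in Gn) = (grid_value N w < - K).
  by apply/idP/idP => [/set_mem|h]; [|apply/mem_set]; rewrite /Gn /= in_itv.
have intail w : K < `|grid_value N w| -> w \in tail K.
  by move=> h; apply/mem_set; exists N.
rewrite -RintegralB// [leRHS]Rintegral_mkcond ler_norml; apply/andP; split.
(* The truncation error is at least the grid value on [Gn], where it equals that value plus K, and
   is nonnegative elsewhere. On [Gn] the grid value is exchanged for M_t. The upper bound is the
   mirror image with [Gp]. *)
- apply: (@le_trans _ _ (\int[P]_w ((grid_value N) \_ Gn) w)).
    rewrite -[leRHS]Rintegral_mkcond sGn.
    rewrite [leRHS]Rintegral_mkcond -mulN1r -RintegralZl//; last first.
      by apply: integrable_restrict => //; exact: integrable_normr.
    apply: le_Rintegral => //.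
    + apply: (eq_integrable measurableT (fun w =>
        (-1)%:E * (((fun w => `|M t w|) \_ (tail K)) w)%:E)%E) => //.
      apply: integrableZl => //.
      by apply: integrable_restrict => //; exact: integrable_normr.
    + exact: integrable_restrict.
    move=> w _; rewrite !restrict_realE inGn; case: ifPn => [/set_mem wt|wt].
      by case: ifPn => _; have := ler_norm (- M t w); rewrite normrN;
        have := normr_ge0 (M t w); lra.
    case: ifPn => [wK|]; last by rewrite mulr0.
    have /intail : K < `|grid_value N w|.
      by have := ler_norm (- grid_value N w); rewrite normrN; lra.
    by rewrite (negbTE wt).
  apply: le_Rintegral => //; first exact: integrable_restrict.
  move=> w _; rewrite restrict_realE inGn; case: ifPn => h.
    have hK : grid_value N w <= K by lra.
    by rewrite /clamp (min_r hK) max_l ?(ltW h)//; lra.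
  rewrite /clamp; rewrite -leNgt in h.
  by case: (leP (grid_value N w) K) => h2; rewrite max_r//; lra.
- apply: (@le_trans _ _ (\int[P]_w ((grid_value N) \_ Gp) w)).
    apply: le_Rintegral => //; first exact: integrable_restrict.
    move=> w _; rewrite restrict_realE inGp; case: ifPn => h.
      rewrite /clamp (min_l (ltW h)) max_r; lra.
    rewrite -leNgt in h; rewrite /clamp (min_r h).
    by case: (leP (- K) (grid_value N w)) => h2; lra.
  rewrite -Rintegral_mkcond sGp.
  rewrite [leLHS]Rintegral_mkcond; apply: le_Rintegral => //.
  + exact: integrable_restrict.
  + by apply: integrable_restrict => //; exact: integrable_normr.
  move=> w _; rewrite !restrict_realE inGp; case: ifPn => h.
    by rewrite intail ?ler_norm// (lt_le_trans h)// ler_norm.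
  by case: ifPn.
Qed.

(** A continuous path is bounded on [0, t], so each w belongs to [tail n] for finitely many n only;
    |M_t| dominates. *)
Lemma cvg_tail : \int[P]_(w in tail n%:R) `|M t w| @[n --> \oo] --> (0 : R).
Proof.
have iM := martingale_integrable t0.
have mM := adapted_measurable t0.
have mf n : measurable_fun setT ((fun w => `|M t w|) \_ (tail n%:R)).
  apply/(measurable_restrictT _ (measurable_tail _)).
  by apply: measurable_funTS; exact: measurableT_comp.
have [|||||_ _] := @dominated_convergence _ _ _ P setT measurableT
  (fun n => EFin \o ((fun w => `|M t w|) \_ (tail n%:R))) (EFin \o cst 0)
  (EFin \o (fun w => `|M t w|)).
- by move=> n; exact/measurable_EFinP.
- exact/measurable_EFinP.
- apply: aeW => w _; apply: cvg_near_cst.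
  have cw : {within `[0, t], continuous (fun v => `|M (Num.max v 0) w|)}.
    apply: continuous_subspaceT => v.
    by apply: cvg_norm; exact: contM.
  have [v _ vmax] := EVT_max t0 cw.
  exists (Num.truncn `|M (Num.max v 0) w|).+1 => // n /= nn.
  rewrite restrict_realE ifN//; apply/negP => /set_mem[N].
  have gt : grid_time N w \in `[0, t].
    by rewrite in_itv/= grid_ge0 grid_le// -ltnS grid_index_lt.
  have := vmax _ gt; rewrite max_l ?grid_ge0// => h1 h2.
  have := lt_le_trans h2 h1; rewrite ltNge => /negP; apply.
  apply: (le_trans (ltW (truncnS_gt _))); by rewrite ler_nat.
- exact: integrable_normr.
- apply: aeW => w n _ /=; rewrite lee_fin restrict_realE; case: ifPn => _.
    by rewrite normr_id.
  by rewrite normr0.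
- have -> : (\int[P]_w (EFin \o cst 0%R) w)%E = 0%:E by rewrite integral0.
  move=> h; have -> : (fun n : nat => \int[P]_(w in tail n%:R) `|M t w|) =
    (fun n : nat => fine (\int[P]_w ((((fun w => `|M t w|) \_ (tail n%:R)) w)%:E)%E)).
    by apply/funext => n; rewrite Rintegral_mkcond.
  exact: fine_cvg h.
Qed.

(** The stopped value is bounded but the grid values approaching it need not be. Truncating them at
    a level n >= C leaves their limit unchanged, and costs at most an integral over [tail n], which
    vanishes as n grows. This takes the place of uniform integrability. *)
Lemma optional_stopping_bounded (C : R) :
  (forall w, `|M (min_time t (sigma w)) w| <= C) ->
  \int[P]_w M (min_time t (sigma w)) w = \int[P]_w M 0 w.
Proof.
move=> MC; set x := (LHS); set m := (RHS).
have key (n : nat) : C <= n%:R -> `|m - x| <= \int[P]_(w in tail n%:R) `|M t w|.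
  move=> Cn; have n0 : 0 <= n%:R :> R by [].
  have nn : - n%:R <= n%:R :> R by rewrite (le_trans _ n0)// oppr_le0.
  have [||||_ cv] := @cvg_Rintegral_bounded _ _ _ P
    (fun N w => clamp (- n%:R) n%:R (grid_value N w))
    (fun w => M (min_time t (sigma w)) w) n%:R.
  - by move=> N; apply: measurable_clamp; exact: measurable_grid_value.
  - exact: measurable_stopped.
  - apply: aeW => w.
    have cl : clamp (- n%:R) n%:R (M (min_time t (sigma w)) w) =
        M (min_time t (sigma w)) w.
      by apply: clamp_id; rewrite -ler_norml (le_trans (MC w)).
    rewrite -[X in _ --> X]cl; apply/cvgrPdist_lt => e e0.
    have /cvgrPdist_lt/(_ _ e0) := @cvg_grid_value w.
    by apply: filterS => N; apply: le_lt_trans; exact: clamp_lipschitz.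
  - by move=> N w; rewrite ler_norml; exact: clamp_itv.
  have cv' : `|m - \int[P]_w clamp (- n%:R) n%:R (grid_value N w)|
      @[N --> \oo] --> `|m - x|.
    by apply: cvg_norm; apply: cvgB => //; exact: cvg_cst.
  apply: (ler_cvg_to cv' (cvg_cst _)); apply: nearW => N.
  exact: clipped_expectation.
have x0 : `|m - x| <= 0.
  apply: (ler_cvg_to (cvg_cst _) cvg_tail).
  exists (Num.truncn C).+1 => // n /= Cn; apply: key.
  by apply: (le_trans (ltW (truncnS_gt _))); rewrite ler_nat.
by apply/eqP; rewrite eq_sym -subr_eq0 -normr_le0.
Qed.

(** Fatou's lemma along the grids, hence an inequality only. *)
Lemma optional_stopping_bounded_below (C : R) :
  (forall w u, 0 <= u -> - C <= M u w) ->
  (\int[P]_w (M (min_time t (sigma w)) w + C)%:E <=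
   (\int[P]_w M 0 w + C)%:E)%E.
Proof.
move=> MC; pose f N w := ((grid_value N w + C)%:E)%E.
have mf N : measurable_fun setT (f N).
  by apply/measurable_EFinP; apply: measurable_funD => //;
    exact: measurable_grid_value.
have f0 N w : (0 <= f N w)%E.
  by rewrite lee_fin; have := MC w _ (grid_ge0 N (grid_index N w));
    rewrite /grid_value /grid_time; lra.
have := fatou P measurableT mf (fun N w _ => f0 N w).
have -> : (fun N => \int[P]_w f N w)%E = cst (\int[P]_w M 0 w + C)%:E.
  apply/funext => N; have [iD eD] := grid_value_expectation N.
  have iC := finite_measure_integrable_cst P C measurableT.
  have -> : (\int[P]_w f N w = \int[P]_w ((grid_value N w)%:E + C%:E))%E.
    by apply: eq_integral.
  rewrite (integralD measurableT iD iC) /=.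
  rewrite (integral_cst P measurableT C%:E) -[X in (_ + _ * X)%E]/(P setT).
  rewrite -(fineK (integrable_fin_num measurableT iD)) -/(Rintegral _ _ _).
  have -> : P setT = 1%E by exact: probability_setT.
  by rewrite mule1 eD.
rewrite (cvg_limn_einf_sup (cvg_cst _)).1.
congr (_ <= _)%E; apply: eq_integral => w _.
have cv : f N w @[N --> \oo] --> (M (min_time t (sigma w)) w + C)%:E.
  apply: cvg_EFin; first exact: nearW.
  by apply: cvgD; [exact: cvg_grid_value|exact: cvg_cst].
by rewrite (cvg_limn_einf_sup cv).1.
Qed.

End optional_stopping.

Lemma Rintegral_cst_probability d (T : measurableType d) (R : realType)
  (P : probability T R) (c : R) : \int[P]_w cst c w = c.
Proof.
have := @Rintegral_cst _ _ _ P setT measurableT c.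
suff -> : fine (P setT) = 1 by rewrite mulr1.
by rewrite -[1]/(fine 1%E); congr fine; exact: probability_setT.
Qed.

(** * Optional stopping for local martingales *)

Section local_martingale_stopping.
Context d (T : measurableType d) (R : realType) (P : probability T R).
Variables (F : R -> set (set T)) (X : R -> T -> R) (x0 : R).
Hypothesis filF : filtration F.
Hypothesis locX : local_martingale P F X.
Hypothesis contX : forall w, continuous (fun v : R => X (Num.max v 0) w).
Hypothesis X0 : forall w, X 0 w = x0.

Lemma local_martingale_localized : exists tau : nat -> T -> \bar R,
  [/\ forall n w, (0 <= tau n w)%E,
      {ae P, forall w, tau n w @[n --> \oo] --> +oo%E} &
      forall n, martingale P F (fun t w => X (min_time t (tau n w)) w - x0)].
Proof.
have [_ [tau [st _ cv mart]]] := locX; exists tau; split => //.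
  by move=> n w; have [] := st n.
move=> n; have := mart n; congr martingale.
by apply/funext => t; apply/funext => w; rewrite X0.
Qed.

Lemma localized_continuous (r : \bar R) w : (0 <= r)%E ->
  continuous (fun v : R => X (min_time (Num.max v 0) r) w - x0).
Proof.
move=> r0.
have E : (fun v : R => X (min_time (Num.max v 0) r) w) =
    (fun u : R => X (Num.max u 0) w) \o (fun v : R => min_time (Num.max v 0) r).
  apply/funext => u /=; congr (X _ w); rewrite [in RHS]max_l//.
  by apply: min_time_ge0 => //; rewrite le_max lexx orbT.
have cE : continuous (fun v : R => X (min_time (Num.max v 0) r) w).
  rewrite E => v; apply: continuous_comp; last exact: contX.
  exact: min_time_continuous.
by move=> v; apply: cvgB; [exact: cE|exact: cvg_cst].
Qed.

Lemma local_martingale_adapted u : 0 <= u -> measurable_wrt (F u) (X u).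
Proof. by move=> u0; have [ad _] := locX; exact: ad. Qed.

Variable sigma : T -> \bar R.
Hypothesis stop : stopping_time F sigma.

Lemma measurable_stopped_process t : 0 <= t ->
  measurable_fun setT (fun w => X (min_time t (sigma w)) w).
Proof.
move=> t0; apply: (measurable_stopped filF _ contX stop t0) => u.
exact: local_martingale_adapted.
Qed.

Lemma stopping_ge0 w : (0 <= sigma w)%E. Proof. by have [] := stop. Qed.

(** Truncations of time at sigma and at a localizing time commute, so the bound C, known for the
    path stopped at sigma, applies to each localized martingale stopped at sigma. Dominated
    convergence then removes the localization. *)
Lemma stopped_expectation t C : 0 <= t ->
  (forall w u, 0 <= u -> `|X (min_time u (sigma w)) w| <= C) ->
  \int[P]_w X (min_time t (sigma w)) w = x0.
Proof.
move=> t0 XC; have [tau [tau0 cvtau mart]] := local_martingale_localized.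
pose f n w := X (min_time (min_time t (sigma w)) (tau n w)) w.
have fE n w : f n w = X (min_time (min_time t (tau n w)) (sigma w)) w.
  by rewrite /f min_timeAC// stopping_ge0.
have fC n w : `|f n w| <= C.
  by rewrite fE; apply: XC; exact: min_time_ge0.
have adM n u : 0 <= u -> measurable_wrt (F u)
    (fun w => X (min_time u (tau n w)) w - x0).
  by have [h _ _] := mart n; exact: h.
have contM n w : continuous
    (fun v : R => X (min_time (Num.max v 0) (tau n w)) w - x0).
  exact: localized_continuous.
have mf n : measurable_fun setT (f n).
  rewrite (_ : f n = (fun w => (f n w - x0) + x0)); last first.
    by apply/funext => w; rewrite subrK.
  apply: measurable_funD => //.
  exact: (measurable_stopped filF (adM n) (contM n) stop t0).
have intf n : \int[P]_w f n w = x0.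
  have ifn := integrable_bounded P (mf n) (fC n).
  have ix0 := finite_measure_integrable_cst P x0 measurableT.
  have := @optional_stopping_bounded _ _ _ P F _ sigma t filF (adM n) (contM n)
    stop t0 (mart n) (C + `|x0|).
  rewrite -[X in (_ -> X = _) -> _]/(\int[P]_w (f n w - cst x0 w)).
  rewrite RintegralB// => h.
  have : \int[P]_w f n w - \int[P]_w cst x0 w =
      \int[P]_w (X (min_time 0 (tau n w)) w - x0).
    by apply: h => w; rewrite (le_trans (ler_normB _ _))// lerD2r fC.
  rewrite (_ : (fun w => _ - _) = cst 0); last first.
    apply/funext => w; rewrite (_ : min_time 0 (tau n w) = 0) ?X0 ?subrr//.
    by rewrite min_time_idl.
  by rewrite !Rintegral_cst_probability => /eqP; rewrite subr_eq0 => /eqP.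
have [||||_ cv] := @cvg_Rintegral_bounded _ _ _ P f
  (fun w => X (min_time t (sigma w)) w) C.
- exact: mf.
- exact: measurable_stopped_process.
- apply: filterS cvtau => w /cvgeyPge/(_ t) h; apply: cvg_near_cst.
  apply: filterS h => n tn; rewrite /f [min_time _ (tau n w)]min_time_idl//.
    by apply: min_time_ge0 => //; exact: stopping_ge0.
  by apply: le_trans tn; rewrite lee_fin min_time_lel// stopping_ge0.
- exact: fC.
have cst_cv : \int[P]_w f n w @[n --> \oo] --> x0.
  by rewrite (_ : (fun n => _) = cst x0); [exact: cvg_cst|exact/funext].
exact: (cvg_unique _ cv cst_cv).
Qed.

Lemma stopped_limit_expectation (xi : T -> R) C :
  (forall w u, 0 <= u -> `|X (min_time u (sigma w)) w| <= C) ->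
  measurable_fun setT xi ->
  {ae P, forall w, X (min_time u (sigma w)) w @[u --> +oo] --> xi w} ->
  P.-integrable setT (EFin \o xi) /\ \int[P]_w xi w = x0.
Proof.
move=> XC mxi cvxi.
have [||||h1 h2] := @cvg_Rintegral_bounded _ _ _ P
  (fun n w => X (min_time n%:R (sigma w)) w) xi C.
- by move=> n; exact: measurable_stopped_process.
- exact: mxi.
- apply: filterS cvxi => w h; exact: (cvg_comp _ _ cvgr_idn h).
- by move=> n w; exact: XC.
split => //; have cst_cv : \int[P]_w X (min_time n%:R (sigma w)) w
    @[n --> \oo] --> x0.
  rewrite (_ : (fun n => _) = cst x0); first exact: cvg_cst.
  by apply/funext => n; exact: (stopped_expectation _ XC).
exact: (cvg_unique _ h2 cst_cv).
Qed.

(** Fatou's lemma along a diagonal sequence in which the horizon n and the localizing time [tau n]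
    grow together. The limit is extended-valued because the path may tend to an end of infinite
    scale. *)
Lemma stopped_limit_expectation_le (xi : T -> \bar R) C :
  (forall w u, 0 <= u -> - C <= X u w) ->
  measurable_fun setT xi ->
  {ae P, forall w, (X (min_time u (sigma w)) w)%:E @[u --> +oo] --> xi w} ->
  (\int[P]_w (xi w + C%:E) <= (x0 + C)%:E)%E.
Proof.
move=> XC mxi cvxi; have [tau [tau0 cvtau mart]] := local_martingale_localized.
pose g n w := X (min_time (min_time n%:R (sigma w)) (tau n w)) w + C.
have s0 := stopping_ge0.
have g0 n w : 0 <= g n w.
  rewrite /g -lerBlDr sub0r XC// min_time_ge0//; exact: min_time_ge0.
have adM n u : 0 <= u -> measurable_wrt (F u)
    (fun w => X (min_time u (tau n w)) w - x0).
  by have [h _ _] := mart n; exact: h.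
have contM n w : continuous
    (fun v : R => X (min_time (Num.max v 0) (tau n w)) w - x0).
  exact: localized_continuous.
have n0 n : 0 <= n%:R :> R by [].
have mg n : measurable_fun setT (g n).
  rewrite (_ : g n = (fun w =>
    (X (min_time (min_time n%:R (sigma w)) (tau n w)) w - x0) + (x0 + C))); last first.
    by apply/funext => w; rewrite addrA subrK.
  apply: measurable_funD => //.
  exact: (measurable_stopped filF (adM n) (contM n) stop (n0 n)).
have intg n : (\int[P]_w (g n w)%:E <= (x0 + C)%:E)%E.
  have := @optional_stopping_bounded_below _ _ _ P F _ sigma n%:R filF (adM n)
    (contM n) stop (n0 n) (mart n) (x0 + C).
  rewrite (_ : \int[P]_w (X (min_time 0 (tau n w)) w - x0) = 0) ?add0r.
    have -> : (\int[P]_w (g n w)%:E = \int[P]_w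
        (X (min_time (min_time n%:R (sigma w)) (tau n w)) w - x0 + (x0 + C))%:E)%E.
      by apply: eq_integral => w _; rewrite addrA subrK.
    apply => w u u0.
    have := XC w _ (min_time_ge0 u0 (tau0 n w)); lra.
  rewrite (_ : (fun w => _ - _) = cst 0) ?Rintegral_cst_probability//.
  apply/funext => w; rewrite (_ : min_time 0 (tau n w) = 0) ?X0 ?subrr//.
  by rewrite min_time_idl.
have cvg_g : {ae P, forall w, (g n w)%:E @[n --> \oo] --> (xi w + C%:E)%E}.
  apply: filterS2 cvtau cvxi => w h1 h2.
  have cvt : min_time n%:R (tau n w) @[n --> \oo] --> +oo.
    apply/cvgryPge => A; move/cvgeyPge : h1 => /(_ A) h1.
    have h3 : \forall n \near \oo, A <= n%:R.
      exists (Num.truncn A).+1 => // n /= An.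
      by apply: (le_trans (ltW (truncnS_gt _))); rewrite ler_nat.
    near=> n; rewrite -lee_fin min_timeE// le_min lee_fin.
    by apply/andP; split; near: n.
  have h3 : (X (min_time (min_time n%:R (sigma w)) (tau n w)) w)%:E @[n --> \oo]
      --> xi w.
    have := cvg_comp _ _ cvt h2; rewrite (_ : _ \o _ = fun n =>
      (X (min_time (min_time n%:R (sigma w)) (tau n w)) w)%:E)//.
    by apply/funext => n /=; rewrite min_timeAC.
  have -> : (fun n => (g n w)%:E) = (fun n =>
      (X (min_time (min_time n%:R (sigma w)) (tau n w)) w)%:E + C%:E)%E.
    by apply/funext => n; rewrite -EFinD.
  by apply: cvgeD => //; [rewrite fin_num_adde_defl|exact: cvg_cst].
(* The null set is cut out, so that the lower limit in Fatou's lemma equals the integrand everywhere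
   on the remaining domain. *)
have [N [mN PN subN]] := cvg_g.
have mNC : measurable (~` N) by exact: measurableC.
have mxiC : measurable_fun setT (fun w => xi w + C%:E)%E.
  by apply: emeasurable_funD.
have -> : (\int[P]_w (xi w + C%:E) = \int[P]_(w in ~` N) (xi w + C%:E))%E.
  rewrite [RHS]integral_mkcond; apply: ae_eq_integral => //.
    apply/(measurable_restrictT _ mNC); exact: measurable_funTS.
  exists N; split => // w /= /not_implyP[_]; apply: contra_notP => wN.
  by rewrite patchE mem_set.
have -> : (\int[P]_(w in ~` N) (xi w + C%:E) =
   \int[P]_(w in ~` N) limn_einf (fun n => (g n w)%:E))%E.
  apply: eq_integral => w /set_mem wN.
  have : (g n w)%:E @[n --> \oo] --> (xi w + C%:E)%E.
    by apply: contrapT => h; apply: wN; exact: subN.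
  by move=> /cvg_limn_einf_sup[].
have mgE n : measurable_fun (~` N) (fun w => (g n w)%:E).
  by apply: measurable_funTS; exact/measurable_EFinP.
apply: (le_trans (fatou P mNC mgE (fun n w _ => g0 n w))).
apply: (le_trans (limn_einf_sup _)); rewrite limn_esup_lim.
apply: lime_le; first exact: is_cvg_esups.
apply: nearW => n; apply: ge_ereal_sup => _ [m _ <-].
apply: le_trans (intg m); apply: ge0_subset_integral => //.
  exact/measurable_EFinP.
by move=> w _; rewrite lee_fin.
Unshelve. all: by end_near. Qed.

End local_martingale_stopping.

(** * Exit probabilities and the scale *)

Section crossing_events.
Context (R : realType).
Implicit Types (a b : \bar R) (w : cpath R).

(** The path goes strictly below a while still strictly below b. The strict inequalities make the
    event decidable at rational times; exits at a are squeezed between events of this kind. *)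
Definition crosses_below (a b : R) : set (cpath R) :=
  [set w | exists2 u : R, 0 <= u & w u < a /\ forall v : R, 0 <= v <= u -> w v < b].

Lemma crosses_belowS (a a' b b' : R) : a <= a' -> b <= b' ->
  crosses_below a b `<=` crosses_below a' b'.
Proof.
move=> aa bb w [u u0 [ua ub]]; exists u => //; split.
  exact: lt_le_trans aa.
by move=> v /ub h; exact: lt_le_trans bb.
Qed.

Lemma measurable_crosses_below (a b : R) :
  @measurable _ (path_space R) (crosses_below a b).
Proof.
pose f (v : R) := b - v.
have cf : continuous f.
  by move=> v; apply: cvgB; [exact: cvg_cst|exact: cvg_id].
rewrite (_ : crosses_below a b = \bigcup_(q : rat)
    (if (0 <= ratr q :> R) then
      [set w : cpath R | `]-oo, a[%classic (w (ratr q))] `&` ~` hits f 0 (ratr q)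
     else set0)).
  apply: bigcupT_measurable_rat => q; case: ifPn => // q0.
  apply: measurableI.
    apply: (@past_measurable R (ratr q)); apply: past_eval.
      by rewrite q0 lexx.
    exact: measurable_itv.
  by apply: measurableC; exact: hits_measurable.
apply/seteqP; split=> w.
  move=> [u u0 [ua ub]].
  (* The rational time must not exceed u, since the path is known to stay below b only up to u. The
     time u = 0 is itself rational. *)
  have [q [q0 qu wq]] : exists q : rat, [/\ 0 <= ratr q :> R, ratr q <= u & w (ratr q) < a].
    have [u00|un0] := eqVneq u 0.
      by exists 0; rewrite rmorph0 lexx u0; split => //; rewrite -u00.
    have up : 0 < u by rewrite lt_neqAle eq_sym un0.
    have wa : 0 < a - w u by rewrite subr_gt0.
    have uu : 0 <= u <= u by rewrite u0 lexx.
    have [e e0 eP] := within_itv_ball (@cpath_within R w 0 u (lexx 0)) uu wa.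
    have /rat_in_itvoo[q] : Num.max 0 (u - e) < u.
      by rewrite gt_max up gtrBl.
    rewrite in_itv/= gt_max => /andP[/andP[q0 qe] qu].
    exists q; split; [exact: ltW|exact: ltW|].
    have q0u : (0 <= (ratr q : R)) && ((ratr q : R) <= u).
      by apply/andP; split; apply: ltW.
    have : `|u - ratr q| < e by rewrite ltr_norml; lra.
    by move=> /(eP _ q0u)/dist_lt[_]; lra.
  exists q => //; rewrite q0; split; first by rewrite /= in_itv.
  move=> [v /andP[v0 vq]]; rewrite /f subr_le0 leNgt ub//.
  by rewrite v0 (le_trans vq).
move=> [q _]; case: ifPn => // q0 [/= + nh]; rewrite in_itv/= => wq.
exists (ratr q) => //; split => // v vq; rewrite ltNge; apply/negP => bv.
by apply: nh; exists v => //; rewrite /f subr_le0.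
Qed.

(** The path comes below every level above a while staying away from b by a fixed margin. This
    expresses both that a is hit before b and that the path tends to a without ever leaving (a,
    b). *)
Definition reaches_left a b : set (cpath R) :=
  [set w | exists b' : R, (b'%:E < b)%E /\
    forall a' : R, (a < a'%:E)%E -> crosses_below a' b' w].

Definition from_above a (n : nat) : R :=
  if a is r%:E then r + n.+1%:R^-1 else - n%:R.

Definition from_below b (n : nat) : R :=
  if b is r%:E then r - n.+1%:R^-1 else n%:R.

Lemma from_above_gt a n : (a < +oo)%E -> (a < (from_above a n)%:E)%E.
Proof.
case: a => [r| |]//= _; last exact: ltNyr.
by rewrite lte_fin ltrDl invr_gt0.
Qed.

Lemma from_below_lt b n : (-oo < b)%E -> ((from_below b n)%:E < b)%E.
Proof.
case: b => [r| |]//= _; last exact: ltry.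
by rewrite lte_fin gtrBl invr_gt0.
Qed.

Lemma from_aboveS a m n : (m <= n)%N -> from_above a n <= from_above a m.
Proof.
move=> mn; case: a => [r| |]/=; last 2 first.
- by rewrite lerN2 ler_nat.
- by rewrite lerN2 ler_nat.
by rewrite lerD2l lef_pV2 ?posrE// ler_nat ltnS.
Qed.

Lemma from_belowS b m n : (m <= n)%N -> from_below b m <= from_below b n.
Proof.
move=> mn; case: b => [r| |]/=; last 2 first.
- by rewrite ler_nat.
- by rewrite ler_nat.
by rewrite lerD2l lerN2 lef_pV2 ?posrE// ler_nat ltnS.
Qed.

Lemma near_from_above a (v : R) : (a < v%:E)%E ->
  \forall n \near \oo, from_above a n < v.
Proof.
case: a => [r| |]//= rv.
  move: rv; rewrite lte_fin -subr_gt0 => rv.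
  have := @near_infty_natSinv_lt R (PosNum rv); apply: filterS => n /=.
  by rewrite ltrBrDl.
exists (Num.truncn (- v)).+1 => // n /= vn.
by rewrite ltrNl (lt_le_trans (truncnS_gt _))// ler_nat.
Qed.

Lemma near_from_below b (v : R) : (v%:E < b)%E ->
  \forall n \near \oo, v < from_below b n.
Proof.
case: b => [r| |]//= rv.
  move: rv; rewrite lte_fin -subr_gt0 => rv.
  have := @near_infty_natSinv_lt R (PosNum rv); apply: filterS => n /=.
  by rewrite ltrBrDl -ltrBrDr.
exists (Num.truncn v).+1 => // n /= vn.
by rewrite (lt_le_trans (truncnS_gt _))// ler_nat.
Qed.

Lemma reaches_leftE a b : (a < +oo)%E -> (-oo < b)%E ->
  reaches_left a b = \bigcup_m \bigcap_n
    crosses_below (from_above a n) (from_below b m).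
Proof.
move=> ay yb; apply/seteqP; split=> w.
  move=> [b' [bb h]].
  have [m _ /(_ m (leqnn m)) bm] := near_from_below bb.
  exists m => // n _; apply: crosses_belowS (h _ (from_above_gt n ay)) => //.
  exact: ltW.
move=> [m _ h]; exists (from_below b m); split; first exact: from_below_lt.
move=> a' aa'; have [n _ /(_ n (leqnn n)) an] := near_from_above aa'.
by apply: crosses_belowS (h n Logic.I) => //; exact: ltW.
Qed.

(** Here the levels range over index sets that do not depend on a and b, unlike in [reaches_leftE];
    this gives joint measurability in the thresholds and the path. *)
Lemma reaches_left_ratE a b : (a < +oo)%E -> (-oo < b)%E ->
  reaches_left a b = [set w | exists q : rat, ((ratr q)%:E < b)%E /\
    forall p : rat, (a < (ratr p)%:E)%E -> crosses_below (ratr p) (ratr q) w].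
Proof.
move=> ay yb; apply/seteqP; split=> w [b' [bb h]].
  have [q [bq qb]] : exists q : rat, b' <= ratr q /\ ((ratr q)%:E < b)%E.
    case: b bb yb => [r| |]//; last first.
      move=> _ _; have /rat_in_itvoo[q] : b' < b' + 1 by rewrite ltrDl.
      by rewrite in_itv/= => /andP[/ltW ? _]; exists q; split => //; exact: ltry.
    rewrite lte_fin => /rat_in_itvoo[q]; rewrite in_itv/= => /andP[/ltW ? ?] _.
    by exists q; rewrite lte_fin.
  by exists q; split => // p /h; exact: crosses_belowS.
exists (ratr b'); split => // a' aa'.
have [p [ap pa]] : exists p : rat, (a < (ratr p)%:E)%E /\ ratr p <= a'.
  case: a aa' ay h => [r| |]//; last first.
    move=> _ _ _; have /rat_in_itvoo[q] : a' - 1 < a' by rewrite gtrBl.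
    by rewrite in_itv/= => /andP[_ /ltW ?]; exists q; split => //; exact: ltNyr.
  rewrite lte_fin => /rat_in_itvoo[q]; rewrite in_itv/= => /andP[? /ltW ?] _ _.
  by exists q; rewrite lte_fin.
by apply: crosses_belowS (h _ ap).
Qed.

End crossing_events.

(** * Exit from intervals with interior end points *)

Section exit_probability.
Context d (T : measurableType d) (R : realType) (P : probability T R).
Variables (F : R -> set (set T)) (I : set R) (y : R).
Variables (Y : T -> path_space R) (k : R.-pker R ~> path_space R) (s : R -> R).
Hypothesis filF : filtration F.
Hypothesis diffY : regular_diffusion P F I y Y k.
Hypothesis conts : {within I, continuous s}.
Hypothesis incs : {in I &, {homo s : x z / x < z}}.
Hypothesis lmX : local_martingale P F (fun t w => s (Y w t)).

Lemma scale_lt x z : I x -> I z -> x < z -> s x < s z.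
Proof. by move=> Ix Iz; apply: incs; exact/mem_set. Qed.

Lemma scale_le x z : I x -> I z -> x <= z -> s x <= s z.
Proof.
move=> Ix Iz; rewrite le_eqVlt => /predU1P[->//|/scale_lt h].
by apply: ltW; exact: h.
Qed.

Lemma scale_inj x z : I x -> I z -> s x = s z -> x = z.
Proof.
move=> Ix Iz sxz; case: (ltgtP x z) => // /scale_lt.
  by move=> /(_ Ix Iz); rewrite sxz ltxx.
by move=> /(_ Iz Ix); rewrite sxz ltxx.
Qed.

Lemma scale_path_continuous w : continuous (fun v : R => s (Y w (Num.max v 0))).
Proof.
move=> v; have /subspace_continuousP cs := conts.
have Iv u : I (Y w (Num.max u 0)).
  by apply: (state_values diffY); rewrite le_max lexx orbT.
have cv := @cpath_ext_continuous R (Y w) v.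
apply/cvgrPdist_lt => e e0.
have := cs _ (Iv v); move/cvgrPdist_lt => /(_ _ e0).
rewrite near_withinE near_simpl => /cv/nbhs_ballP[r r0 hr]; exists r => // u /hr.
by apply; exact: Iv.
Qed.

Lemma scale_path_start w : s (Y w 0) = s y.
Proof. by rewrite (starts_at diffY). Qed.


Definition outside (a b : R) : R -> R := fun v => Num.min (v - a) (b - v).

Lemma outside_continuous a b : continuous (outside a b).
Proof.
move=> v; apply: (@continuous_min R R (fun v => v - a) (fun v => b - v)).
  by apply: cvgB; [exact: cvg_id|exact: cvg_cst].
by apply: cvgB; [exact: cvg_cst|exact: cvg_id].
Qed.

Lemma outside_le0 a b v : (outside a b v <= 0) = (v <= a) || (b <= v).
Proof. by rewrite /outside ge_min !subr_le0. Qed.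

Definition exit_itv a b (w : T) : \bar R := passage (outside a b) 0 (Y w).

Lemma exit_itv_stopping a b : stopping_time F (exit_itv a b).
Proof.
by apply: (passage_stopping filF diffY) => //; exact: outside_continuous.
Qed.

Lemma before_exit a b w v : a < y -> y < b -> 0 <= v ->
  (v%:E <= exit_itv a b w)%E -> a <= Y w v <= b.
Proof.
move=> ay yb v0 vs; have co := @outside_continuous a b.
have nohit u : 0 <= u -> u < v -> a < Y w u < b.
  move=> u0 uv; have : ~~ (outside a b (Y w u) <= 0).
    apply/negP => h; have : (exit_itv a b w <= u%:E)%E.
      by apply/passage_le => //; exists u => //; rewrite u0 lexx.
    by move=> /(le_trans vs); rewrite lee_fin leNgt uv.
  by rewrite outside_le0 negb_or -!ltNge.
rewrite !leNgt; apply/andP; split; apply/negP => h.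
- have [|u /andP[u0 uv] wu] := @path_ivt R (Y w) 0 v a (lexx 0) v0.
    by right; rewrite (starts_at diffY) !ltW.
  have : u < v by rewrite lt_neqAle uv andbT; apply/eqP => uE; move: h; rewrite -uE wu ltxx.
  by move=> /(nohit _ u0); rewrite wu ltxx.
- have [|u /andP[u0 uv] wu] := @path_ivt R (Y w) 0 v b (lexx 0) v0.
    by left; rewrite (starts_at diffY) !ltW.
  have : u < v by rewrite lt_neqAle uv andbT; apply/eqP => uE; move: h; rewrite -uE wu ltxx.
  by move=> /(nohit _ u0); rewrite wu ltxx andbF.
Qed.

Lemma exit_itv_values a b w : a < y -> y < b -> (exit_itv a b w < +oo)%E ->
  Y w (fine (exit_itv a b w)) = a \/ Y w (fine (exit_itv a b w)) = b.
Proof.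
move=> ay yb fin; have co := @outside_continuous a b.
have [e s0 out] := passage_fin co (lexx 0) fin.
have le : ((fine (exit_itv a b w))%:E <= exit_itv a b w)%E by rewrite /exit_itv -e.
have /andP[h1 h2] := before_exit ay yb s0 le.
by move: out; rewrite outside_le0 => /orP[h|h]; [left|right];
  apply/eqP; rewrite eq_le; apply/andP.
Qed.

(** A recurrent path visits a; any other path tends to an end of I and finally stays below a or
    above b. *)
Lemma ae_exit_itv_fin a b : I° a -> I° b -> a < y -> y < b ->
  {ae P, forall w, (exit_itv a b w < +oo)%E}.
Proof.
move=> Ia Ib ay yb; have := ae_path_dichotomy filF diffY.
apply: filterS => w h.
apply/(passage_ltyP _ (@outside_continuous a b) (lexx 0)).
case: h => [|[/(_ _ Ia)[n h] _]|[/(_ _ Ib)[n h] _]].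
- move=> /(_ a (interior_subset Ia) 0%N)/hits_reachP[u u0 wu].
  by exists u => //; rewrite outside_le0 wu lexx.
- by exists n%:R => //; rewrite outside_le0 ltW ?h.
- by exists n%:R => //; rewrite outside_le0 [X in _ || X]ltW ?orbT ?h.
Qed.

Definition exits_left a b : set T :=
  [set w | (exit_itv a b w < +oo)%E /\ Y w (fine (exit_itv a b w)) = a].

(** The value of Y at the exit is accessible through the stopped scale process, whose measurability
    is known. As s is injective on I, the value [s a] identifies a. *)
Lemma measurable_exits_left a b : I° a -> a < y -> y < b ->
  measurable (exits_left a b).
Proof.
move=> Ia ay yb; have stop := exit_itv_stopping a b.
pose D := [set w | (exit_itv a b w < +oo)%E].
have mD : measurable D by exact: stopping_measurable_fin stop.
pose xi := (fun w => s (Y w (fine (exit_itv a b w)))) \_ D.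
have mxi : measurable_fun setT xi.
  apply: (@measurable_fun_cvg _ _ _ _ (fun n =>
    (fun w => s (Y w (min_time n%:R (exit_itv a b w)))) \_ D)).
    move=> n; apply/(measurable_restrictT _ mD); apply: measurable_funTS.
    exact: (measurable_stopped_process filF lmX scale_path_continuous stop).
  move=> w _; apply: cvg_near_cst; rewrite /xi restrict_realE.
  have [/set_mem wD|wD] := boolP (w \in D); last first.
    by apply: nearW => n; rewrite restrict_realE (negbTE wD).
  have [e s0] := stopping_fin stop wD.
  exists (Num.truncn (fine (exit_itv a b w))).+1 => // n /= sn.
  rewrite restrict_realE mem_set//; congr (s (Y w _)).
  rewrite {1}e min_time_idr//.
  by rewrite (le_trans (ltW (truncnS_gt _)))// ler_nat.
rewrite (_ : exits_left a b = D `&` (xi @^-1` [set s a])).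
  apply: measurableI => //; rewrite -[X in measurable X]setTI.
  exact: mxi.
apply/seteqP; split=> w [wD h]; split => //.
  by rewrite /= /xi restrict_realE mem_set// h.
move: h; rewrite /= /xi restrict_realE mem_set//; apply: scale_inj.
  by apply: (state_values diffY); have [] := stopping_fin stop wD.
exact: interior_subset.
Qed.

(** The scale process stopped at the exit is bounded and converges to s a or s b, so its limit has
    mean s y; solving for the weight of s a gives the formula. *)
Lemma exits_left_prob a b : I° a -> I° b -> a < y -> y < b ->
  P (exits_left a b) = ((s b - s y) / (s b - s a))%:E.
Proof.
move=> Ia Ib ay yb; have stop := exit_itv_stopping a b.
have [Ja Jb] := (interior_subset Ia, interior_subset Ib).
have sab : s a < s b by apply: scale_lt => //; exact: lt_trans yb.
have mA := measurable_exits_left Ia ay yb.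
pose xi w := s b + (s a - s b) * \1_(exits_left a b) w.
have mind : measurable_fun setT (\1_(exits_left a b) : T -> R).
  exact: measurable_indic.
have mxi : measurable_fun setT xi.
  by apply: measurable_funD => //; exact: measurable_funM.
have [|||_] := @stopped_limit_expectation _ _ _ P F (fun t w => s (Y w t)) (s y)
  filF lmX scale_path_continuous scale_path_start _ stop xi (`|s a| + `|s b|).
- move=> w u u0; have st0 := stopping_ge0 stop w.
  have /andP[h1 h2] := before_exit ay yb (min_time_ge0 u0 st0)
    (min_time_ler u0 st0).
  have Iu : I (Y w (min_time u (exit_itv a b w))).
    by apply: (state_values diffY); exact: min_time_ge0.
  have := scale_le Ja Iu h1; have := scale_le Iu Jb h2.
  have := ler_norm (s b); have := ler_norm (- s a); rewrite normrN.
  have := normr_ge0 (s a); have := normr_ge0 (s b).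
  by rewrite ler_norml => *; apply/andP; split; lra.
- exact: mxi.
- apply: filterS (ae_exit_itv_fin Ia Ib ay yb) => w wfin; apply: cvg_near_cst.
  have [e s0] := stopping_fin stop wfin.
  have h : \forall u \near +oo, fine (exit_itv a b w) <= u.
    by apply: nbhs_pinfty_ge; exact: num_real.
  apply: filterS h => u su; rewrite {1}e min_time_idr//.
  rewrite /xi indicE; have [wA|wA] := boolP (w \in exits_left a b).
    by have [_ ->] := set_mem wA; rewrite mulr1 addrC subrK.
  rewrite mulr0 addr0; have [h|->//] := exit_itv_values ay yb wfin.
  by exfalso; move/negP : wA; apply; apply/mem_set.
have iind : P.-integrable setT (EFin \o (\1_(exits_left a b) : T -> R)).
  exact: integrable_indic.
have icst := finite_measure_integrable_cst P (s b) measurableT.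
have iM : P.-integrable setT (EFin \o (fun w => (s a - s b) * \1_(exits_left a b) w)).
  apply: (eq_integrable measurableT
    (fun w => (s a - s b)%:E * (\1_(exits_left a b) w)%:E)%E) => //.
  exact: integrableZl.
rewrite (_ : (\int[P]_w xi w) =
    s b + (s a - s b) * fine (P (exits_left a b))); last first.
  rewrite /xi (RintegralD measurableT icst iM) Rintegral_cst_probability.
  rewrite RintegralZl//; congr (_ + _ * fine _).
  by rewrite integral_indic// setIT.
move=> h; rewrite -(fineK (fin_num_measure P _ mA)); congr _%:E.
have sab0 : s b - s a != 0 by rewrite subr_eq0 gt_eqF.
apply: (mulIf sab0); rewrite divfK//; lra.
Qed.

(** With the next lemma, the exit at a is enclosed between [crosses_below a b] and
    [crosses_below a' b] for every a' > a. *)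
Lemma crosses_below_exits_left a b w : a < y -> y < b ->
  crosses_below a b (Y w) -> exits_left a b w.
Proof.
move=> ay yb [u u0 [ua ub]]; have co := @outside_continuous a b.
have su : (exit_itv a b w <= u%:E)%E.
  apply/(passage_le _ _ co (lexx 0)); exists u; first by rewrite u0 lexx.
  by rewrite outside_le0 ltW.
have fin : (exit_itv a b w < +oo)%E by apply: le_lt_trans su _; exact: ltry.
split => //; have [e s0] := stopping_fin (exit_itv_stopping a b) fin.
have [//|h] := exit_itv_values ay yb fin.
have := ub (fine (exit_itv a b w)); rewrite s0 -lee_fin -e su h ltxx.
by move=> /(_ isT).
Qed.

Lemma exits_left_crosses_below a a' b w : a < a' -> a < y -> y < b ->
  exits_left a b w -> crosses_below a' b (Y w).
Proof.
move=> aa ay yb [fin h]; have [e s0] := stopping_fin (exit_itv_stopping a b) fin.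
exists (fine (exit_itv a b w)) => //; rewrite h; split => // v /andP[v0 vs].
have vs' : (v%:E <= exit_itv a b w)%E by rewrite e lee_fin.
have /andP[_] := before_exit ay yb v0 vs'.
rewrite le_eqVlt => /predU1P[wb|//].
have : (exit_itv a b w <= v%:E)%E.
  apply/(passage_le _ _ (@outside_continuous a b) (lexx 0)).
  by exists v; [rewrite v0 lexx|rewrite outside_le0 wb lexx orbT].
rewrite e lee_fin => sv; have vE : v = fine (exit_itv a b w).
  by apply/eqP; rewrite eq_le vs.
by move: wb; rewrite vE h => ab; lra.
Qed.

End exit_probability.

Section approximating_sequences.
Context (R : realType).
Implicit Types (a b : \bar R).

Lemma from_above_lt a m n : (m < n)%N -> from_above a n < from_above a m.
Proof.
move=> mn; case: a => [r| |]/=; last 2 first.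
- by rewrite ltrN2 ltr_nat.
- by rewrite ltrN2 ltr_nat.
by rewrite ltrD2l ltf_pV2 ?posrE// ltr_nat ltnS.
Qed.

Lemma cvg_from_above a : (a < +oo)%E -> (from_above a n)%:E @[n --> \oo] --> a.
Proof.
case: a => [r| |]// ar.
- apply: cvg_EFin; first exact: nearW.
  rewrite -[X in _ --> X]addr0; apply: cvgD; first exact: cvg_cst.
  exact: cvg_harmonic.
- apply/cvgeNyPlt => A; have := @near_from_above R -oo%E A (ltNyr _).
  by apply: filterS => n; rewrite lte_fin.
Qed.

Lemma cvg_from_below b : (-oo < b)%E -> (from_below b n)%:E @[n --> \oo] --> b.
Proof.
case: b => [r| |]// br.
- apply: cvg_EFin; first exact: nearW.
  rewrite -[X in _ --> X]subr0; apply: cvgB; first exact: cvg_cst.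
  exact: cvg_harmonic.
- apply/cvgeyPgt => A; have := @near_from_below R +oo%E A (ltry _).
  by apply: filterS => n; rewrite lte_fin.
Qed.

Lemma closure_cvg_seq (X : topologicalType) (A : set X) (u : nat -> X) (z : X) :
  u n @[n --> \oo] --> z -> (\forall n \near \oo, A (u n)) -> closure A z.
Proof.
move=> uz uA B /uz; rewrite near_simpl => uB.
have [n [An Bn]] := filter_ex (filterI uA uB).
by exists (u n).
Qed.

End approximating_sequences.

(** * Extension of the scale to the closure of I *)

Section extended_scale.
Context (R : realType).
Variables (I : set R) (y : R) (s : R -> R).
Hypothesis itvI : is_interval I.
Hypothesis Iy : I° y.
Hypothesis conts : {within I, continuous s}.
Hypothesis incs : {in I &, {homo s : x z / x < z}}.

Definition left_end : \bar R := ereal_inf (EFin @` I).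
Definition right_end : \bar R := ereal_sup (EFin @` I).

Let Jy : I y := interior_subset Iy.

Lemma left_end_lt : (left_end < y%:E)%E.
Proof.
have /(interior_itvP _ itvI)[v1 [v2 [I1 I2 v1y yv2]]] := Iy.
apply: (@le_lt_trans _ _ v1%:E); last by rewrite lte_fin.
by apply: ereal_inf_lbound; exists v1.
Qed.

Lemma right_end_gt : (y%:E < right_end)%E.
Proof.
have /(interior_itvP _ itvI)[v1 [v2 [I1 I2 v1y yv2]]] := Iy.
apply: (@lt_le_trans _ _ v2%:E); first by rewrite lte_fin.
by apply: ereal_sup_ubound; exists v2.
Qed.

Lemma left_end_le v : I v -> (left_end <= v%:E)%E.
Proof. by move=> Iv; apply: ereal_inf_lbound; exists v. Qed.

Lemma right_end_ge v : I v -> (v%:E <= right_end)%E.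
Proof. by move=> Iv; apply: ereal_sup_ubound; exists v. Qed.

Lemma interval_left v : (left_end < v%:E)%E -> v <= y -> I v.
Proof.
move=> /ereal_inf_lt[_ [u Iu <-]]; rewrite lte_fin => uv vy.
by apply: (itvI Iu Jy); rewrite (ltW uv) vy.
Qed.

Lemma interval_right v : (v%:E < right_end)%E -> y <= v -> I v.
Proof.
move=> /ereal_sup_gt[_ [u Iu <-]]; rewrite lte_fin => uv vy.
by apply: (itvI Jy Iu); rewrite (ltW uv) vy.
Qed.

Lemma interior_left (a : \bar R) v : (left_end <= a)%E -> (a < v%:E)%E ->
  v <= y -> I° v.
Proof.
move=> la av vy; have /(interior_itvP _ itvI)[v1 [v2 [I1 I2 v1y yv2]]] := Iy.
have /ereal_inf_lt[_ [u Iu <-]] := le_lt_trans la av; rewrite lte_fin => uv.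
by apply/(interior_itvP _ itvI); exists u, v2; split => //; lra.
Qed.

Lemma interior_right (b : \bar R) v : (b <= right_end)%E -> (v%:E < b)%E ->
  y <= v -> I° v.
Proof.
move=> br vb yv; have /(interior_itvP _ itvI)[v1 [v2 [I1 I2 v1y yv2]]] := Iy.
have /ereal_sup_gt[_ [u Iu <-]] := lt_le_trans vb br; rewrite lte_fin => vu.
by apply/(interior_itvP _ itvI); exists v1, u; split => //; lra.
Qed.

Lemma near_from_above_interior a : (left_end <= a)%E -> (a < y%:E)%E ->
  \forall n \near \oo, from_above a n < y /\ I° (from_above a n).
Proof.
move=> la ay; have := near_from_above ay; apply: filterS => n ny; split => //.
apply: (interior_left la _ (ltW ny)); apply: from_above_gt.
by apply: lt_trans ay _; exact: ltry.
Qed.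

Lemma near_from_below_interior b : (b <= right_end)%E -> (y%:E < b)%E ->
  \forall n \near \oo, y < from_below b n /\ I° (from_below b n).
Proof.
move=> br yb; have := near_from_below yb; apply: filterS => n ny; split => //.
apply: (interior_right br _ (ltW ny)); apply: from_below_lt.
by apply: lt_trans yb; exact: ltNyr.
Qed.

Lemma state_closureP z : state_closure I z <-> (left_end <= z <= right_end)%E.
Proof.
split.
  have cl : closed [set x | (left_end <= x)%E /\ (x <= right_end)%E].
    by apply: closedI; [exact: closed_ereal_le_ereal|exact: closed_ereal_ge_ereal].
  have sub : EFin @` I `<=` [set x | (left_end <= x)%E /\ (x <= right_end)%E].
    by move=> _ [v Iv <-]; split; [exact: left_end_le|exact: right_end_ge].
  by move=> /(closure_subset sub); rewrite -(closure_id _).1 => // -[-> ->].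
move=> /andP[lz zr]; case: (ltgtP z y%:E) => zy.
- apply: (@closure_cvg_seq _ _ (fun n => (from_above z n)%:E)).
    by apply: cvg_from_above; apply: lt_trans zy _; exact: ltry.
  have := near_from_above_interior lz zy; apply: filterS => n [_ /interior_subset h].
  by exists (from_above z n).
- apply: (@closure_cvg_seq _ _ (fun n => (from_below z n)%:E)).
    by apply: cvg_from_below; apply: lt_trans zy; exact: ltNyr.
  have := near_from_below_interior zr zy; apply: filterS => n [_ /interior_subset h].
  by exists (from_below z n).
- by rewrite zy; apply: subset_closure; exists y.
Qed.

(* The continuous extension of s to the closure of I, made monotone on all of
   \bar R: below y an infimum is used and above y a supremum, so that the value
   at an end point which does not belong to I is the limit of s. *)
Definition scale_ext (z : \bar R) : \bar R :=
  if (z <= y%:E)%E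
  then ereal_inf [set (s v)%:E | v in [set v | I v /\ (z <= v%:E)%E]]
  else ereal_sup [set (s v)%:E | v in [set v | I v /\ (v%:E <= z)%E]].

Lemma scale_homo_lt x z : I x -> I z -> x < z -> s x < s z.
Proof. by move=> Ix Iz; apply: incs; exact/mem_set. Qed.

Lemma scale_homo x z : I x -> I z -> x <= z -> s x <= s z.
Proof.
move=> Ix Iz; rewrite le_eqVlt => /predU1P[->//|/scale_homo_lt h].
by apply: ltW; exact: h.
Qed.

Lemma scale_extE v : I v -> scale_ext v%:E = (s v)%:E.
Proof.
move=> Iv; rewrite /scale_ext; case: ifPn => vy; apply/eqP; rewrite eq_le;
  apply/andP; split.
- by apply: ereal_inf_lbound; exists v.
- apply: le_ereal_inf_tmp => _ [u [Iu +] <-]; rewrite !lee_fin.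
  exact: scale_homo.
- apply: ge_ereal_sup => _ [u [Iu +] <-]; rewrite !lee_fin.
  exact: scale_homo.
- by apply: ereal_sup_ubound; exists v.
Qed.

Lemma scale_ext_homo x z : (x <= z)%E -> (scale_ext x <= scale_ext z)%E.
Proof.
move=> xz; rewrite /scale_ext; case: ifPn => xy; case: ifPn => zy.
- by apply: ereal_inf_le_tmp => _ [u [Iu zu] <-]; exists u => //; split => //; exact: le_trans zu.
- apply: (@le_trans _ _ (s y)%:E).
    by apply: ereal_inf_lbound; exists y.
  by apply: ereal_sup_ubound; exists y => //; split => //; apply: ltW; rewrite ltNge.
- by move: xy; rewrite (le_trans xz zy).
- by apply: le_ereal_sup => _ [u [Iu ux] <-]; exists u => //; split => //; exact: le_trans xz.
Qed.

Lemma scale_ext_lt a : (left_end <= a)%E -> (a < y%:E)%E ->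
  (scale_ext a < (s y)%:E)%E.
Proof.
move=> la ay; have [n [ny /interior_subset In]] :=
  filter_ex (near_from_above_interior la ay).
apply: (@le_lt_trans _ _ (s (from_above a n))%:E); last first.
  by rewrite lte_fin; exact: scale_homo_lt.
rewrite -scale_extE//; apply: scale_ext_homo; apply/ltW/from_above_gt.
by apply: lt_trans ay _; exact: ltry.
Qed.

Lemma scale_ext_gt b : (b <= right_end)%E -> (y%:E < b)%E ->
  ((s y)%:E < scale_ext b)%E.
Proof.
move=> br yb; have [n [ny /interior_subset In]] :=
  filter_ex (near_from_below_interior br yb).
apply: (@lt_le_trans _ _ (s (from_below b n))%:E).
  by rewrite lte_fin; exact: scale_homo_lt.
rewrite -scale_extE//; apply: scale_ext_homo; apply/ltW/from_below_lt.
by apply: lt_trans yb; exact: ltNyr.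
Qed.

Lemma scale_near v e : I v -> 0 < e ->
  exists2 r : R, 0 < r & forall u, I u -> `|v - u| < r -> `|s v - s u| < e.
Proof.
move=> Iv e0; have /subspace_continuousP cs := conts.
have := cs _ Iv; move/cvgrPdist_lt => /(_ _ e0).
rewrite near_withinE near_simpl => /nbhs_ballP[r r0 hr].
by exists r => // u Iu vu; apply: hr.
Qed.

(** The nontrivial half of the convergence of s along [from_above a] to [scale_ext a]. A state v
    with s v < M is either beyond a, and monotonicity suffices, or a itself, and continuity of s at
    a is used. *)
Lemma near_scale_above a (M : R) : (left_end <= a)%E -> (a < y%:E)%E ->
  (scale_ext a < M%:E)%E -> \forall n \near \oo, s (from_above a n) < M.
Proof.
move=> la ay; rewrite {1}/scale_ext (ltW ay) => /ereal_inf_lt[_ [v [Iv +] <-]].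
rewrite lte_fin => + sv; rewrite le_eqVlt => /predU1P[aE|av]; last first.
  apply: filterS2 (near_from_above av) (near_from_above_interior la ay).
  move=> n nv [_ /interior_subset In]; apply: lt_trans sv.
  exact: scale_homo_lt.
have sv0 : 0 < M - s v by rewrite subr_gt0.
have [r r0 hr] := scale_near Iv sv0.
have avr : (a < (v + r)%:E)%E by rewrite aE lte_fin ltrDl.
apply: filterS2 (near_from_above avr) (near_from_above_interior la ay).
move=> n nv [_ /interior_subset In].
have vn : v < from_above a n.
  by rewrite -lte_fin -aE; apply: from_above_gt; rewrite aE; exact: ltry.
have : `|v - from_above a n| < r by rewrite ltr_norml; lra.
by move=> /(hr _ In)/dist_lt[_]; lra.
Qed.

Lemma near_scale_below b (M : R) : (b <= right_end)%E -> (y%:E < b)%E ->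
  (M%:E < scale_ext b)%E -> \forall n \near \oo, M < s (from_below b n).
Proof.
move=> br yb; rewrite {1}/scale_ext leNgt yb /= => /ereal_sup_gt[_ [v [Iv +] <-]].
rewrite lte_fin => + sv; rewrite le_eqVlt => /predU1P[bE|vb]; last first.
  apply: filterS2 (near_from_below vb) (near_from_below_interior br yb).
  move=> n nv [_ /interior_subset In]; apply: (lt_trans sv).
  exact: scale_homo_lt.
have sv0 : 0 < s v - M by rewrite subr_gt0.
have [r r0 hr] := scale_near Iv sv0.
have bvr : ((v - r)%:E < b)%E by rewrite -bE lte_fin gtrBl.
apply: filterS2 (near_from_below bvr) (near_from_below_interior br yb).
move=> n nv [_ /interior_subset In].
have vn : from_below b n < v.
  by rewrite -lte_fin bE; apply: from_below_lt; rewrite -bE; exact: ltNyr.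
have : `|v - from_below b n| < r by rewrite ltr_norml; lra.
by move=> /(hr _ In)/dist_lt[]; lra.
Qed.

(* The value is 0 where the scale is infinite. The exit law of (a, b) charges a
   and b proportionally to their inverse gaps. *)
Definition inv_gap (z : \bar R) : R :=
  if scale_ext z is r%:E then `|r - s y|^-1 else 0.

Lemma inv_gap_ge0 z : 0 <= inv_gap z.
Proof. by rewrite /inv_gap; case: scale_ext => // r; rewrite invr_ge0. Qed.

Lemma inv_gapE v : I v -> inv_gap v%:E = `|s v - s y|^-1.
Proof. by move=> Iv; rewrite /inv_gap scale_extE. Qed.

Lemma inv_gap_gt0 v : I v -> v != y -> 0 < inv_gap v%:E.
Proof.
move=> Iv vy; rewrite inv_gapE// invr_gt0 normr_gt0 subr_eq0.
move: vy; rewrite neq_lt => /orP[h|h].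
  by rewrite lt_eqF//; exact: scale_homo_lt.
by rewrite gt_eqF//; exact: scale_homo_lt.
Qed.

(** Continuity from the right at a threshold, including an end of infinite scale, where the inverse
    gaps tend to 0. *)
Lemma cvg_inv_gap_above a : (left_end <= a)%E -> (a < y%:E)%E ->
  inv_gap (from_above a n)%:E @[n --> \oo] --> inv_gap a.
Proof.
move=> la ay; have lt := scale_ext_lt la ay.
have nI := near_from_above_interior la ay.
have nE : \forall n \near \oo, `|s (from_above a n) - s y|^-1 =
    inv_gap (from_above a n)%:E.
  by apply: filterS nI => n [_ /interior_subset In]; rewrite inv_gapE.
apply: (cvg_trans (near_eq_cvg nE)).
have nM := near_scale_above la ay.
rewrite {1}/inv_gap; case E : (scale_ext a) lt nM => [r| |]// lt nM.
- apply: cvgV.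
    by rewrite normr_eq0 subr_eq0 lt_eqF// -lte_fin.
  apply: cvg_norm; apply: cvgB; last exact: cvg_cst.
  apply/cvgrPdist_lt => e e0.
  have := nM (r + e); rewrite lte_fin ltrDl => /(_ e0).
  apply: filterS2 nI => n [ny /interior_subset In] h.
  have : r <= s (from_above a n).
    rewrite -lee_fin -E -scale_extE//; apply: scale_ext_homo.
    by apply/ltW/from_above_gt; apply: lt_trans ay _; exact: ltry.
  by rewrite ltr_norml; lra.
- apply/cvgrPdist_lt => e e0.
  (* Below the level s y - 1/e the gap exceeds 1/e, so its inverse is less than e. *)
  have := nM (s y - e^-1) (ltNyr _); apply: filterS => n h.
  have e10 : 0 < e^-1 by rewrite invr_gt0.
  rewrite sub0r normrN ger0_norm ?invr_ge0// -[ltRHS]invrK ltf_pV2 ?posrE//;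
    by have := ler_norm (- (s (from_above a n) - s y)); rewrite normrN; lra.
Qed.

Lemma cvg_inv_gap_below b : (b <= right_end)%E -> (y%:E < b)%E ->
  inv_gap (from_below b n)%:E @[n --> \oo] --> inv_gap b.
Proof.
move=> br yb; have gt := scale_ext_gt br yb.
have nI := near_from_below_interior br yb.
have nE : \forall n \near \oo, `|s (from_below b n) - s y|^-1 =
    inv_gap (from_below b n)%:E.
  by apply: filterS nI => n [_ /interior_subset In]; rewrite inv_gapE.
apply: (cvg_trans (near_eq_cvg nE)).
have nM := near_scale_below br yb.
rewrite {1}/inv_gap; case E : (scale_ext b) gt nM => [r| |]// gt nM.
- apply: cvgV.
    by rewrite normr_eq0 subr_eq0 gt_eqF// -lte_fin.
  apply: cvg_norm; apply: cvgB; last exact: cvg_cst.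
  apply/cvgrPdist_lt => e e0.
  have := nM (r - e); rewrite lte_fin gtrBl => /(_ e0).
  apply: filterS2 nI => n [ny /interior_subset In] h.
  have : s (from_below b n) <= r.
    rewrite -lee_fin -E -scale_extE//; apply: scale_ext_homo.
    by apply/ltW/from_below_lt; apply: lt_trans yb; exact: ltNyr.
  by rewrite ltr_norml; lra.
- apply/cvgrPdist_lt => e e0.
  have := nM (s y + e^-1) (ltry _); apply: filterS => n h.
  have e10 : 0 < e^-1 by rewrite invr_gt0.
  rewrite sub0r normrN ger0_norm ?invr_ge0// -[ltRHS]invrK ltf_pV2 ?posrE//;
    by have := ler_norm (s (from_below b n) - s y); lra.
Qed.

End extended_scale.

Section path_extrema.
Context (R : realType).
Implicit Types (w : cpath R).

Lemma path_max w u : 0 <= u -> exists2 c : R, 0 <= c <= u &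
  forall v : R, 0 <= v <= u -> w v <= w c.
Proof.
move=> u0; have [c + h] := EVT_max u0 (@cpath_within R w 0 u (lexx 0)).
by rewrite in_itv/= => cu; exists c => // v vu; apply: h; rewrite in_itv.
Qed.

Lemma path_min w u : 0 <= u -> exists2 c : R, 0 <= c <= u &
  forall v : R, 0 <= v <= u -> w c <= w v.
Proof.
move=> u0; have [c + h] := EVT_min u0 (@cpath_within R w 0 u (lexx 0)).
by rewrite in_itv/= => cu; exists c => // v vu; apply: h; rewrite in_itv.
Qed.

Lemma ereal_real_between (v : R) (b : \bar R) : (v%:E < b)%E ->
  exists2 b' : R, v < b' & (b'%:E < b)%E.
Proof.
case: b => [r| |]//; last by move=> _; exists (v + 1); rewrite ?ltry// ltrDl.
rewrite lte_fin => vr; exists ((v + r) / 2); rewrite ?lte_fin; lra.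
Qed.

Lemma ereal_real_between_lt (v : R) (a : \bar R) : (a < v%:E)%E ->
  exists2 a' : R, a' < v & (a < a'%:E)%E.
Proof.
case: a => [r| |]//; last by move=> _; exists (v - 1); rewrite ?ltNyr// gtrBl.
rewrite lte_fin => vr; exists ((v + r) / 2); rewrite ?lte_fin; lra.
Qed.

End path_extrema.

(** * Exit probabilities for general thresholds *)

Section hitting_probability.
Context d (T : measurableType d) (R : realType) (P : probability T R).
Variables (F : R -> set (set T)) (I : set R) (y : R).
Variables (Y : T -> path_space R) (k : R.-pker R ~> path_space R) (s : R -> R).
Hypothesis filF : filtration F.
Hypothesis diffY : regular_diffusion P F I y Y k.
Hypothesis conts : {within I, continuous s}.
Hypothesis incs : {in I &, {homo s : x z / x < z}}.
Hypothesis lmX : local_martingale P F (fun t w => s (Y w t)).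

Let Iy : I° y := start_interior diffY.
Let itvI : is_interval I := state_interval diffY.
Let Jy : I y := interior_subset Iy.
Let ig := inv_gap I y s.

Lemma exits_left_inv_gap a b : I° a -> I° b -> a < y -> y < b ->
  P (exits_left Y a b) = (ig a%:E / (ig a%:E + ig b%:E))%:E.
Proof.
move=> Ia Ib ay yb; have [Ja Jb] := (interior_subset Ia, interior_subset Ib).
rewrite (exits_left_prob filF diffY conts incs lmX)//; congr _%:E.
have h1 : s a < s y by exact: (scale_homo_lt incs).
have h2 : s y < s b by exact: (scale_homo_lt incs).
rewrite /ig !(inv_gapE _ incs)// ler0_norm ?ger0_norm ?subr_ge0 ?subr_le0 ?ltW//.
have d1 : s b - s y != 0 by rewrite subr_eq0 gt_eqF.
have d2 : s y - s a != 0 by rewrite subr_eq0 gt_eqF.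
have d3 : s b - s y + (s y - s a) != 0.
  by rewrite addrA subrK subr_eq0 gt_eqF// (lt_trans h1).
have d4 : s b - s a != 0 by rewrite subr_eq0 gt_eqF// (lt_trans h1).
by rewrite opprB; field; rewrite ?d1 ?d2 ?d3 ?d4.
Qed.

Lemma measurable_crosses a b : measurable (Y @^-1` crosses_below a b).
Proof.
by apply: (measurable_path_event filF diffY); exact: measurable_crosses_below.
Qed.

Lemma exit_ratio_cvg (f g : nat -> R) (p q : R) :
  (forall n, 0 <= f n) -> (forall n, 0 <= g n) -> 0 < p + q ->
  f n @[n --> \oo] --> p -> g n @[n --> \oo] --> q ->
  f n / (f n + g n) @[n --> \oo] --> p / (p + q).
Proof.
move=> f0 g0 pq fp gq; apply: cvgM => //; apply: cvgV; first by rewrite gt_eqF.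
exact: cvgD.
Qed.

(** The event for the n-th level contains the exit at the next, strictly lower level, and is
    contained in the exit at the n-th level. Both exit probabilities converge to the same ratio, by
    continuity of the inverse gap at a. *)
Lemma prob_crosses_limit (a : \bar R) (b : R) : (left_end I <= a)%E ->
  (a < y%:E)%E -> I° b -> y < b ->
  P (\bigcap_n (Y @^-1` crosses_below (from_above a n) b)) =
  (ig a / (ig a + ig b%:E))%:E.
Proof.
move=> la ay Ib yb; set p := fun n => Y @^-1` crosses_below (from_above a n) b.
have mp n : measurable (p n) by exact: measurable_crosses.
have cvp : P (p n) @[n --> \oo] --> P (\bigcap_n p n).
  apply: nonincreasing_cvg_mu => //.
  - by apply: le_lt_trans (probability_le1 _ (mp _)) _; exact: ltry.
  - exact: bigcapT_measurable.
  - apply/nonincreasing_seqP => n; apply/subsetPset => w.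
    by apply: crosses_belowS => //; exact: from_aboveS.
pose e n := ig (from_above a n)%:E / (ig (from_above a n)%:E + ig b%:E).
have ig0 z : 0 <= ig z by exact: inv_gap_ge0.
have igb : 0 < ig b%:E.
  by apply: inv_gap_gt0 => //; [exact: interior_subset|rewrite gt_eqF].
have cve : e n @[n --> \oo] --> ig a / (ig a + ig b%:E).
  apply: exit_ratio_cvg => //; first by rewrite ltr_wpDl.
    exact: (cvg_inv_gap_above itvI Iy conts incs).
  exact: cvg_cst.
have nI := near_from_above_interior itvI Iy la ay.
have cveS : e n.+1 @[n --> \oo] --> ig a / (ig a + ig b%:E).
  by rewrite cvg_shiftS.
have nIS : \forall n \near \oo, from_above a n.+1 < y /\ I° (from_above a n.+1).
  by have [N _ h] := nI; exists N => // n /= Nn; apply: h; rewrite /= leqW.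
have sq : \forall n \near \oo, ((e n.+1)%:E <= P (p n) <= (e n)%:E)%E.
  apply: filterS2 nI nIS => n [ny In] [nyS InS].
  rewrite -(exits_left_inv_gap InS Ib nyS yb) -(exits_left_inv_gap In Ib ny yb).
  have mS := measurable_exits_left filF diffY conts incs lmX InS nyS yb.
  have mE := measurable_exits_left filF diffY conts incs lmX In ny yb.
  apply/andP; split; apply: le_measure; rewrite ?inE//.
    move=> w; apply: (exits_left_crosses_below filF diffY) => //.
    exact: from_above_lt.
  by move=> w; exact: (crosses_below_exits_left filF diffY).
have cv : P (p n) @[n --> \oo] --> (ig a / (ig a + ig b%:E))%:E.
  by apply: (squeeze_cvge sq); apply: cvg_EFin => //; exact: nearW.
exact: (cvg_unique _ cvp cv).
Qed.

Lemma measurable_reaches_left a b : (a < +oo)%E -> (-oo < b)%E ->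
  @measurable _ (path_space R) (reaches_left a b).
Proof.
move=> ay yb; rewrite reaches_leftE//; apply: bigcupT_measurable => m.
by apply: bigcapT_measurable => n; exact: measurable_crosses_below.
Qed.

(** [reaches_left] is an increasing union over upper levels tending to b, each term being a
    decreasing intersection over lower levels tending to a. The inner limit is [prob_crosses_limit];
    the outer one uses continuity of the inverse gap at b. *)
Lemma prob_reaches_left (a b : \bar R) : (left_end I <= a)%E -> (a < y%:E)%E ->
  (y%:E < b)%E -> (b <= right_end I)%E ->
  P (Y @^-1` reaches_left a b) = (ig a / (ig a + ig b))%:E.
Proof.
move=> la ay yb br.
have ayy : (a < +oo)%E by apply: lt_trans ay _; exact: ltry.
have bny : (-oo < b)%E by apply: lt_trans yb; exact: ltNyr.
have nI := near_from_below_interior itvI Iy br yb.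
pose V m := \bigcap_n (Y @^-1` crosses_below (from_above a n) (from_below b m)).
have -> : Y @^-1` reaches_left a b = \bigcup_m V m.
  by rewrite reaches_leftE// preimage_bigcup; apply: eq_bigcupr => m _;
    rewrite preimage_bigcap.
have mV m : measurable (V m).
  by apply: bigcapT_measurable => n; exact: measurable_crosses.
have cvV : P (V m) @[m --> \oo] --> P (\bigcup_m V m).
  apply: nondecreasing_cvg_mu => //; first exact: bigcupT_measurable.
  apply/nondecreasing_seqP => m; apply/subsetPset => w h n _.
  by apply: crosses_belowS (h n Logic.I) => //; exact: from_belowS.
have ig0 z : 0 <= ig z by exact: inv_gap_ge0.
have VE : \forall m \near \oo,
    (ig a / (ig a + ig (from_below b m)%:E))%:E = P (V m).
  by apply: filterS nI => m [ym Im]; rewrite prob_crosses_limit.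
have cv : P (V m) @[m --> \oo] --> (ig a / (ig a + ig b))%:E.
  apply: (cvg_trans (near_eq_cvg VE)); apply: cvg_EFin; first exact: nearW.
  (* A vanishing inverse gap at a is treated apart: the ratio is then 0 along the whole sequence,
     while the limiting denominator may be 0. *)
  have := ig0 a; rewrite le_eqVlt => /predU1P[<-|iga].
    rewrite mul0r; apply: cvg_near_cst; apply: nearW => m /=.
    by rewrite mul0r.
  apply: exit_ratio_cvg => //; first by rewrite ltr_wpDr.
    exact: cvg_cst.
  exact: (cvg_inv_gap_below itvI Iy conts incs).
exact: (cvg_unique _ cvV cv).
Qed.

(* Recurrent paths belong to all the events "reach a_n before the right end" but
   not to "reach the left end before the right end"; by [prob_reaches_left] the
   probability of the former tends to the probability of the latter. *)
Lemma ae_not_recurrent : (forall v, I v -> (left_end I < v%:E)%E) ->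
  (forall v, I v -> (v%:E < right_end I)%E) ->
  0 < ig (left_end I) + ig (right_end I) ->
  {ae P, forall w, ~ recurrent_path I (Y w)}.
Proof.
set l := left_end I; set r := right_end I => lI rI gap.
have ly : (l < y%:E)%E by exact: left_end_lt.
have yr : (y%:E < r)%E by exact: right_end_gt.
have lyy : (l < +oo)%E by apply: lt_trans ly _; exact: ltry.
have rny : (-oo < r)%E by apply: lt_trans yr; exact: ltNyr.
pose W n := Y @^-1` reaches_left (from_above l n)%:E r.
have mW n : measurable (W n).
  apply: (measurable_path_event filF diffY).
  by apply: measurable_reaches_left => //; exact: ltry.
pose W0 := Y @^-1` reaches_left l r.
have mW0 : measurable W0.
  by apply: (measurable_path_event filF diffY); exact: measurable_reaches_left.
have sub : W0 `<=` \bigcap_n W n.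
  move=> w [b' [br h]] n _; exists b'; split => // a' na'; apply: h.
  by apply: lt_trans na'; exact: from_above_gt.
have ig0 z : 0 <= ig z by exact: inv_gap_ge0.
have le : (P (\bigcap_n W n) <= P W0)%E.
  rewrite prob_reaches_left//.
  have cv : ig (from_above l n)%:E / (ig (from_above l n)%:E + ig r)
      @[n --> \oo] --> ig l / (ig l + ig r).
    apply: exit_ratio_cvg => //; last exact: cvg_cst.
    exact: (cvg_inv_gap_above itvI Iy conts incs).
  have cvE : (ig (from_above l n)%:E / (ig (from_above l n)%:E + ig r))%:E
      @[n --> \oo] --> (ig l / (ig l + ig r))%:E.
    by apply: cvg_EFin => //; exact: nearW.
  apply: (cvge_ge _ cvE).
  apply: filterS (near_from_above_interior itvI Iy (lexx l) ly) => n [ny In].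
  have <- := @prob_reaches_left (from_above l n)%:E r
    (left_end_le (interior_subset In)) _ yr (lexx r); last by rewrite lte_fin.
  apply: le_measure; rewrite ?inE.
  - exact: bigcapT_measurable.
  - exact: mW.
  - by move=> w; exact.
exists (\bigcap_n W n `\` W0); split.
- by apply: measurableD => //; exact: bigcapT_measurable.
- rewrite measureD//; last 2 first.
  + exact: bigcapT_measurable.
  + apply: le_lt_trans (probability_le1 _ _) _; last exact: ltry.
    exact: bigcapT_measurable.
  rewrite setIC (setIidl sub).
  apply: (@etrans _ _ (P W0 - P W0)%E); last first.
    by rewrite subee// fin_num_measure.
  congr (_ - _)%E; apply/eqP; rewrite eq_le; apply/andP; split; first exact: le.
  by rewrite le_measure ?inE//; exact: bigcapT_measurable.
move=> w /= /contrapT rec; split.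
(* A recurrent path visits a state below the n-th level. The maximum of the path up to that time is
   a state, hence strictly below the open right end, which leaves room for b'. *)
- move=> n _.
  have /ereal_inf_lt[_ [v Iv <-]] := @from_above_gt R l n lyy.
  rewrite lte_fin => vn.
  have /hits_reachP[u u0 wu] := rec v Iv 0%N.
  have [c /andP[c0 _] cmax] := path_max (Y w) u0.
  have [b' cb br] := ereal_real_between (rI _ (state_values diffY w c0)).
  exists b'; split => // a'; rewrite lte_fin => na'.
  exists u => //; split; first by rewrite wu (lt_trans vn).
  by move=> v' /cmax h; exact: le_lt_trans cb.
(* The path visits some level v > b' at a time u. To get below its own minimum over [0, u] it needs
   more time than u, but by then it has exceeded b'. *)
- move=> [b' [br h]].
  have /ereal_sup_gt[_ [v Iv <-]] := br; rewrite lte_fin => bv.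
  have /hits_reachP[u u0 wu] := rec v Iv 0%N.
  have [c /andP[c0 _] cmin] := path_min (Y w) u0.
  have [u' u'0 [h1 h2]] := h _ (lI _ (state_values diffY w c0)).
  have [uu|uu] := leP u u'.
    by have := h2 u; rewrite u0 uu wu => /(_ isT); lra.
  by have := cmin u'; rewrite u'0 (ltW uu) => /(_ isT); lra.
Qed.

End hitting_probability.

(** * Exit value of a single path *)

Section exit_of_a_path.
Context (R : realType).
Implicit Types (a b : \bar R) (w : cpath R).

(** The pathwise form of [exit_time]: [exit_time Y a b w] unfolds to
    [exit_path (a w) (b w) (Y w)]. *)
Definition exit_path a b w : \bar R :=
  ereal_inf [set t%:E | t in [set t : R | 0 <= t /\ ~ (a < (w t)%:E < b)%E]].

Lemma closed_EFin_le a : closed [set v : R | (v%:E <= a)%E].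
Proof.
case: a => [r| |].
- by rewrite (_ : [set v | _] = [set v | v <= r]); [exact: closed_le|
    apply/seteqP; split=> v; rewrite /= lee_fin].
- rewrite (_ : [set v | _] = setT); first exact: closedT.
  by apply/seteqP; split=> // v _; exact: leey.
- rewrite (_ : [set v | _] = set0); first exact: closed0.
  by apply/seteqP; split=> // v; rewrite /= leeNy_eq.
Qed.

Lemma closed_EFin_ge b : closed [set v : R | (b <= v%:E)%E].
Proof.
case: b => [r| |].
- by rewrite (_ : [set v | _] = [set v | r <= v]); [exact: closed_ge|
    apply/seteqP; split=> v; rewrite /= lee_fin].
- rewrite (_ : [set v | _] = set0); first exact: closed0.
  by apply/seteqP; split=> // v; rewrite /= leye_eq.
- rewrite (_ : [set v | _] = setT); first exact: closedT.
  by apply/seteqP; split=> // v _; exact: leNye.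
Qed.

Lemma outside_itvP a b (v : R) :
  ~ (a < v%:E < b)%E <-> (v%:E <= a)%E \/ (b <= v%:E)%E.
Proof.
split; first by move/negP; rewrite negb_and -!leNgt => /orP.
by rewrite !leNgt => -[] h; apply/negP; rewrite negb_and h ?orbT.
Qed.

Lemma exit_path_le a b w (t : R) : (exit_path a b w <= t%:E)%E <->
  exists2 u : R, 0 <= u <= t & (((w u)%:E <= a) \/ (b <= (w u)%:E))%E.
Proof.
have cl : closed [set t : R | 0 <= t /\ ~ (a < (w t)%:E < b)%E].
  rewrite (_ : [set t : R | _] = [set t : R | 0 <= t] `&`
    (fun u => w (Num.max u 0)) @^-1`
    ([set v : R | (v%:E <= a)%E] `|` [set v : R | (b <= v%:E)%E])).
    apply: closedI; first exact: closed_ge.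
    apply: preimage_closed; last first.
      by apply: closedU; [exact: closed_EFin_le|exact: closed_EFin_ge].
    by move=> u _; exact: cpath_ext_continuous.
  by apply/seteqP; split=> u [u0]; rewrite /= max_l//; move/outside_itvP.
rewrite /exit_path; rewrite (ereal_inf_closed_le _ cl); last by move=> u [].
split=> [[u [u0 /outside_itvP h] ut]|[u /andP[u0 ut] h]].
  by exists u => //; rewrite u0.
by exists u => //; split => //; apply/outside_itvP.
Qed.

Lemma exit_path_ge0 a b w : (0 <= exit_path a b w)%E.
Proof. by apply: le_ereal_inf_tmp => _ [u [u0 _] <-]; rewrite lee_fin. Qed.

Lemma exit_path_cases a b w :
  (exists u : R, [/\ exit_path a b w = u%:E, 0 <= u,
     ((w u)%:E <= a)%E \/ (b <= (w u)%:E)%E &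
     forall v : R, 0 <= v < u -> (a < (w v)%:E < b)%E]) \/
  (exit_path a b w = +oo%E /\ forall v : R, 0 <= v -> (a < (w v)%:E < b)%E).
Proof.
have := exit_path_ge0 a b w; case E : (exit_path a b w) => [u| |]// u0.
- left; exists u; split => //.
    have /exit_path_le[v /andP[v0 vu] h] : (exit_path a b w <= u%:E)%E by rewrite E.
    have uv : u <= v.
      by rewrite -lee_fin -E; apply/exit_path_le; exists v => //; rewrite v0 lexx.
    by have <- : v = u by apply/eqP; rewrite eq_le vu.
  move=> v /andP[v0 vu]; apply: contrapT => /outside_itvP h.
  have : (exit_path a b w <= v%:E)%E.
    by apply/exit_path_le; exists v => //; rewrite v0 lexx.
  by rewrite E lee_fin leNgt vu.
- right; split => // v v0; apply: contrapT => /outside_itvP h.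
  have : (exit_path a b w <= v%:E)%E.
    by apply/exit_path_le; exists v => //; rewrite v0 lexx.
  by rewrite E leye_eq.
Qed.

Lemma cvg_ereal_above (f : R -> R) a : (a < +oo)%E ->
  (\forall t \near +oo, (a <= (f t)%:E)%E) ->
  (forall v : R, (a < v%:E)%E -> \forall t \near +oo, f t < v) ->
  (f t)%:E @[t --> +oo] --> a.
Proof.
case: a => [r| |]// _ ge lt.
- apply: cvg_EFin; first exact: nearW.
  apply/cvgrPdist_lt => e e0.
  have := lt (r + e); rewrite lte_fin ltrDl => /(_ e0).
  apply: filterS2 ge => t; rewrite lee_fin => h1 h2 /=.
  by rewrite ltr_norml; lra.
- apply/cvgeNyPlt => A; apply: filterS (lt A (ltNyr _)) => t.
  by rewrite lte_fin.
Qed.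

Lemma cvg_ereal_below (f : R -> R) b : (-oo < b)%E ->
  (\forall t \near +oo, ((f t)%:E <= b)%E) ->
  (forall v : R, (v%:E < b)%E -> \forall t \near +oo, v < f t) ->
  (f t)%:E @[t --> +oo] --> b.
Proof.
case: b => [r| |]// _ le gt.
- apply: cvg_EFin; first exact: nearW.
  apply/cvgrPdist_lt => e e0.
  have := gt (r - e); rewrite lte_fin gtrBl => /(_ e0).
  apply: filterS2 le => t; rewrite lee_fin => h1 h2 /=.
  by rewrite ltr_norml; lra.
- apply/cvgeyPgt => A; apply: filterS (gt A (ltry _)) => t.
  by rewrite lte_fin.
Qed.

Lemma near_pinfty_nat (n : nat) : \forall t \near +oo, n%:R <= t :> R.
Proof. by apply: nbhs_pinfty_ge; exact: num_real. Qed.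

Lemma near_pinfty_ge0 : \forall t \near +oo, 0 <= t :> R.
Proof. by apply: nbhs_pinfty_ge; exact: num_real. Qed.

Definition path_at (t : \bar R) w : \bar R :=
  if t is u%:E then (w u)%:E else lim ((w u)%:E @[u --> +oo]).

Variables (I : set R) (y : R).
Hypothesis itvI : is_interval I.
Hypothesis Iy : I° y.

(** At a finite exit time the intermediate value theorem places the path exactly on a threshold. If
    there is no exit, the path is not recurrent by the last hypothesis, so it tends to an end of I;
    the threshold on that side must be this end, since an interior threshold would have been passed.
    In each case extrema over a compact time interval provide the margin in [reaches_left], or
    refute it. *)
Lemma exit_path_value a b w : w 0 = y -> (forall t, 0 <= t -> I (w t)) ->
  [\/ recurrent_path I w, path_to_left_end I w | path_to_right_end I w] ->
  (left_end I <= a)%E -> (a < y%:E)%E -> (y%:E < b)%E -> (b <= right_end I)%E ->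
  (recurrent_path I w -> exists2 v, I v & (v%:E <= a)%E \/ (b <= v%:E)%E) ->
  let z := if pselect (reaches_left a b w) then a else b in
  (w (min_time t (exit_path a b w)))%:E @[t --> +oo] --> z /\
  path_at (exit_path a b w) w = z.
Proof.
move=> w0 Iw dich la ay yb br nrec z.
have ayy : (a < +oo)%E by apply: lt_trans ay _; exact: ltry.
have bny : (-oo < b)%E by apply: lt_trans yb; exact: ltNyr.
have zT : reaches_left a b w -> z = a.
  by rewrite /z => h; case: pselect.
have zF : ~ reaches_left a b w -> z = b.
  by rewrite /z => h; case: pselect.
have [[u [E u0 out inside]]|[E inside]] := exit_path_cases a b w.
- suff wz : (w u)%:E = z.
    rewrite E /= wz; split => //; apply: cvg_near_cst.
    have h : \forall t \near +oo, u <= t.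
      by apply: nbhs_pinfty_ge; exact: num_real.
    by apply: filterS h => t ut; rewrite min_time_idr.
  case: out => out.
  + have wa : (w u)%:E = a.
      apply/eqP; rewrite eq_le out leNgt; apply/negP => wa.
      case: a ay la wa {inside E z zT zF nrec ayy} out (inside) =>
        [r| |]// ay la; rewrite lte_fin => wr _ inside.
      have [|v /andP[v0 vu] wv] := @path_ivt R w 0 u r (lexx 0) u0.
        by right; rewrite w0 (ltW wr)/= ltW.
      have vlt : v < u.
        by rewrite lt_neqAle vu andbT; apply/eqP => vE; move: wr; rewrite -vE wv ltxx.
      by have := inside v; rewrite v0 vlt wv ltxx => /(_ isT).
    (* The maximum of the path up to its exit at a is strictly below b, which leaves room for b'. *)
    rewrite wa zT//; have [c /andP[c0 cu] cmax] := path_max w u0.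
    have cb : ((w c)%:E < b)%E.
      have [cu'|uc] := ltP c u.
        by have := inside c; rewrite c0 cu' => /(_ isT)/andP[].
      have -> : c = u by apply/eqP; rewrite eq_le cu.
      by rewrite wa; exact: lt_trans yb.
    have [b' cb' bb] := ereal_real_between cb.
    exists b'; split => // a' aa'; exists u => //; split.
      by rewrite -lte_fin wa.
    by move=> v /cmax h; exact: le_lt_trans cb'.
  + have wb : (w u)%:E = b.
      apply/eqP; rewrite eq_le out andbT leNgt; apply/negP => wb.
      have [r rE] : exists r : R, b = r%:E by case: (b) yb wb => [r| |]//; exists r.
      have wr : r < w u by rewrite -lte_fin -rE.
      have yr : y < r by rewrite -lte_fin -rE.
      have [|v /andP[v0 vu] wv] := @path_ivt R w 0 u r (lexx 0) u0.
        by left; rewrite w0 (ltW wr) ltW.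
      have vlt : v < u.
        by rewrite lt_neqAle vu andbT; apply/eqP => vE; move: wr; rewrite -vE wv ltxx.
      by have := inside v; rewrite v0 vlt wv rE ltxx andbF => /(_ isT).
    rewrite wb zF// => -[b' [bb h]].
    have [c /andP[c0 cu] cmin] := path_min w u0.
    have ac : (a < (w c)%:E)%E.
      have [cu'|uc] := ltP c u.
        by have := inside c; rewrite c0 cu' => /(_ isT)/andP[].
      have -> : c = u by apply/eqP; rewrite eq_le cu.
      by rewrite wb; exact: lt_trans yb.
    have [v v0 [h1 h2]] := h _ ac.
    have [uv|vu] := leP u v.
      by have := h2 u; rewrite u0 uv -lte_fin wb => /(_ isT)/(lt_trans bb); rewrite ltxx.
    by have := cmin v; rewrite v0 (ltW vu) => /(_ isT); lra.
- rewrite E /=.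
  suff cvz : (w t)%:E @[t --> +oo] --> z.
    split; last exact: cvg_lim.
    apply: cvg_trans cvz; apply: near_eq_cvg.
    by apply: filterS near_pinfty_ge0 => t t0; rewrite min_time_idl// leey.
  case: dich => [rec|[left leftI]|[right rightI]].
  + have [v Iv h] := nrec rec.
    have /hits_reachP[u u0 wu] := rec v Iv 0%N.
    have /andP[h1 h2] := inside u u0; rewrite wu in h1 h2.
    by exfalso; case: h; rewrite leNgt ?h1 ?h2.
  + have aE : a = left_end I.
      apply/eqP; rewrite eq_le la andbT leNgt; apply/negP => la'.
      have [r rE] : exists r : R, a = r%:E.
        by case: (a) la' ay => [r _ _|//|]; [exists r|rewrite ltNge leNye].
      rewrite rE in la' ay inside.
      have Ir : I° r by apply: (interior_left itvI Iy (lexx _) la'); exact: ltW.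
      have [n /(_ n%:R (lexx _)) h] := left r Ir.
      by have /andP[] := inside n%:R (ler0n _ _); rewrite lte_fin ltNge (ltW h).
    have near_lt v : (a < v%:E)%E -> \forall t \near +oo, w t < v.
      move=> av; have amin : (a < (Num.min v y)%:E)%E.
        by rewrite EFin_min lt_min av.
      have Iv : I° (Num.min v y).
        by apply: (interior_left itvI Iy la amin); rewrite ge_min lexx orbT.
      have [n h] := left _ Iv; apply: filterS (near_pinfty_nat n) => t /h.
      by rewrite lt_min => /andP[].
    rewrite zT.
      apply: cvg_ereal_above => //.
      by apply: filterS near_pinfty_ge0 => t /inside/andP[/ltW].
    have [n0 wy] : exists n : nat, forall u, n%:R <= u -> w u < y.
      exact: left.
    have [c /andP[c0 cu] cmax] := path_max w (ler0n R n0).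
    have /andP[_ cb] := inside c c0.
    have cb2 : ((Num.max (w c) y)%:E < b)%E by rewrite EFin_max gt_max cb.
    have [b' cb' bb] := ereal_real_between cb2.
    move: cb'; rewrite gt_max => /andP[cb' yb'].
    exists b'; split => // a' aa'.
    have [t [ta t0]] := filter_ex (filterI (near_lt _ aa') near_pinfty_ge0).
    exists t => //; split => // v /andP[v0 vt].
    have [nv|vn] := leP n0%:R v; first exact: lt_trans (wy _ nv) yb'.
    by apply: le_lt_trans cb'; apply: cmax; rewrite v0 ltW.
  + have bE : b = right_end I.
      apply/eqP; rewrite eq_le br /= leNgt; apply/negP => br'.
      have [r rE] : exists r : R, b = r%:E.
        by case: (b) br' yb => [r _ _||//]; [exists r|rewrite ltNge leey].
      rewrite rE in br' yb inside.
      have Ir : I° r by apply: (interior_right itvI Iy (lexx _) br'); exact: ltW.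
      have [n /(_ n%:R (lexx _)) h] := right r Ir.
      by have /andP[_] := inside n%:R (ler0n _ _); rewrite lte_fin ltNge (ltW h).
    have near_gt v : (v%:E < b)%E -> \forall t \near +oo, v < w t.
      move=> vb; have bmax : ((Num.max v y)%:E < b)%E.
        by rewrite EFin_max gt_max vb.
      have Iv : I° (Num.max v y).
        by apply: (interior_right itvI Iy br bmax); rewrite le_max lexx orbT.
      have [n h] := right _ Iv; apply: filterS (near_pinfty_nat n) => t /h.
      by rewrite gt_max => /andP[].
    rewrite zF.
      apply: cvg_ereal_below => //.
      by apply: filterS near_pinfty_ge0 => t /inside/andP[_ /ltW].
    move=> [b' [bb h]].
    have [n0 wy] : exists n : nat, forall u, n%:R <= u -> y < w u.
      exact: right.
    have [c /andP[c0 cu] cmin] := path_min w (ler0n R n0).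
    have /andP[ac _] := inside c c0.
    have ac2 : (a < (Num.min (w c) y)%:E)%E by rewrite EFin_min lt_min ac.
    have [v v0 [h1 _]] := h _ ac2.
    move: h1; rewrite lt_min => /andP[h1 h2].
    have [nv|vn] := leP n0%:R v; first by have := wy _ nv; lra.
    by have := cmin v; rewrite v0 (ltW vn) => /(_ isT); lra.
Qed.

End exit_of_a_path.

(** * Stopped values *)

Section path_limits.
Context (R : realType).
Implicit Types (w : cpath R) (z : \bar R).

Lemma cvg_ereal_between (f : R -> R) z :
  (forall v : R, (v%:E < z)%E -> \forall t \near +oo, v < f t) ->
  (forall v : R, (z < v%:E)%E -> \forall t \near +oo, f t < v) ->
  (f t)%:E @[t --> +oo] --> z.
Proof.
case: z => [r| |] below above.
- apply: cvg_EFin; first exact: nearW.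
  apply/cvgrPdist_lt => e e0.
  have h1 := below (r - e); have h2 := above (r + e).
  rewrite lte_fin ltrBlDr ltrDl in h1; rewrite lte_fin ltrDl in h2.
  apply: filterS2 (h1 e0) (h2 e0) => t {}h1 {}h2 /=.
  by rewrite ltr_norml; lra.
- apply/cvgeyPgt => A; apply: filterS (below A (ltry _)) => t.
  by rewrite lte_fin.
- apply/cvgeNyPlt => A; apply: filterS (above A (ltNyr _)) => t.
  by rewrite lte_fin.
Qed.

Definition oscillates (p q : rat) : set (cpath R) :=
  visits_io (fun v : R => v - ratr p) `&` visits_io (fun v : R => ratr q - v).

Definition converges : set (cpath R) :=
  [set w | exists z : \bar R, (w t)%:E @[t --> +oo] --> z].

Lemma not_visits_io (f : R -> R) w : ~ visits_io f w ->
  \forall t \near +oo, 0 < f (w t).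
Proof.
move=> /existsNP[n nh].
apply: filterS (near_pinfty_nat R n) => t nt.
by rewrite ltNge; apply/negP => h; apply: nh; exists t.
Qed.

Lemma visits_io_not_near (f : R -> R) w :
  (\forall t \near +oo, 0 < f (w t)) -> ~ visits_io f w.
Proof.
move=> [M [_ h]] /(_ (Num.truncn `|M|).+1)[u un].
rewrite leNgt => /negP; apply; apply: h.
apply: le_lt_trans (ler_norm M) _; apply: lt_le_trans (truncnS_gt _) _.
exact: un.
Qed.

Lemma cvg_ereal_near_lt (f : R -> R) z (v : R) : (f t)%:E @[t --> +oo] --> z ->
  (z < v%:E)%E -> \forall t \near +oo, f t < v.
Proof.
move=> cz zv; have /cz : nbhs z [set u | (u < v%:E)%E].
  by apply: open_nbhs_nbhs; split => //; exact: open_ereal_lt_ereal.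
move=> h; have {}h : \forall t \near +oo, ((f t)%:E < v%:E)%E by exact: h.
by apply: filterS h => t; rewrite lte_fin.
Qed.

Lemma cvg_ereal_near_gt (f : R -> R) z (v : R) : (f t)%:E @[t --> +oo] --> z ->
  (v%:E < z)%E -> \forall t \near +oo, v < f t.
Proof.
move=> cz zv; have /cz : nbhs z [set u | (v%:E < u)%E].
  by apply: open_nbhs_nbhs; split => //; exact: open_ereal_gt_ereal.
move=> h; have {}h : \forall t \near +oo, (v%:E < (f t)%:E)%E by exact: h.
by apply: filterS h => t; rewrite lte_fin.
Qed.

(** A path has no limit in the extended reals exactly when it oscillates between two rational
    levels. This makes convergence an event. *)
Lemma convergesE : converges =
  ~` \bigcup_(p : rat) \bigcup_(q in [set q : rat | p < q]) oscillates p q.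
Proof.
apply/seteqP; split => w.
- move=> [z cz] [p _ [q /= pq [iop ioq]]].
  have pq' : (ratr p : R) < ratr q by rewrite ltr_rat.
  have [zq|qz] := ltP z (ratr q)%:E%E.
  + apply: visits_io_not_near ioq.
    by apply: filterS (cvg_ereal_near_lt cz zq) => t; rewrite subr_gt0.
  + apply: visits_io_not_near iop.
    have pz : ((ratr p : R)%:E < z)%E by apply: lt_le_trans qz; rewrite lte_fin.
    by apply: filterS (cvg_ereal_near_gt cz pz) => t; rewrite subr_gt0.
- move=> nosc.
  (* The supremum of D is the lower limit of the path; it is the limit in the absence of
     oscillation. *)
  set D := [set v : \bar R | exists2 q : rat, v = (ratr q)%:E &
    \forall t \near +oo, (ratr q : R) < w t].
  exists (ereal_sup D); apply: cvg_ereal_between => v.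
  + move=> /ereal_sup_gt[_ [q -> h]]; rewrite lte_fin => vq.
    by apply: filterS h => t; exact: lt_trans.
  + move=> /ereal_real_between_lt[v' v'v Dv'].
    have [p /andP[v'p pv]] := @rat_in_itvoo R _ _ v'v.
    have [q /andP[pq qv]] := @rat_in_itvoo R _ _ pv.
    rewrite !bnd_simp in v'p pv pq qv.
    have Dp : (ereal_sup D < (ratr p : R)%:E)%E.
      by apply: lt_trans Dv' _; rewrite lte_fin.
    have iop : visits_io (fun v : R => v - ratr p) w.
      apply: contrapT => /not_visits_io h.
      have /ereal_sup_ubound : D (ratr p)%:E.
        by exists p => //; apply: filterS h => t; rewrite subr_gt0.
      by rewrite leNgt Dp.
    have : ~ visits_io (fun v : R => ratr q - v) w.
      move=> ioq; apply: nosc; exists p => //; exists q => //=.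
      by rewrite -(ltr_rat R).
    move=> /not_visits_io; apply: filterS => t; rewrite subr_gt0 => h.
    exact: lt_trans h qv.
Qed.

Lemma measurable_visits_io (f : R -> R) : continuous f ->
  @measurable _ (path_space R) (visits_io f).
Proof.
move=> cf; rewrite (_ : visits_io f = \bigcap_n hits_after f n%:R).
  by apply: bigcapT_measurable => n; exact: hits_after_measurable.
by apply/seteqP; split => w h n => [_|]; exact: h.
Qed.

Lemma measurable_converges : @measurable _ (path_space R) converges.
Proof.
rewrite convergesE; apply: measurableC.
apply: bigcupT_measurable_rat => p.
rewrite (_ : \bigcup_(q in _) _ =
  \bigcup_q (if p < q then oscillates p q else set0)); last first.
  apply/seteqP; split => w [q] => [/= pq h|_].
  - by exists q => //; rewrite pq.
  - by case: ifP => // pq h; exists q.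
apply: bigcupT_measurable_rat => q; case: ifP => _ //.
apply: measurableI; apply: measurable_visits_io.
- by move=> v; apply: cvgB; [exact: cvg_id|exact: cvg_cst].
- by move=> v; apply: cvgB; [exact: cvg_cst|exact: cvg_id].
Qed.

Lemma measurable_eval (t : R) : 0 <= t ->
  measurable_fun setT (fun w : path_space R => (w : cpath R) t).
Proof.
move=> t0 _ B mB; rewrite setTI; apply: sub_sigma_algebra.
by exists t; exists B.
Qed.

Lemma path_at_pinfty_cvg w (z : \bar R) : (w t)%:E @[t --> +oo] --> z ->
  path_at +oo w = z.
Proof. by move=> h; apply/cvg_lim. Qed.

Lemma measurable_path_limit :
  measurable_fun setT (fun w : path_space R => path_at +oo w).
Proof.
have mC := measurable_converges.
rewrite -(setUv converges); apply/measurable_funU => //; first exact: measurableC.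
split.
- apply: (@emeasurable_fun_cvg _ _ _ _ (fun n (w : path_space R) => (w n%:R)%:E)).
  + move=> n; apply: measurable_funTS; apply/measurable_EFinP.
    exact: measurable_eval.
  + move=> w [z cz]; rewrite (path_at_pinfty_cvg cz).
    apply: (cvg_comp (fun n : nat => n%:R : R) _ _ cz).
    exact: cvgr_idn.
(* Along a divergent path [lim] returns the default [point], so the function is constant off
   [converges]. *)
- apply: (@eq_measurable_fun _ _ _ _ _ (cst (point : \bar R))); last exact: measurable_cst.
  move=> w; rewrite inE => nc /=; rewrite dvgP// => cv; apply: nc.
  by exists (lim ((w u)%:E @[u --> +oo])).
Qed.
End path_limits.

Section stopped_values.
Context d (T : measurableType d) (R : realType) (P : probability T R).
Variables (F : R -> set (set T)) (I : set R) (y : R).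
Variables (Y : T -> path_space R) (k : R.-pker R ~> path_space R).
Hypothesis filF : filtration F.
Hypothesis diffY : regular_diffusion P F I y Y k.

Lemma stopped_value_path_at tau w : stopped_value Y tau w = path_at (tau w) (Y w).
Proof. by []. Qed.

Lemma path_at_cvg (r : \bar R) (w : cpath R) : (0 <= r)%E -> (r < +oo)%E ->
  (w (min_time t r))%:E @[t --> +oo] --> path_at r w.
Proof.
case: r => [r| |]// r0 _; apply: cvg_near_cst.
apply: filterS (@nbhs_pinfty_ge R r (num_real _)) => t rt.
by rewrite min_time_idr// -lee_fin.
Qed.

Lemma min_time_pinfty t : min_time t +oo%E = t :> R.
Proof. by rewrite /min_time /mine ltry. Qed.

Lemma stopped_value_cvg tau w z : (0 <= tau w)%E ->
  (Y w (min_time t (tau w)))%:E @[t --> +oo] --> z -> stopped_value Y tau w = z.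
Proof.
move=> t0 cz; rewrite stopped_value_path_at.
have [fin|] := ltP (tau w) +oo%E.
  exact: (cvg_unique _ (path_at_cvg (w := Y w) t0 fin) cz).
rewrite leye_eq => /eqP tw; rewrite tw; apply: path_at_pinfty_cvg.
apply: cvg_trans cz; rewrite tw; apply: near_eq_cvg; apply: nearW => t.
by rewrite min_time_pinfty.
Qed.

Lemma measurable_stopped_value tau : stopping_time F tau ->
  measurable_fun setT (stopped_value Y tau).
Proof.
move=> stop; have mfin := stopping_measurable_fin filF stop.
have inv : setT = [set w | (tau w < +oo)%E] `|` ~` [set w | (tau w < +oo)%E].
  by rewrite setUv.
rewrite inv; apply/measurable_funU => //; first exact: measurableC.
split.
- apply: (@emeasurable_fun_cvg _ _ _ _ (fun n w => (Y w (min_time n%:R (tau w)))%:E)).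
  + move=> n; apply: measurable_funTS; apply/measurable_EFinP.
    apply: (@measurable_stopped _ T R F (fun u w => Y w u) tau n%:R filF) => //.
    * exact: (diffusion_adapted diffY).
    * by move=> w; exact: cpath_ext_continuous.
  + move=> w /= fin; rewrite stopped_value_path_at.
    apply: (cvg_comp (fun n : nat => n%:R : R) _ _ (path_at_cvg (w := Y w) _ fin)).
    * exact: cvgr_idn.
    * by have [] := stop.
- apply: (@eq_measurable_fun _ _ _ _ _ (fun w => path_at +oo (Y w))).
    move=> w; rewrite inE stopped_value_path_at /= => /negP.
    by rewrite -leNgt leye_eq => /eqP ->.
  apply: measurable_funTS; apply: measurableT_comp; first exact: measurable_path_limit.
  exact: measurable_diffusion filF diffY.
Qed.

Lemma measurable_wrtE t d' (T' : measurableType d') (f : T -> T') : 0 <= t ->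
  measurable_wrt (F t) f <->
  measurable_fun setT (f : g_sigma_algebraType (F t) -> T').
Proof.
move=> t0; have sF := filtration_salgebra filF t0.
split => [h _ B mB|h B mB].
  by rewrite setTI; apply: sub_sigma_algebra; exact: h.
have := h measurableT B mB; rewrite setTI.
suff -> : @measurable _ (g_sigma_algebraType (F t)) = F t by [].
exact: sigma_algebra_id.
Qed.

(** With thresholds known at time 0, Y - a and b - Y are adapted continuous processes, and the exit
    is their first passage to the nonpositive reals; [sg] is the sign that produces either process.
    Infinite thresholds are separated: a = +oo or b = -oo forces exit at time 0, while a = -oo and b
    = +oo are never hit. *)
Lemma exit_time_stopping (a b : T -> \bar R) :
  measurable_wrt (F 0) a -> measurable_wrt (F 0) b ->
  stopping_time F (exit_time Y a b).
Proof.
move=> ma mb; split => [w|t t0]; first exact: exit_path_ge0.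
have sF := filtration_salgebra filF t0.
have wrt (f : T -> \bar R) : measurable_wrt (F 0) f -> measurable_wrt (F t) f.
  by move=> mf B mB; apply: (proj2 filF 0 t _ t0) => //; exact: mf.
have hit (f : T -> \bar R) (sg : R) : measurable_wrt (F 0) f ->
    F t [set w | f w \is a fin_num /\
      exists2 u : R, 0 <= u <= t & sg * Y w u - fine (f w) <= 0].
  move=> /wrt mf; apply: (@salgebraI _ _ sF (f @^-1` [set z | z \is a fin_num])).
    apply: mf; rewrite (_ : [set z | _] = EFin @` setT).
      apply: measurable_image_EFin; exact: measurableT.
    apply/seteqP; split => z /=.
      by move=> /fineK <-; exists (fine z).
    by move=> [v _ <-].
  apply: (@hit_sigma_algebra _ _ _ (fun u w => sg * Y w u - fine (f w))) => //.
    move=> w; apply: (@comp_within _ (fun v : R => sg * v - fine (f w)) (Y w)).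
      move=> v; apply: cvgB; last exact: cvg_cst.
      by apply: cvgM; [exact: cvg_cst|exact: cvg_id].
    exact: (@cpath_within _ (Y w)).
  move=> u /andP[u0 ut]; apply/(measurable_wrtE _ t0).
  apply: measurable_funB.
    apply: measurable_funM; first exact: measurable_cst.
    apply/(measurable_wrtE _ t0) => B mB; apply: (proj2 filF u t u0 ut).
    exact: (diffusion_adapted diffY).
  apply: measurableT_comp; first exact: fine_measurable.
  exact/(measurable_wrtE _ t0).
rewrite (_ : [set w | _] =
  ((a @^-1` [set +oo%E]) `|` [set w | a w \is a fin_num /\
      exists2 u : R, 0 <= u <= t & 1 * Y w u - fine (a w) <= 0]) `|`
  ((b @^-1` [set -oo%E]) `|` [set w | b w \is a fin_num /\
      exists2 u : R, 0 <= u <= t & (-1) * Y w u - fine (oppe (b w)) <= 0])).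
  apply: (salgebraU sF); apply: (salgebraU sF).
  - by apply: wrt.
  - exact: hit.
  - by apply: wrt.
  - have mN : measurable_wrt (F 0) (fun w => oppe (b w)).
      apply/(measurable_wrtE _ (lexx 0)); apply: measurableT_comp => //.
      exact/(measurable_wrtE _ (lexx 0)).
    by have := hit _ (-1) mN; under eq_set do rewrite fin_numN.
apply/seteqP; split => w.
  move=> /exit_path_le[u ut [au|bu]]; [left|right].
  - case E: (a w) au => [r| |]//.
      rewrite lee_fin => h; right => /=; rewrite E; split => //.
      by exists u => //; rewrite mul1r subr_le0.
    by move=> _; left.
  - case E: (b w) bu => [r| |]//.
      rewrite lee_fin => h; right => /=; rewrite E; split => //.
      by exists u => //=; rewrite mulN1r opprK addrC subr_le0.
    by move=> _; left.
move=> h; apply/exit_path_le; case: h => [[aw|[fa [u ut h]]]|[bw|[fb [u ut h]]]].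
- by exists 0; [rewrite lexx|left; rewrite aw leey].
- exists u => //; left; rewrite -(fineK fa) lee_fin.
  by rewrite mul1r subr_le0 in h.
- by exists 0; [rewrite lexx|right; rewrite bw leNye].
- exists u => //; right; rewrite -(fineK fb) lee_fin.
  by move: h; rewrite fineN mulN1r opprK addrC subr_le0.
Qed.

End stopped_values.

(** * Quantile transforms *)

Section density_measure.
Import HBNNSimple.
Context d (T : measurableType d) (R : realType) (mu : {measure set T -> \bar R}).
Variable h : T -> R.

(** Measurability and positivity of h are arguments of the set function so that a measure structure
    can be attached to it. *)
Definition density_measure of measurable_fun setT h & (forall w, 0 <= h w) :=
  fun A : set T => (\int[mu]_(w in A) (h w)%:E)%E.

Variables (mh : measurable_fun setT h) (h0 : forall w, 0 <= h w).
Local Notation nu := (density_measure mh h0).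

Let nu0 : nu set0 = 0%E. Proof. exact: integral_set0. Qed.
Let nu_ge0 A : (0 <= nu A)%E.
Proof. by apply: integral_ge0 => w _; rewrite lee_fin. Qed.
Let nu_sigma : semi_sigma_additive nu.
Proof.
apply: semi_sigma_additive_nng_induced; first exact/measurable_EFinP.
by move=> w; rewrite lee_fin.
Qed.

HB.instance Definition _ := isMeasure.Build _ _ _ nu nu0 nu_ge0 nu_sigma.

Lemma integral_density_measure_nnsfun (f : {nnsfun T >-> R}) :
  (\int[nu]_w (f w)%:E = \int[mu]_w ((f w)%:E * (h w)%:E))%E.
Proof.
rewrite integral_nnsfun// patch_setT sintegralE.
transitivity (\sum_(r \in range f)
    \int[mu]_w ((r * \1_(f @^-1` [set r]) w)%:E * (h w)%:E))%E.
  apply: eq_fsbigr => r; rewrite inE => -[w0 _ <-]; set A := _ @^-1` _.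
  have mA : measurable A by exact: measurable_sfunP.
  have f0 : (0 <= (f w0)%:E)%E by rewrite lee_fin.
  rewrite /= /density_measure integral_mkcond -ge0_integralZl//; first last.
  - by move=> w _; rewrite patchE; case: ifP => // _; rewrite lee_fin.
  - apply/(measurable_restrictT _ mA); apply: measurable_funTS.
    exact/measurable_EFinP.
  apply: eq_integral => w _; rewrite patchE indicE.
  by case: ifP => _; rewrite ?mulr1 ?mulr0 ?mule0 ?mul0e.
rewrite -ge0_integral_fsum//.
- apply: eq_integral => w _; rewrite [in RHS]fimfunE -fsumEFin//.
  rewrite -ge0_mule_fsuml// => r; rewrite lee_fin; exact: nnfun_muleindic_ge0.
- move=> r; apply: emeasurable_funM; last exact/measurable_EFinP.
  exact/measurable_EFinP/measurable_funM.
- move=> r w _; apply: mule_ge0; last by rewrite lee_fin.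
  exact: nnfun_muleindic_ge0.
Qed.

Lemma ge0_integral_density_measure (f : T -> \bar R) :
  measurable_fun setT f -> (forall w, 0 <= f w)%E ->
  (\int[nu]_w f w = \int[mu]_w (f w * (h w)%:E))%E.
Proof.
move=> mf f0; pose f_ := nnsfun_approx measurableT mf.
have cf w : (EFin \o f_^~ w) n @[n --> \oo] --> f w by exact: cvg_nnsfun_approx.
transitivity (limn (fun n => \int[nu]_w (f_ n w)%:E)%E).
  rewrite -monotone_convergence//.
  - by apply: eq_integral => w _; apply/esym/cvg_lim => //; exact: cf.
  - by move=> n; exact/measurable_EFinP/measurable_funP.
  - by move=> n w _; rewrite lee_fin.
  - by move=> w _ m n mn; rewrite lee_fin; exact/lefP/nd_nnsfun_approx.
under eq_fun do rewrite integral_density_measure_nnsfun.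
rewrite -monotone_convergence//.
- apply: eq_integral => w _; rewrite limeMr//.
    by congr (_ * _)%E; apply/cvg_lim => //; exact: cf.
  by apply/cvg_ex; exists (f w); exact: cf.
- move=> n; apply: emeasurable_funM; last exact/measurable_EFinP.
  exact/measurable_EFinP/measurable_funP.
- by move=> n w _; apply: mule_ge0; rewrite lee_fin.
- move=> w _ m n mn; apply: lee_wpmul2r; first by rewrite lee_fin.
  by rewrite lee_fin; exact/lefP/nd_nnsfun_approx.
Qed.

End density_measure.

Section down_closed_sets.
Context (R : realType).

(** Such a set is a ray ending at its supremum, closed or open according to whether the supremum
    belongs to it. *)
Lemma measurable_down_closed (D : set (\bar R)) :
  (forall u v : \bar R, (u <= v)%E -> D v -> D u) -> measurable D.
Proof.
move=> dc; pose c := ereal_sup D.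
have h v : D v -> (v <= c)%E by exact: ereal_sup_ubound.
have h' v : (v < c)%E -> D v.
  by move=> /ereal_sup_gt[u Du /ltW vu]; exact: dc Du.
have [Dc|nDc] := pselect (D c).
- rewrite (_ : D = `]-oo, c]%classic); first exact: emeasurable_itv.
  by apply/seteqP; split => v /=; rewrite in_itv/=; [exact: h|move=> vc; exact: dc Dc].
- rewrite (_ : D = `]-oo, c[%classic); first exact: emeasurable_itv.
  apply/seteqP; split => v /=; rewrite in_itv/=; last exact: h'.
  move=> Dv; rewrite lt_neqAle h// andbT; apply/eqP => vc.
  by apply: nDc; rewrite -vc.
Qed.

Lemma measurable_fun_rays d (T : measurableType d) (f : T -> \bar R) :
  (forall z, measurable [set w | (f w <= z)%E]) -> measurable_fun setT f.
Proof.
move=> mf; apply: (measurability _ (ErealGenOInfty.measurableE R)).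
move=> _ [_ [r ->] <-]; rewrite setTI.
rewrite (_ : _ @^-1` _ = ~` [set w | (f w <= r%:E)%E]); first exact: measurableC.
by apply/seteqP; split => w /=; rewrite in_itv/= andbT ltNge => /negP.
Qed.

Lemma nondecreasing_emeasurable (f : \bar R -> \bar R) :
  (forall u v, (u <= v)%E -> (f u <= f v)%E) -> measurable_fun setT f.
Proof.
move=> mono; apply: measurable_fun_rays => z; apply: measurable_down_closed.
by move=> u v uv /=; apply: le_trans; exact: mono.
Qed.

(** Closed lower rays form a generating class stable under intersection, and the ray at +oo is the
    whole space. *)
Lemma measure_eq_rays (m1 m2 : {measure set (\bar R) -> \bar R}) :
  (m1 setT < +oo)%E ->
  (forall z, m1 [set v | (v <= z)%E] = m2 [set v | (v <= z)%E]) ->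
  forall C, measurable C -> m1 C = m2 C.
Proof.
move=> fin eqm C mC.
pose G := [set A : set (\bar R) | exists z, A = [set v | (v <= z)%E]].
have GT : [set v : \bar R | (v <= +oo)%E] = setT.
  by apply/seteqP; split => v // _; exact: leey.
apply: (@g_sigma_algebra_measure_unique _ R _ G _ (fun=> setT)).
- move=> _ [z ->]; apply: measurable_down_closed => u v uv /=.
  exact: le_trans.
- by move=> _; exists +oo%E; rewrite GT.
- by rewrite bigcup_const.
- move=> _ _ [z ->] [z' ->]; exists (Order.min z z').
  by apply/seteqP; split => v /=; rewrite le_min => /andP.
- by move=> _ [z ->]; exact: eqm.
- by [].
- move: mC; rewrite (_ : measurable C = emeasurable (@ocitv R) C)//.
  rewrite ErealGenOInfty.measurableE.
  apply: smallest_sub; first exact: smallest_sigma_algebra.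
  move=> _ [r ->].
  have -> : `]r%:E, +oo[%classic = ~` [set v : \bar R | (v <= r%:E)%E].
    by apply/seteqP; split => w /=; rewrite in_itv/= andbT ltNge => /negP.
  have [_ sC _] := smallest_sigma_algebra setT G.
  rewrite -setTD; apply: sC; apply: sub_sigma_algebra; by exists r%:E.
Qed.

End down_closed_sets.

Section quantile.
Context d (T : measurableType d) (R : realType) (P : probability T R).
Variable U : T -> R.
Hypothesis mU : measurable_fun setT U.
Hypothesis atomless : forall u, P (U @^-1` [set u]) = 0%E.

Lemma measurable_preimageT d' (T' : measurableType d') (f : T -> T') (A : set T') :
  measurable_fun setT f -> measurable A -> measurable (f @^-1` A).
Proof. by move=> mf mA; rewrite -[_ @^-1` _]setTI; exact: mf. Qed.

Let X w : \bar R := (U w)%:E.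
Let mX : measurable_fun setT X. Proof. exact/measurable_EFinP. Qed.

Let m_le c : measurable [set w | (X w <= c)%E].
Proof.
apply: (measurable_preimageT (A := [set v : \bar R | (v <= c)%E]) mX).
by apply: measurable_down_closed => u v uv /=; exact: le_trans.
Qed.

Let m_lt c : measurable [set w | (X w < c)%E].
Proof.
apply: (measurable_preimageT (A := [set v : \bar R | (v < c)%E]) mX).
by apply: measurable_down_closed => u v uv /=; exact: le_lt_trans.
Qed.

Lemma atomless_lt_le c : P [set w | (X w < c)%E] = P [set w | (X w <= c)%E].
Proof.
case: c => [r| |].
- rewrite (_ : [set w | (X w <= r%:E)%E] = [set w | (X w < r%:E)%E] `|` U @^-1` [set r]).
    rewrite measureU0//.
      exact: (measurable_preimageT (A := [set r]) mU).
    exact: atomless.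
  apply/seteqP; split => w /=; rewrite /X lte_fin lee_fin.
    by rewrite le_eqVlt => /orP[/eqP|]; [right|left].
  by move=> [/ltW|->].
- by congr (P _); apply/seteqP; split => w /= _; rewrite ?ltry ?leey.
- by congr (P _); apply/seteqP; split => w /=.
Qed.

(** The distribution function K of an atomless variable U makes K(U) uniform. With c the supremum of
    {K <= p}, the level set lies between {U < c} and {U <= c} up to a null set, and both have
    probability p by continuity of P along monotone sequences. U is read in the extended reals
    because c may be infinite. *)
Lemma atomless_level (p : \bar R) : (0 <= p <= 1)%E ->
  P [set w | (P [set w' | (X w' <= X w)%E] <= p)%E] = p.
Proof.
move=> /andP[p0 p1]; pose K (x : R) := P [set w' | (X w' <= x%:E)%E].
have Kle x z : (x <= z) -> (K x <= K z)%E.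
  move=> xz; apply: le_measure; rewrite ?inE//; try exact: m_le.
  by move=> w /= h; apply: le_trans h _; rewrite lee_fin.
pose A := [set x : R | (K x <= p)%E].
pose c := ereal_sup (EFin @` A).
have below v : (v%:E < c)%E -> A v.
  by move=> /ereal_sup_gt[_ [u Au <-]]; rewrite lte_fin => /ltW/Kle h; exact: le_trans h Au.
have above v : (c < v%:E)%E -> (p <= K v)%E.
  move=> cv; rewrite leNgt; apply/negP => /ltW Av.
  have /ereal_sup_ubound : (EFin @` A) v%:E by exists v.
  by rewrite leNgt cv.
have lt_p : (P [set w | (X w < c)%E] <= p)%E.
  have [->|cNy] := eqVneq c -oo%E.
    by rewrite (_ : [set w | _] = set0) ?measure0//; apply/seteqP; split.
  have cNy' : (-oo < c)%E by rewrite ltNye.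
  have E : [set w | (X w < c)%E] = \bigcup_n [set w | (X w <= (from_below c n)%:E)%E].
    apply/seteqP; split => w /=.
      move=> /near_from_below[n _ /(_ n (leqnn n)) /ltW h].
      by exists n => //=; rewrite lee_fin.
    by move=> [n _ /= h]; apply: le_lt_trans h _; exact: from_below_lt.
  have cv := @nondecreasing_cvg_mu _ _ _ P
    (fun n => [set w | (X w <= (from_below c n)%:E)%E]).
  have inc : {homo (fun n => [set w | (X w <= (from_below c n)%:E)%E]) :
      n m / (n <= m)%N >-> (n <= m)%O}.
    move=> i j ij; apply/subsetPset => w /= h; apply: le_trans h _.
    by rewrite lee_fin; exact: from_belowS.
  have mE : measurable (\bigcup_n [set w | (X w <= (from_below c n)%:E)%E]).
    by rewrite -E.
  rewrite E -(cvg_lim _ (cv (fun n => m_le _) mE inc))//.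
  apply: lime_le; first by apply/cvg_ex; eexists; apply: (cv (fun n => m_le _) mE inc).
  by apply: nearW => n /=; apply: below; exact: from_below_lt.
have le_p : (p <= P [set w | (X w <= c)%E])%E.
  have [->|cy] := eqVneq c +oo%E.
    rewrite (_ : [set w | _] = setT); first by rewrite probability_setT.
    by apply/seteqP; split => // w _ /=; exact: leey.
  have cy' : (c < +oo)%E by rewrite ltey.
  have E : [set w | (X w <= c)%E] = \bigcap_n [set w | (X w <= (from_above c n)%:E)%E].
    apply/seteqP; split => w /=.
      by move=> h n _ /=; apply: le_trans h _; apply/ltW/from_above_gt.
    move=> h; rewrite leNgt; apply/negP => /near_from_above[n _ /(_ n (leqnn n))].
    by have := h n Logic.I; rewrite /= lee_fin leNgt => /negP.
  rewrite E; have cv := @nonincreasing_cvg_mu _ _ _ P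
    (fun n => [set w | (X w <= (from_above c n)%:E)%E]).
  have dec : {homo (fun n => [set w | (X w <= (from_above c n)%:E)%E]) :
      n m / (n <= m)%N >-> (m <= n)%O}.
    move=> i j ij; apply/subsetPset => w /= h; apply: le_trans h _.
    by rewrite lee_fin; exact: from_aboveS.
  have fin : (P [set w | (X w <= (from_above c 0%N)%:E)%E] < +oo)%E.
    by rewrite ltey_eq fin_num_measure.
  have mE : measurable (\bigcap_n [set w | (X w <= (from_above c n)%:E)%E]).
    by rewrite -E.
  rewrite -(cvg_lim _ (cv fin _ mE dec))//.
  apply: lime_ge; first by apply/cvg_ex; eexists; apply: cv.
  by apply: nearW => n /=; apply: above; exact: from_above_gt.
have mA : measurable [set w | A (U w)].
  apply: (measurable_preimageT mU); apply: is_interval_measurable.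
  move=> u v Au Av w /andP[_ wv]; exact: le_trans (Kle _ _ wv) Av.
apply/eqP; rewrite eq_le; apply/andP; split.
- apply: le_trans lt_p; rewrite atomless_lt_le; apply: le_measure; rewrite ?inE//.
  by move=> w Aw; apply: ereal_sup_ubound; exists (U w).
- apply: (le_trans le_p); rewrite -atomless_lt_le; apply: le_measure; rewrite ?inE//.
  by move=> w; exact: below.
Qed.

Variable m : {measure set (\bar R) -> \bar R}.
Hypothesis m1 : m setT = 1%E.

Let G (z : \bar R) := m [set v | (v <= z)%E].

Let m_ray z : measurable [set v : \bar R | (v <= z)%E].
Proof. by apply: measurable_down_closed => u v uv /=; exact: le_trans. Qed.

(** Right-continuity of the distribution function G of m, at -oo as well: an atom of m at -oo is
    allowed. *)
Lemma ray_mass_limit (z : \bar R) (p : \bar R) : (z < +oo)%E ->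
  (forall v : R, (z < v%:E)%E -> (p <= G v%:E)%E) -> (p <= G z)%E.
Proof.
move=> zy h.
have E : [set v | (v <= z)%E] = \bigcap_n [set v | (v <= (from_above z n)%:E)%E].
  apply/seteqP; split => w /=.
    by move=> {}h n _ /=; apply: le_trans h _; apply/ltW/from_above_gt.
  move=> {}h; rewrite leNgt; apply/negP => zw.
  have [v zv vw] : exists2 v : R, (z < v%:E)%E & (v%:E < w)%E.
    case: w zw {h} => [r| |]; last 1 first; [by rewrite ltNge leNye|by move=> /ereal_real_between_lt[v]; exists v|].
    case: z zy => // [r _ _|_ _]; last by exists 0; rewrite ?ltNyr ?ltry.
    by exists (r + 1); rewrite ?ltry// lte_fin ltrDl.
  have [n _ /(_ n (leqnn n))] := near_from_above zv.
  have := h n Logic.I; rewrite /= -lte_fin leNgt => /negP nlt lt.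
  by apply: nlt; exact: lt_trans vw.
have cv := @nonincreasing_cvg_mu _ _ _ m
    (fun n => [set v | (v <= (from_above z n)%:E)%E]).
have dec : {homo (fun n => [set v | (v <= (from_above z n)%:E)%E]) :
    n m / (n <= m)%N >-> (m <= n)%O}.
  move=> i j ij; apply/subsetPset => w /= h'; apply: le_trans h' _.
  by rewrite lee_fin; exact: from_aboveS.
have fin : (m [set v | (v <= (from_above z 0%N)%:E)%E] < +oo)%E.
  apply: (@le_lt_trans _ _ (m setT)); last by rewrite m1 ltry.
  by apply: le_measure; rewrite ?inE.
have mE : measurable (\bigcap_n [set v | (v <= (from_above z n)%:E)%E]).
  by rewrite -E.
rewrite /G E -(cvg_lim _ (cv fin _ mE dec))//.
apply: lime_ge; first by apply/cvg_ex; eexists; apply: cv.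
by apply: nearW => n /=; apply: h; exact: from_above_gt.
Qed.

(** f is the generalized inverse of G applied to K. By right-continuity of G, f x <= z holds exactly
    when K x <= G z, so the law of f(U) follows from the uniformity of K(U). *)
Lemma quantile_transform : exists2 f : R -> \bar R, measurable_fun setT f &
  forall C, measurable C -> P ((f \o U) @^-1` C) = m C.
Proof.
pose K (x : R) := P [set w' | (X w' <= x%:E)%E].
have Kle x z : (x <= z) -> (K x <= K z)%E.
  move=> xz; apply: le_measure; rewrite ?inE//; try exact: m_le.
  by move=> w /= h; apply: le_trans h _; rewrite lee_fin.
have Gle u v : (u <= v)%E -> (G u <= G v)%E.
  move=> uv; apply: le_measure; rewrite ?inE//.
  by move=> w /= h; exact: le_trans uv.
have Gy : G +oo%E = 1%E.
  by rewrite -m1; congr (m _); apply/seteqP; split => // v _; exact: leey.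
pose f (x : R) := ereal_inf [set z | (K x <= G z)%E].
have fP x z : (f x <= z)%E <-> (K x <= G z)%E.
  split => h; last exact: ereal_inf_lbound.
  apply: le_trans (Gle _ _ h).
  have [->|fy] := eqVneq (f x) +oo%E; first by rewrite Gy; apply: probability_le1.
  apply: ray_mass_limit; first by rewrite ltey.
  by move=> v /ereal_inf_lt[u /= Ku /ltW uv]; apply: (le_trans Ku); exact: Gle.
have mf : measurable_fun setT f.
  apply: measurable_fun_rays => z; apply: is_interval_measurable.
  move=> u v /fP Au /fP Av w /andP[_ wv]; apply/fP.
  exact: le_trans (Kle _ _ wv) Av.
exists f => // C mC.
have mfU : measurable_fun setT (f \o U) by exact: measurableT_comp.
transitivity (pushforward P (f \o U) C); first by [].
apply: (@measure_eq_rays R (pushforward P (f \o U)) m) => //.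
  by rewrite /= /pushforward preimage_setT -ge0_fin_numE// fin_num_measure.
move=> z; rewrite /pushforward /=.
rewrite -[RHS](@atomless_level (G z)).
  by congr (P _); apply/seteqP; split => w /=; move=> /fP.
rewrite measure_ge0 -m1; apply: le_measure; rewrite ?inE//.
Qed.

End quantile.

Section mixture.
Context d (T : measurableType d) (R : realType) (P : probability T R).
Variable U : T -> R.
Hypothesis mU : measurable_fun setT U.
Hypothesis atomless : forall u, P (U @^-1` [set u]) = 0%E.

(** The law of f(U) is the image under Z of the measure with density h, plus an atom of mass c at
    z0, expressed by test functions. It serves to copy the law of the stopped value, to size-bias
    it, and to tilt the law of U itself. *)
Lemma mixture_transform (h : T -> R) (Z : T -> \bar R) (c : R) (z0 : \bar R) :
  measurable_fun setT h -> (forall w, 0 <= h w) -> measurable_fun setT Z -> 0 <= c ->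
  (\int[P]_w (h w)%:E + c%:E = 1)%E ->
  exists2 f : R -> \bar R, measurable_fun setT f &
  forall psi : \bar R -> \bar R, measurable_fun setT psi -> (forall z, 0 <= psi z)%E ->
    (\int[P]_w psi (f (U w)) = \int[P]_w (psi (Z w) * (h w)%:E) + c%:E * psi z0)%E.
Proof.
move=> mh h0 mZ c0 tot.
pose M1 : {measure set (\bar R) -> \bar R} := pushforward (density_measure P mh h0) Z.
pose M2 : {measure set (\bar R) -> \bar R} := mscale (NngNum c0) (@dirac _ _ z0 R).
pose M : {measure set (\bar R) -> \bar R} := measure_add (M1 mZ) M2.
have intM psi : measurable_fun setT psi -> (forall z, 0 <= psi z)%E ->
    (\int[M]_z psi z = \int[P]_w (psi (Z w) * (h w)%:E) + c%:E * psi z0)%E.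
  move=> mpsi psi0; rewrite ge0_integral_measure_add//; congr (_ + _)%E.
    rewrite (ge0_integral_pushforward mZ)// preimage_setT.
    rewrite ge0_integral_density_measure//; first exact: measurableT_comp.
    by move=> w /=.
  rewrite ge0_integral_mscale//= integral_dirac// diracT mul1e.
  by [].
have M1T : M setT = 1%E.
  have := intM (cst 1%E) (measurable_cst _) (fun=> lee01).
  rewrite integral_cst// mul1e => ->; rewrite mule1 -[RHS]tot; congr (_ + _)%E.
  by apply: eq_integral => w _; rewrite /cst mul1e.
have [f mf fM] := quantile_transform mU atomless M1T.
exists f => // psi mpsi psi0.
have mfU : measurable_fun setT (f \o U) by exact: measurableT_comp.
rewrite -intM//.
transitivity (\int[pushforward P (f \o U)]_z psi z)%E.
  by rewrite (ge0_integral_pushforward mfU).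
apply: eq_measure_integral => A mA _; exact: fM.
Qed.
End mixture.

(** * Laws of randomized exits *)

Section exit_values.
Context (R : realType) (y : R).

(** Exit value as a function of the pair and the path jointly, which is the form needed when the
    pair is random. If y is not strictly between the thresholds, the exit occurs at time 0. *)
Definition exit_value (abw : (\bar R * \bar R) * path_space R) : \bar R :=
  if (abw.1.1 < y%:E)%E && (y%:E < abw.1.2)%E
  then if pselect (reaches_left abw.1.1 abw.1.2 abw.2) then abw.1.1 else abw.1.2
  else y%:E.

Let mlt (c : \bar R) : measurable [set abw : (\bar R * \bar R) * path_space R | (abw.1.1 < c)%E].
Proof.
apply: (measurable_preimageT (f := fun abw : (\bar R * \bar R) * path_space R => abw.1.1)
  (A := [set v : \bar R | (v < c)%E])).
  by apply: measurableT_comp; exact: measurable_fst.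
by apply: measurable_down_closed => u v uv /=; exact: le_lt_trans.
Qed.

Let mgt (c : \bar R) : measurable [set abw : (\bar R * \bar R) * path_space R | (c < abw.1.2)%E].
Proof.
apply: (measurable_preimageT (f := fun abw : (\bar R * \bar R) * path_space R => abw.1.2)
  (A := [set v : \bar R | (c < v)%E])).
  by apply: measurableT_comp; [exact: measurable_snd|exact: measurable_fst].
rewrite (_ : [set v | _] = ~` [set v | (v <= c)%E]).
  apply: measurableC; apply: measurable_down_closed => u v uv /=; exact: le_trans.
by apply/seteqP; split => v /=; rewrite ltNge => /negP.
Qed.

Lemma measurable_exit_value : measurable_fun setT exit_value.
Proof.
pose D := [set abw : (\bar R * \bar R) * path_space R | (abw.1.1 < y%:E)%E] `&`
          [set abw | (y%:E < abw.1.2)%E].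
(* The rational form of [reaches_left], with the thresholds as variables; the implication inside the
   intersection is written as the complement of a conjunction. *)
pose RL := \bigcup_(q : rat) ([set abw : (\bar R * \bar R) * path_space R |
   ((ratr q : R)%:E < abw.1.2)%E] `&`
   \bigcap_(p : rat) (~` ([set abw : (\bar R * \bar R) * path_space R |
      (abw.1.1 < (ratr p : R)%:E)%E] `&`
      snd @^-1` (~` (crosses_below (ratr p : R) (ratr q) : set (path_space R)))))).
have mD : measurable D by apply: measurableI; [exact: mlt|exact: mgt].
have mRL : measurable RL.
  apply: bigcupT_measurable_rat => q; apply: measurableI; first exact: mgt.
  rewrite -[X in measurable X]setCK setC_bigcap; apply: measurableC.
  apply: bigcupT_measurable_rat => p; rewrite setCK.
  apply: measurableI; first exact: mlt.
  apply: (measurable_preimageT measurable_snd); apply: measurableC.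
  exact: measurable_crosses_below.
have RLP abw : D abw -> RL abw <-> reaches_left abw.1.1 abw.1.2 abw.2.
  move=> [ay yb]; rewrite reaches_left_ratE; last 2 first.
  - exact: lt_trans ay (ltry _).
  - exact: lt_trans (ltNyr _) yb.
  split.
    move=> [q _ [qb h]]; exists q; split => // p ap.
    by apply: contrapT => nc; apply: (h p Logic.I).
  move=> [q [qb h]]; exists q => //; split => // p _ [ap nc].
  exact: nc (h p ap).
move=> _ C mC; rewrite setTI.
have -> : exit_value @^-1` C =
    (D `&` RL `&` ((fun abw => abw.1.1) @^-1` C)) `|`
    (D `&` ~` RL `&` ((fun abw => abw.1.2) @^-1` C)) `|`
    (~` D `&` (cst y%:E @^-1` C)).
  apply/seteqP; split => abw; rewrite /exit_value /=.
  - case: ifPn => [/andP[ay yb]|nD]; last first.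
      by move=> Cy; right; split => // -[ay yb]; move: nD; rewrite ay yb.
    have Dw : D abw by [].
    case: pselect => [rl|nrl] Cw; left; [left|right]; split => //; split => //.
      exact/RLP.
    by move=> /(RLP _ Dw).
  - move=> [[[[Dw Rw] Cw]|[[Dw nRw] Cw]]|[nDw Cw]].
    + by case: (Dw) => -> -> /=; case: pselect => // nrl; case: nrl; exact/RLP.
    + by case: (Dw) => -> -> /=; case: pselect => // rl; case: nRw; exact/RLP.
    + by case: ifPn => // /andP[ay yb]; case: nDw.
apply: measurableU; first apply: measurableU.
- apply: measurableI; first exact: measurableI.
  apply: measurable_preimageT => //.
  by apply: measurableT_comp; exact: measurable_fst.
- apply: measurableI; first by apply: measurableI => //; exact: measurableC.
  apply: measurable_preimageT => //.
  by apply: measurableT_comp; [exact: measurable_snd|exact: measurable_fst].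
- apply: measurableI; first exact: measurableC.
  by apply: measurable_preimageT => //; exact: measurable_cst.
Qed.

Lemma degenerate_exit_value (ab : \bar R * \bar R) (w : cpath R) : w 0 = y ->
  ~~ ((ab.1 < y%:E)%E && (y%:E < ab.2)%E) ->
  (w (min_time t (exit_path ab.1 ab.2 w)))%:E @[t --> +oo] --> exit_value (ab, w) /\
  path_at (exit_path ab.1 ab.2 w) w = exit_value (ab, w).
Proof.
move=> w0 nab; rewrite /exit_value /= (negbTE nab).
have -> : exit_path ab.1 ab.2 w = 0%E.
  apply/eqP; rewrite eq_le exit_path_ge0 andbT; apply/exit_path_le; exists 0.
    by rewrite lexx.
  by rewrite w0; move: nab; rewrite negb_and -!leNgt => /orP[]; [left|right].
split; last by rewrite /= w0.
apply: cvg_near_cst; apply: filterS (near_pinfty_ge0 R) => t t0.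
by rewrite min_time_idr// w0.
Qed.

End exit_values.

Section randomized_exit.
Context d (T : measurableType d) (R : realType) (P : probability T R).
Variables (F : R -> set (set T)) (I : set R) (y : R).
Variables (Y : T -> path_space R) (k : R.-pker R ~> path_space R) (s : R -> R).
Hypothesis filF : filtration F.
Hypothesis diffY : regular_diffusion P F I y Y k.
Hypothesis conts : {within I, continuous s}.
Hypothesis incs : {in I &, {homo s : x z / x < z}}.
Hypothesis lmX : local_martingale P F (fun t w => s (Y w t)).
Let Iy : I° y := start_interior diffY.
Let itvI : is_interval I := state_interval diffY.
Let ig := inv_gap I y s.

(** When both ends have infinite scale, the pair formed by the two ends is excluded: a recurrent
    path never leaves that interval and has no limit. *)
Definition proper_pairs : set (\bar R * \bar R) :=
  [set ab | threshold_pairs I y ab /\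
    (0 < ig (left_end I) + ig (right_end I) \/
     ~ (ab.1 = left_end I /\ ab.2 = right_end I))].

Lemma threshold_pairsP ab : threshold_pairs I y ab <->
  [/\ (left_end I <= ab.1)%E, (ab.1 <= y%:E)%E, (y%:E <= ab.2)%E & (ab.2 <= right_end I)%E].
Proof.
split.
- by move=> [/(state_closureP itvI Iy)/andP[l1 _] h1 /(state_closureP itvI Iy)/andP[_ r2] h2].
- move=> [l1 h1 h2 r2]; split => //; apply/(state_closureP itvI Iy); apply/andP; split => //.
    by apply: le_trans h1 _; apply: ltW; exact: right_end_gt.
  by apply: le_trans h2; apply: ltW; exact: left_end_lt.
Qed.

Lemma measurable_threshold_pairs : measurable (threshold_pairs I y).
Proof.
have ml (c : \bar R) : measurable [set v : \bar R | (v <= c)%E].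
  by apply: measurable_down_closed => u v uv /=; exact: le_trans.
have mg (c : \bar R) : measurable [set v : \bar R | (c <= v)%E].
  rewrite (_ : [set v | _] = ~` [set v | (v < c)%E]).
    apply: measurableC; apply: measurable_down_closed => u v uv /=; exact: le_lt_trans.
  by apply/seteqP; split => v /=; rewrite leNgt => /negP.
rewrite (_ : threshold_pairs I y =
   fst @^-1` ([set v | (left_end I <= v)%E] `&` [set v | (v <= y%:E)%E]) `&`
   snd @^-1` ([set v | (y%:E <= v)%E] `&` [set v | (v <= right_end I)%E])).
  apply: measurableI.
    by apply: (measurable_preimageT measurable_fst); exact: measurableI.
  by apply: (measurable_preimageT measurable_snd); exact: measurableI.
apply/seteqP; split => ab.
  by move=> /threshold_pairsP[].
by move=> [[/= h1 h2] [h3 h4]]; apply/threshold_pairsP.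
Qed.

Lemma measurable_proper_pairs : measurable proper_pairs.
Proof.
apply: measurableI; first exact: measurable_threshold_pairs.
have [pos|npos] := pselect (0 < ig (left_end I) + ig (right_end I)).
  rewrite (_ : (fun _ => _) = setT)//; apply/seteqP; split => // ab _.
  by left.
rewrite (_ : (fun _ => _) = ~` (fst @^-1` [set left_end I] `&` snd @^-1` [set right_end I])).
  apply: measurableC; apply: measurableI.
    by apply: (measurable_preimageT measurable_fst); exact: emeasurable_set1.
  by apply: (measurable_preimageT measurable_snd); exact: emeasurable_set1.
by apply/seteqP; split => ab /=; [move=> [|]|right].
Qed.

(** The null set does not depend on the pair, so that a random pair can be substituted. *)
Lemma ae_exit_value : {ae P, forall w, forall ab, proper_pairs ab ->
  (Y w (min_time t (exit_path ab.1 ab.2 (Y w))))%:E @[t --> +oo] --> exit_value y (ab, Y w) /\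
  path_at (exit_path ab.1 ab.2 (Y w)) (Y w) = exit_value y (ab, Y w)}.
Proof.
pose open_ends := (forall v, I v -> (left_end I < v%:E)%E) /\
  (forall v, I v -> (v%:E < right_end I)%E).
have key : {ae P, forall w, [\/ recurrent_path I (Y w), path_to_left_end I (Y w) |
    path_to_right_end I (Y w)] /\
    (open_ends -> 0 < ig (left_end I) + ig (right_end I) -> ~ recurrent_path I (Y w))}.
  have dich := ae_path_dichotomy filF diffY.
  have [[[ol or] pos]|nQ] :=
      pselect (open_ends /\ 0 < ig (left_end I) + ig (right_end I)).
    apply: filterS2 dich (ae_not_recurrent filF diffY conts incs lmX ol or pos).
    by move=> w h1 h2; split.
  by apply: filterS dich => w h; split => // h1 h2; case: nQ.
apply: filterS key => w [dich nrec] ab [/threshold_pairsP[l1 h1 h2 r2] prop].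
have w0 : Y w 0 = y by exact: starts_at diffY w.
case: (boolP ((ab.1 < y%:E)%E && (y%:E < ab.2)%E)) => [ayb|]; last first.
  exact: degenerate_exit_value.
case/andP: (ayb) => ay yb; rewrite /exit_value /= ay yb /=.
apply: (exit_path_value itvI Iy) => //.
  by move=> t t0; exact: (state_values diffY).
move=> rec.
have [l_lt|] := boolP (left_end I < ab.1)%E.
  have /ereal_inf_lt[_ [v Iv <-] /ltW va] := l_lt.
  by exists v => //; left.
rewrite -leNgt => l1'; have al : ab.1 = left_end I by apply/eqP; rewrite eq_le l1 l1'.
have [r_lt|] := boolP (ab.2 < right_end I)%E.
  have /ereal_sup_gt[_ [v Iv <-] /ltW va] := r_lt.
  by exists v => //; right.
rewrite -leNgt => r2'; have br : ab.2 = right_end I by apply/eqP; rewrite eq_le r2 r2'.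
case: prop => [pos|[]]; last by [].
(* For the pair of the two ends, recurrence is only excluded when neither end is a state. An end
   that is a state provides the required visit outside the interval. *)
apply: contrapT => nex; apply: nrec => //; split => v Iv; rewrite ltNge; apply/negP => h.
- by apply: nex; exists v => //; left; rewrite al.
- by apply: nex; exists v => //; right; rewrite br.
Qed.

Lemma exit_value_closure ab w : threshold_pairs I y ab ->
  state_closure I (exit_value y (ab, w)).
Proof.
move=> [ca _ cb _]; rewrite /exit_value /=; case: ifPn => _; first by case: pselect.
by apply/(state_closureP itvI Iy); rewrite !ltW ?left_end_lt ?right_end_gt.
Qed.

Definition exit_law (ab : \bar R * \bar R) (C : set (\bar R)) : \bar R :=
  P (Y @^-1` [set w | C (exit_value y (ab, w))]).

Lemma exit_lawE ab C : threshold_pairs I y ab -> (ab.1 < y%:E)%E -> (y%:E < ab.2)%E ->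
  0 < ig ab.1 + ig ab.2 -> exit_law ab C =
  ((ig ab.1 * \1_C ab.1 + ig ab.2 * \1_C ab.2) / (ig ab.1 + ig ab.2))%:E.
Proof.
move=> /threshold_pairsP[l1 _ _ r2] ay yb pos.
have RL := prob_reaches_left filF diffY conts incs lmX l1 ay yb r2.
have mRL : measurable (Y @^-1` reaches_left ab.1 ab.2).
  apply: (measurable_path_event filF diffY); apply: measurable_reaches_left.
    exact: lt_trans ay (ltry _).
  exact: lt_trans (ltNyr _) yb.
have E w : exit_value y (ab, w) = if pselect (reaches_left ab.1 ab.2 w) then ab.1 else ab.2.
  by rewrite /exit_value /= ay yb.
have part : ig ab.2 / (ig ab.1 + ig ab.2) = 1 - ig ab.1 / (ig ab.1 + ig ab.2).
  by field; rewrite gt_eqF.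
have PN : P (Y @^-1` (~` reaches_left ab.1 ab.2)) = (ig ab.2 / (ig ab.1 + ig ab.2))%:E.
  rewrite preimage_setC probability_setC// part EFinB; congr (_ - _)%E.
  exact: RL.
rewrite /exit_law mulrDl !(mulrAC _ (\1_C _)) !indicE.
have [Ca|nCa] := pselect (C ab.1); have [Cb|nCb] := pselect (C ab.2).
- transitivity (P setT); last first.
    by rewrite !mem_set// !mulr1 part addrC subrK probability_setT.
  by congr (P _); apply/seteqP; split => // w _ /=; rewrite E; case: pselect.
- rewrite mem_set// memNset// mulr1 mulr0 addr0 -RL.
  by congr (P _); apply/seteqP; split => w /=; rewrite E; case: pselect.
- rewrite memNset// mem_set// mulr1 mulr0 add0r -PN.
  by congr (P _); apply/seteqP; split => w /=; rewrite E; case: pselect.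
- rewrite !memNset// !mulr0 addr0 -[RHS](@measure0 _ _ _ P).
  by congr (P _); apply/seteqP; split => w //=; rewrite E; case: pselect.
Qed.

Lemma exit_law_degenerate ab C : ~~ ((ab.1 < y%:E)%E && (y%:E < ab.2)%E) ->
  exit_law ab C = (\1_C y%:E)%:E.
Proof.
move=> nab; rewrite /exit_law /exit_value /= (negbTE nab) indicE.
have [Cy|nCy] := pselect (C y%:E).
- transitivity (P setT); last by rewrite mem_set//= probability_setT.
  by congr (P _); apply/seteqP; split.
- rewrite memNset//= -[RHS](@measure0 _ _ _ P).
  by congr (P _); apply/seteqP; split.
Qed.

End randomized_exit.

Lemma ae_measure_eq d (T : measurableType d) (R : realType) (P : {measure set T -> \bar R})
    (A B : set T) : measurable A -> measurable B ->
  {ae P, forall w, A w <-> B w} -> P A = P B.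
Proof.
move=> mA mB AB; rewrite -(setIT A) -(setIT B) -!integral_indic//.
apply: ae_eq_integral => //.
- exact/measurable_EFinP/measurable_indic.
- exact/measurable_EFinP/measurable_indic.
apply: filterS AB => w ABw _; rewrite !indicE.
have [Aw|nAw] := pselect (A w); [have Bw := ABw.1 Aw|have nBw : ~ B w by move=> /ABw].
  by rewrite !mem_set.
by rewrite !memNset.
Qed.

Section randomized_law.
Context d (T : measurableType d) (R : realType) (P : probability T R).
Variables (F : R -> set (set T)) (I : set R) (y : R).
Variables (Y : T -> path_space R) (k : R.-pker R ~> path_space R) (s : R -> R).
Hypothesis filF : filtration F.
Hypothesis diffY : regular_diffusion P F I y Y k.
Hypothesis conts : {within I, continuous s}.
Hypothesis incs : {in I &, {homo s : x z / x < z}}.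
Hypothesis lmX : local_martingale P F (fun t w => s (Y w t)).
Let mY : measurable_fun setT Y := measurable_diffusion filF diffY.

Let Ym : {mfun T >-> path_space R} :=
  HB.pack Y (isMeasurableFun.Build _ _ _ _ Y mY).

Lemma exit_law_xsection C ab : exit_law P y Y ab C =
  distribution P Ym (xsection (exit_value y @^-1` C) ab).
Proof.
congr (P _); apply/seteqP; split => w /=; rewrite /xsection /=.
- by move=> h; apply/mem_set.
- by move/set_mem.
Qed.

Lemma measurable_exit_law C : measurable C ->
  measurable_fun setT (fun ab => exit_law P y Y ab C).
Proof.
move=> mC; under eq_fun do rewrite exit_law_xsection.
apply: measurable_fun_xsection.
exact: (measurable_preimageT (measurable_exit_value y)).
Qed.

(** By independence the joint law of the pair and the path is a product measure, and Fubini's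
    theorem freezes the pair. *)
Lemma independent_exit_law (AB : T -> \bar R * \bar R) C : measurable_fun setT AB ->
  independent P Y AB -> measurable C ->
  (P [set w | C (exit_value y (AB w, Y w))] = \int[P]_w exit_law P y Y (AB w) C)%E.
Proof.
move=> mAB ind mC.
pose ABm : {mfun T >-> (\bar R * \bar R)%type} :=
  HB.pack AB (isMeasurableFun.Build _ _ _ _ AB mAB).
have mp : measurable_fun setT (fun w => (AB w, Y w)) by exact: measurable_fun_pair.
pose pm : {mfun T >-> ((\bar R * \bar R) * path_space R)%type} :=
  HB.pack (fun w => (AB w, Y w)) (isMeasurableFun.Build _ _ _ _ _ mp).
have mE : measurable (exit_value y @^-1` C).
  exact: (measurable_preimageT (measurable_exit_value y)).
have := @product_measure_unique _ _ _ _ _ (distribution P ABm) (distribution P Ym)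
  (distribution P pm) _ _ mE.
rewrite /product_measure1 => h.
transitivity (distribution P pm (exit_value y @^-1` C)); first by [].
rewrite -h; last first.
  move=> A B mA mB; rewrite /distribution /pushforward muleC -ind//.
  by congr (P _); apply/seteqP; split => w [].
rewrite (ge0_integral_pushforward mAB)// ?preimage_setT.
- by apply: eq_integral => w _; rewrite /= exit_law_xsection.
- by apply: measurable_fun_xsection.
Qed.

Variable U : T -> R.
Hypothesis mU : measurable_wrt (F 0) U.
Hypothesis indU : independent P Y U.

(** A randomized rule uses the fixed vector [thresholds zeta], not g(U). With zeta the law of g(U),
    the two vectors have the same law and are both independent of Y, and the law of the exit value
    depends on nothing else. *)
Lemma randomized_threshold_law (g : R -> \bar R * \bar R) : measurable_fun setT g ->
  (forall u, proper_pairs I y s (g u)) ->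
  exists2 tau, randomized_threshold P F I y Y tau &
  forall C, measurable C ->
    (P (stopped_value Y tau @^-1` C) = \int[P]_w exit_law P y Y (g (U w)) C)%E.
Proof.
move=> mg proper.
have wrtm d' (T' : measurableType d') (f : T -> T') : measurable_wrt (F 0) f ->
    measurable_fun setT f.
  by move=> mf _ B mB; rewrite setTI; apply: (filtration_measurable filF (lexx 0)); exact: mf.
have mUT : measurable_fun setT U by exact: wrtm.
have mgU : measurable_fun setT (g \o U) by exact: measurableT_comp.
pose gU : {mfun T >-> (\bar R * \bar R)%type} :=
  HB.pack (g \o U) (isMeasurableFun.Build _ _ _ _ _ mgU).
pose zeta : probability (\bar R * \bar R)%type R := distribution P gU.
have randU : randomizes P F Y zeta (g \o U).
  split.
  - move=> B mB; have mgB := measurable_preimageT mg mB; exact: (mU mgB).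
  - move=> B C mB mC; have mgC := measurable_preimageT mg mC; exact: (indU mB mgC).
  - by [].
(* Since g(U) randomizes zeta, the choice in [thresholds] is not the default value. *)
have [wrtAB indAB lawAB] : randomizes P F Y zeta (thresholds P F y Y zeta).
  by apply: (xgetPex (cst (y%:E, y%:E)) (P := [set AB | randomizes P F Y zeta AB])); exists (g \o U).
set AB := thresholds P F y Y zeta in wrtAB indAB lawAB.
have mAB : measurable_fun setT AB by exact: wrtm.
have lawE E : measurable E -> P (AB @^-1` E) = P ((g \o U) @^-1` E).
  move=> mE; have := congr1 (fun f => f E) lawAB.
  by rewrite /law !patchE mem_set.
(* Properness holds everywhere for g(U) but passes to the chosen vector through the law only, hence
   almost surely. *)
have aeAB : {ae P, forall w, proper_pairs I y s (AB w)}.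
  have mpp := measurable_proper_pairs s diffY.
  exists (AB @^-1` (~` proper_pairs I y s)); split.
  - by apply: (measurable_preimageT mAB); exact: measurableC.
  - rewrite lawE; last exact: measurableC.
    rewrite (_ : _ @^-1` _ = set0) ?measure0//.
    by apply/seteqP; split => // w /=; apply; exact: proper.
  - by move=> w.
set tau := randomized_time P F y Y zeta.
have stop : stopping_time F tau.
  apply: (exit_time_stopping filF diffY).
  - move=> B mB; apply: (wrtAB (fst @^-1` B)).
    exact: (measurable_preimageT measurable_fst).
  - move=> B mB; apply: (wrtAB (snd @^-1` B)).
    exact: (measurable_preimageT measurable_snd).
have ev := ae_exit_value filF diffY conts incs lmX.
exists tau.
  split; last first.
    exists zeta => //; rewrite /zeta /distribution /pushforward /=.
    transitivity (P setT); last exact: probability_setT.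
    by congr (P _); apply/seteqP; split => // w _; case: (proper (U w)).
  split => //; apply: filterS2 ev aeAB => w h pw.
  have [cv _] := h _ pw; exists (exit_value y (AB w, Y w)) => //.
  by apply: (exit_value_closure diffY); case: pw.
move=> C mC.
have mX : measurable (stopped_value Y tau @^-1` C).
  exact: (measurable_preimageT (measurable_stopped_value filF diffY stop)).
have mE : measurable [set w | C (exit_value y (AB w, Y w))].
  apply: (measurable_preimageT (f := fun w => exit_value y (AB w, Y w)) _ mC).
  apply: measurableT_comp; first exact: measurable_exit_value.
  exact: measurable_fun_pair.
rewrite (ae_measure_eq mX mE); last first.
  by apply: filterS2 ev aeAB => w h pw; have [_ E] := h _ pw; rewrite /= -E.
apply: (etrans (independent_exit_law mAB indAB mC)).
have mel := measurable_exit_law mC.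
transitivity (\int[distribution P gU]_ab exit_law P y Y ab C)%E; last first.
  by rewrite (ge0_integral_pushforward mgU).
transitivity (\int[pushforward P AB]_ab exit_law P y Y ab C)%E.
  by rewrite (ge0_integral_pushforward mAB).
by apply: eq_measure_integral => E mE0 _; exact: lawE.
Qed.

End randomized_law.

(** * Moments of stopped values *)

Lemma local_martingaleN d (T : measurableType d) (R : realType) (P : probability T R)
    (F : R -> set (set T)) (M : R -> T -> R) :
  (forall t, 0 <= t -> sigma_algebra setT (F t) /\ F t `<=` measurable) ->
  local_martingale P F M -> local_martingale P F (fun t w => - M t w).
Proof.
have wrtN (G : set (set T)) (f : T -> R) :
    measurable_wrt G f -> measurable_wrt G (fun w => - f w).
  move=> mf B mB; apply: (mf ((-%R) @^-1` B)).
  by rewrite -[X in measurable X]setTI; exact: oppr_measurable.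
move=> filF [adM [tau [stop inc cvg mart]]]; split; first by move=> t t0; exact: wrtN (adM t t0).
exists tau; split => // n; have [ad int eqs] := mart n.
have E t w : - M t w - - M 0 w = - (M t w - M 0 w) by rewrite opprB opprK addrC.
split => [t t0|t t0|u t G u0 ut FG].
- by under eq_fun do rewrite E; exact: wrtN (ad t t0).
- by under eq_fun do rewrite E EFinN; exact: integrableN (int t t0).
- under eq_integral do rewrite E EFinN.
  under [RHS]eq_integral do rewrite E EFinN.
  have mG : measurable G by have [_] := filF u u0; exact.
  have t0 : 0 <= t by exact: le_trans ut.
  have intG v : 0 <= v -> P.-integrable G (fun w => (M (min_time v (tau n w)) w - M 0 w)%:E).
    by move=> v0; apply: integrableS (int v v0).
  have N v : 0 <= v -> (\int[P]_(w in G) - (M (min_time v (tau n w)) w - M 0 w)%:E =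
      - \int[P]_(w in G) (M (min_time v (tau n w)) w - M 0 w)%:E)%E.
    by move=> v0; apply: integralN; apply: integrable_add_def => //; exact: intG.
  by rewrite !N// (eqs u t G).
Qed.

(** For a stopped scale value S bounded below by r, this is used with xi = S - r, K = s y - r, and A
    and B the positive and negative parts of S - s y. Then A + K = xi + B where xi is finite, and
    the mean of xi being at most K gives the comparison. The bound B <= K makes every subtraction
    legitimate. *)
Lemma moment_comparison d (T : measurableType d) (R : realType) (P : probability T R)
    (xi : T -> \bar R) (A B : T -> R) (K : R) :
  measurable_fun setT xi -> measurable_fun setT A -> measurable_fun setT B ->
  (forall w, 0 <= xi w)%E -> (forall w, 0 <= A w) -> (forall w, 0 <= B w <= K) ->
  (\int[P]_w xi w <= K%:E)%E ->
  (forall w v, xi w = v%:E -> A w + K = v + B w) ->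
  [/\ (\int[P]_w (B w)%:E < +oo)%E, (\int[P]_w (A w)%:E <= \int[P]_w (B w)%:E)%E &
      {ae P, forall w, xi w \is a fin_num}].
Proof.
move=> mxi mA mB xi0 A0 B0 intxi eq_fin.
have PK (c : R) : (\int[P]_w (cst c%:E w) = c%:E)%E.
  rewrite integral_cst//; transitivity (c%:E * 1)%E; last by rewrite mule1.
  congr (_ * _)%E; exact: probability_setT.
have mA' : measurable_fun setT (EFin \o A) by exact/measurable_EFinP.
have mB' : measurable_fun setT (EFin \o B) by exact/measurable_EFinP.
have aefin : {ae P, forall w, xi w \is a fin_num}.
  have : P.-integrable setT xi.
    apply/integrableP; split => //; under eq_integral do rewrite gee0_abs//.
    exact: le_lt_trans intxi (ltry _).
  by move=> /(integrable_ae measurableT); apply: filterS => w; exact.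
have finB : (\int[P]_w (B w)%:E < +oo)%E.
  apply: (@le_lt_trans _ _ (\int[P]_w (cst K%:E w))%E); last by rewrite PK ltry.
  apply: ge0_le_integral => //.
  - by move=> w _; rewrite lee_fin; case/andP: (B0 w).
  - by move=> w _; rewrite lee_fin; case/andP: (B0 w).
(* K >= 0 is read off the bounds on B at some point, and a point exists because P has total mass
   1. *)
have [w0 _] : exists w : T, True.
  apply: contrapT => nT; have := probability_setT P.
  rewrite (_ : setT = set0) ?measure0; first by move=> /eqP; rewrite eq_sym onee_eq0.
  by apply/seteqP; split => // w _; apply: nT; exists w.
have K0 : 0 <= K by case/andP: (B0 w0) => h1 h2; exact: le_trans h2.
split => //.
rewrite -(leeD2rE (x := K%:E))//.
rewrite -{1}PK -ge0_integralD//; last by move=> w _; rewrite lee_fin.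
have -> : (\int[P]_w ((A w)%:E + cst K%:E w) = \int[P]_w (xi w + (B w)%:E))%E.
  apply: ae_eq_integral => //.
  - exact: emeasurable_funD.
  - exact: emeasurable_funD.
  apply: filterS aefin => w /fineK xiw _.
  by rewrite -xiw -!EFinD (eq_fin w _ (esym xiw)).
rewrite ge0_integralD//; last by move=> w _; rewrite lee_fin; case/andP: (B0 w).
by rewrite addeC; exact: leeD2l.
Qed.

Section stopped_moments.
Context d (T : measurableType d) (R : realType) (P : probability T R).
Variables (F : R -> set (set T)) (I : set R) (y : R).
Variables (Y : T -> path_space R) (k : R.-pker R ~> path_space R) (s : R -> R).
Hypothesis filF : filtration F.
Hypothesis diffY : regular_diffusion P F I y Y k.
Hypothesis conts : {within I, continuous s}.
Hypothesis incs : {in I &, {homo s : x z / x < z}}.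
Hypothesis lmX : local_martingale P F (fun t w => s (Y w t)).
Let Iy : I° y := start_interior diffY.
Let itvI : is_interval I := state_interval diffY.
Let Jy : I y := interior_subset Iy.
Let ig := inv_gap I y s.
Let S := scale_ext I y s.

(** As z is arbitrary, monotonicity of [scale_ext] does not apply directly; the bound comes from
    writing the value at the left end as the infimum of s over all states. *)
Lemma scale_ext_ge_left z : (S (left_end I) <= S z)%E.
Proof.
have Sy : S (left_end I) = ereal_inf [set (s v)%:E | v in I].
  rewrite /S /scale_ext ifT; last by apply: ltW; exact: left_end_lt.
  congr ereal_inf; apply/seteqP; split.
    by move=> _ [v [Iv _] <-]; exists v.
  by move=> _ [v Iv <-]; exists v => //; split => //; exact: left_end_le.
rewrite /S {2}/scale_ext; case: ifPn => zy.
  by rewrite -/S Sy; apply: ereal_inf_le_tmp => _ [v [Iv _] <-]; exists v.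
apply: (@le_trans _ _ (s y)%:E).
  by rewrite -/S Sy; apply: ereal_inf_lbound; exists y.
by apply: ereal_sup_ubound; exists y => //; split => //; apply: ltW; rewrite ltNge.
Qed.

Lemma scale_ext_le_right z : (S z <= S (right_end I))%E.
Proof.
have Sy : S (right_end I) = ereal_sup [set (s v)%:E | v in I].
  rewrite /S /scale_ext ifF; last by apply/negbTE; rewrite -ltNge; exact: right_end_gt.
  congr ereal_sup; apply/seteqP; split.
    by move=> _ [v [Iv _] <-]; exists v.
  by move=> _ [v Iv <-]; exists v => //; split => //; exact: right_end_ge.
rewrite /S {1}/scale_ext; case: ifPn => zy.
  apply: (@le_trans _ _ (s y)%:E).
    by apply: ereal_inf_lbound; exists y.
  by rewrite -/S Sy; apply: ereal_sup_ubound; exists y.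
by rewrite -/S Sy; apply: le_ereal_sup => _ [v [Iv _] <-]; exists v.
Qed.

Lemma scale_ext_start : S y%:E = (s y)%:E.
Proof. exact: scale_extE. Qed.

Lemma state_closure_cases z : state_closure I z ->
  (exists2 v, I v & z = v%:E) \/
  (~ (exists2 v, I v & z = v%:E) /\ (z = left_end I \/ z = right_end I)).
Proof.
move=> /(state_closureP itvI Iy)/andP[lz zr].
have [|nI] := pselect (exists2 v, I v & z = v%:E); [by left|right; split => //].
apply: contrapT => /not_orP[/eqP zl /eqP zr']; apply: nI.
have {lz zl}lz : (left_end I < z)%E by rewrite lt_neqAle eq_sym zl.
have {zr zr'}zr : (z < right_end I)%E by rewrite lt_neqAle zr'.
case: z lz zr => [v| |] lz zr.
- exists v => //; have [vy|yv] := leP v y.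
    by apply: (interval_left itvI Iy).
  by apply: (interval_right itvI Iy) => //; exact: ltW.
- by move: zr; rewrite ltNge leey.
- by move: lz; rewrite ltNge leNye.
Qed.

(** At a state this is continuity of s. At an end that is not a state it is monotonicity, the
    extended scale being there the infimum or supremum of s. *)
Lemma cvg_scale_path (u : R -> R) z : (\forall t \near +oo, I (u t)) ->
  state_closure I z -> (u t)%:E @[t --> +oo] --> z -> (s (u t))%:E @[t --> +oo] --> S z.
Proof.
move=> uI cz cu; have [[v Iv zv]|[nI]] := state_closure_cases cz.
  rewrite zv /S scale_extE//; apply: cvg_EFin; first exact: nearW.
  apply/cvgrPdist_lt => e e0; have [r r0 near] := scale_near conts Iv e0.
  have lt : \forall t \near +oo, u t < v + r.
    by apply: (cvg_ereal_near_lt cu); rewrite zv lte_fin ltrDl.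
  have gt : \forall t \near +oo, v - r < u t.
    by apply: (cvg_ereal_near_gt cu); rewrite zv lte_fin ltrBlDr ltrDl.
  apply: filterS3 uI lt gt => t It lt gt; apply: near => //.
  by rewrite ltr_norml; apply/andP; split; lra.
have sS t : I (u t) -> (s (u t))%:E = S (u t)%:E by move=> It; rewrite /S scale_extE.
case=> zE.
- have ly := left_end_lt itvI Iy.
  apply: cvg_ereal_between => M.
  + rewrite zE => MS; apply: filterS uI => t It; rewrite -lte_fin sS//.
    by apply: lt_le_trans MS _; exact: scale_ext_ge_left.
  + rewrite zE /S /scale_ext ifT; last exact: ltW.
    move=> /ereal_inf_lt[_ [v [Iv lv] <-]]; rewrite lte_fin => vM.
    have zv : (z < v%:E)%E.
      by rewrite lt_neqAle {2}zE lv andbT; apply/eqP => zv; apply: nI; exists v.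
    apply: filterS2 uI (cvg_ereal_near_lt cu zv) => t It uv.
    by apply: lt_trans vM; apply: incs; rewrite ?inE.
- have yr := right_end_gt itvI Iy.
  apply: cvg_ereal_between => M.
  + rewrite zE /S /scale_ext ifF; last by apply/negbTE; rewrite -ltNge.
    move=> /ereal_sup_gt[_ [v [Iv lv] <-]]; rewrite lte_fin => vM.
    have zv : (v%:E < z)%E.
      rewrite lt_neqAle {2}zE lv andbT; apply/eqP => zv; apply: nI.
      by exists v.
    apply: filterS2 uI (cvg_ereal_near_gt cu zv) => t It uv.
    by apply: lt_trans vM _; apply: incs; rewrite ?inE.
  + rewrite zE => MS; apply: filterS uI => t It; rewrite -lte_fin sS//.
    by apply: le_lt_trans MS; exact: scale_ext_le_right.
Qed.

(** [fine] turns an infinite gap into 0, whose inverse is 0 as well; so [inv_gap] is the inverse of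
    [gap] without exception. *)
Definition gap (z : \bar R) : R := `|fine (S z - (s y)%:E)%E|.

Lemma inv_gap_gap z : ig z = (gap z)^-1.
Proof.
rewrite /ig /inv_gap /gap /S; case: (scale_ext I y s z) => [r| |] //=.
  by rewrite normr0 invr0.
by rewrite normr0 invr0.
Qed.

Lemma gap_ge0 z : 0 <= gap z. Proof. exact: normr_ge0. Qed.

Lemma measurable_gap : measurable_fun setT gap.
Proof.
apply: measurableT_comp => //; apply: measurableT_comp; first exact: fine_measurable.
apply: emeasurable_funB; last exact: measurable_cst.
by apply: nondecreasing_emeasurable => u v; exact: scale_ext_homo.
Qed.

Lemma measurable_inv_gap : measurable_fun setT ig.
Proof.
have mV : measurable_fun setT (@GRing.inv R).
  rewrite -(setUv [set 0 : R]); apply/measurable_funU => //; first exact: measurableC.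
  split; first exact: measurable_fun_set1.
  apply: open_continuous_measurable_fun.
    by apply: closed_openC; exact: closed_eq.
  by move=> x /set_mem /= x0; apply: inv_continuous; apply/eqP.
rewrite (_ : ig = fun z => (gap z)^-1); last by apply/funext => z; exact: inv_gap_gap.
by apply: measurableT_comp => //; exact: measurable_gap.
Qed.

(** Where S is finite, [gap_below] and [gap_above] are the negative and positive parts of S - s
    y. *)
Definition gap_below (z : \bar R) : R := if (z < y%:E)%E then gap z else 0.
Definition gap_above (z : \bar R) : R := if (y%:E < z)%E then gap z else 0.

Lemma gap_below_ge0 z : 0 <= gap_below z.
Proof. by rewrite /gap_below; case: ifP => // _; exact: gap_ge0. Qed.

Lemma gap_above_ge0 z : 0 <= gap_above z.
Proof. by rewrite /gap_above; case: ifP => // _; exact: gap_ge0. Qed.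

Lemma measurable_gap_below : measurable_fun setT gap_below.
Proof.
apply: measurable_fun_ifT => //; last exact: measurable_gap.
apply: (@measurable_fun_bool _ _ _ _ true); rewrite setTI.
by apply: measurable_down_closed => u v uv /=; exact: le_lt_trans.
Qed.

Lemma measurable_gap_above : measurable_fun setT gap_above.
Proof.
apply: measurable_fun_ifT => //; last exact: measurable_gap.
apply: (@measurable_fun_bool _ _ _ _ true); rewrite setTI.
rewrite (_ : _ @^-1` _ = ~` [set v | (v <= y%:E)%E]).
  apply: measurableC; apply: measurable_down_closed => u v uv /=; exact: le_trans.
by apply/seteqP; split => v /=; rewrite ltNge => /negP.
Qed.

Lemma gap_real (r : R) z : S z = r%:E -> gap z = `|r - s y|.
Proof. by rewrite /gap => ->. Qed.

Lemma inv_gap_left_gt0 : 0 < ig (left_end I) ->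
  exists2 r : R, S (left_end I) = r%:E & r < s y.
Proof.
have := scale_ext_lt itvI Iy incs (lexx (left_end I)) (left_end_lt itvI Iy).
rewrite -/S /ig /inv_gap -/S; case: (S (left_end I)) => [r| |]; rewrite ?ltxx//.
by rewrite lte_fin; exists r.
Qed.

Lemma inv_gap_right_gt0 : 0 < ig (right_end I) ->
  exists2 r : R, S (right_end I) = r%:E & s y < r.
Proof.
have := scale_ext_gt itvI Iy incs (lexx (right_end I)) (right_end_gt itvI Iy).
rewrite -/S /ig /inv_gap -/S; case: (S (right_end I)) => [r| |]; rewrite ?ltxx//.
by rewrite lte_fin; exists r.
Qed.

Lemma inv_gap_left_eq0 : ~ 0 < ig (left_end I) -> S (left_end I) = -oo%E.
Proof.
have := scale_ext_lt itvI Iy incs (lexx (left_end I)) (left_end_lt itvI Iy).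
rewrite -/S /ig /inv_gap -/S; case: (S (left_end I)) => [r| |]//.
by rewrite lte_fin => h []; rewrite invr_gt0 normr_gt0 subr_eq0 lt_eqF.
Qed.

Lemma inv_gap_right_eq0 : ~ 0 < ig (right_end I) -> S (right_end I) = +oo%E.
Proof.
have := scale_ext_gt itvI Iy incs (lexx (right_end I)) (right_end_gt itvI Iy).
rewrite -/S /ig /inv_gap -/S; case: (S (right_end I)) => [r| |]//.
by rewrite lte_fin => h []; rewrite invr_gt0 normr_gt0 subr_eq0 gt_eqF.
Qed.

Lemma scale_ext_sign z : 
  ((z < y%:E)%E -> (S z <= (s y)%:E)%E) /\ ((y%:E < z)%E -> ((s y)%:E <= S z)%E).
Proof.
by split => h; rewrite -scale_ext_start; apply: scale_ext_homo => //; exact: ltW.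
Qed.

Variable tau : T -> \bar R.
Hypothesis admtau : admissible P F I Y tau.
Let X := stopped_value Y tau.
Let stop : stopping_time F tau := proj1 admtau.

Let mX : measurable_fun setT X.
Proof. exact: (measurable_stopped_value filF diffY). Qed.

Lemma ae_stopped_cvg : {ae P, forall w, state_closure I (X w) /\
  (Y w (min_time t (tau w)))%:E @[t --> +oo] --> X w}.
Proof.
apply: filterS (proj2 admtau) => w [z cz cvg].
have -> : X w = z by apply: stopped_value_cvg cvg; exact: (stopping_ge0 stop).
by [].
Qed.

Lemma ae_scale_stopped_cvg :
  {ae P, forall w, (s (Y w (min_time t (tau w))))%:E @[t --> +oo] --> S (X w)}.
Proof.
apply: filterS ae_stopped_cvg => w [cX cvg].
apply: (cvg_scale_path (u := fun t => Y w (min_time t (tau w)))) => //.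
apply: filterS (near_pinfty_ge0 R) => t t0; apply: (state_values diffY).
by apply: min_time_ge0 => //; exact: (stopping_ge0 stop).
Qed.

Let mS : measurable_fun setT (S \o X).
Proof.
apply: measurableT_comp => //; apply: nondecreasing_emeasurable => u v.
exact: scale_ext_homo.
Qed.

Let mbelow : measurable_fun setT (gap_below \o X).
Proof. by apply: measurableT_comp => //; exact: measurable_gap_below. Qed.

Let mabove : measurable_fun setT (gap_above \o X).
Proof. by apply: measurableT_comp => //; exact: measurable_gap_above. Qed.

Let below_mass := (\int[P]_w (gap_below (X w))%:E)%E.
Let above_mass := (\int[P]_w (gap_above (X w))%:E)%E.

(** A finite scale r at the left end bounds the scale process from below, so optional stopping gives
    a mean of S(X) of at most s y, and the part above y cannot outweigh the part below. The latter
    is bounded by s y - r. *)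
Lemma left_moment : 0 < ig (left_end I) ->
  [/\ (below_mass < +oo)%E, (above_mass <= below_mass)%E &
      {ae P, forall w, S (X w) \is a fin_num}].
Proof.
move=> /inv_gap_left_gt0[r Sr ry].
have lowS z : (r%:E <= S z)%E by rewrite -Sr; exact: scale_ext_ge_left.
have bound : (\int[P]_w ((S \o X) w + (- r)%:E) <= (s y + - r)%:E)%E.
  apply: (stopped_limit_expectation_le filF lmX (scale_path_continuous diffY conts) _ stop) => //.
  - by move=> w; rewrite (starts_at diffY w).
  - move=> w u u0; rewrite opprK -lee_fin.
    have -> : (s (Y w u))%:E = S (Y w u)%:E.
      by rewrite /S scale_extE//; exact: (state_values diffY).
    exact: lowS.
  - exact: ae_scale_stopped_cvg.
have [] := @moment_comparison _ T R P (fun w => (S \o X) w + (- r)%:E)%E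
  (gap_above \o X) (gap_below \o X) (s y - r) _ mabove mbelow _ _ _ bound.
- exact: emeasurable_funD.
- by move=> w /=; rewrite EFinN sube_ge0.
- by move=> w; exact: gap_above_ge0.
- move=> w /=; rewrite gap_below_ge0 /gap_below; case: ifP => [zy|_]; last by rewrite subr_ge0 ltW.
  have := (scale_ext_sign (X w)).1 zy; have := lowS (X w).
  rewrite /gap; case: (S (X w)) => [v| |]//=.
  by rewrite !lee_fin => rv vy; rewrite ler0_norm ?subr_le0//; lra.
- move=> w v /= E; have [u Su] : exists u, S (X w) = u%:E.
    by move: E; case: (S (X w)) => [u| |]//; exists u.
  move: E; rewrite Su /gap_above /gap_below !(gap_real Su) => -[<-].
  have [lo up] := scale_ext_sign (X w); rewrite Su !lee_fin in lo up.
  case: (ltgtP (X w) y%:E) => [/lo h|/up h|zy].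
  + by rewrite ler0_norm ?subr_le0//; lra.
  + by rewrite ger0_norm ?subr_ge0//; lra.
  + by move: Su; rewrite zy scale_ext_start => -[->]; lra.
move=> h1 h2 h3; split => //; apply: filterS h3 => w.
by rewrite fin_numD => /andP[].
Qed.

(** The mirror image of [left_moment], for the local martingale -s(Y), which is bounded below when
    the right end has finite scale. *)
Lemma right_moment : 0 < ig (right_end I) ->
  [/\ (above_mass < +oo)%E, (below_mass <= above_mass)%E &
      {ae P, forall w, S (X w) \is a fin_num}].
Proof.
move=> /inv_gap_right_gt0[r Sr yr].
have upS z : (S z <= r%:E)%E by rewrite -Sr; exact: scale_ext_le_right.
have lmN : local_martingale P F (fun t w => - s (Y w t)).
  by apply: local_martingaleN => //; case: filF.
have mNS : measurable_fun setT (fun w => (- (S \o X) w)%E) by exact: measurableT_comp.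
have bound : (\int[P]_w (- (S \o X) w + r%:E) <= (- s y + r)%:E)%E.
  apply: (stopped_limit_expectation_le filF lmN _ _ stop) => //.
  - move=> w v; apply: cvgN; exact: (scale_path_continuous diffY conts).
  - by move=> w; rewrite (starts_at diffY w).
  - move=> w u u0; rewrite lerN2 -lee_fin.
    have -> : (s (Y w u))%:E = S (Y w u)%:E.
      by rewrite /S scale_extE//; exact: (state_values diffY).
    exact: upS.
  - apply: filterS ae_scale_stopped_cvg => w h.
    by under eq_fun do rewrite EFinN; exact: cvgeN.
have [] := @moment_comparison _ T R P (fun w => - (S \o X) w + r%:E)%E
  (gap_below \o X) (gap_above \o X) (- s y + r) _ mbelow mabove _ _ _ bound.
- exact: emeasurable_funD.
- move=> w /=; have := upS (X w); case: (S (X w)) => [v| |]//=.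
    by rewrite !lee_fin; lra.
  by rewrite addye// leey.
- by move=> w; exact: gap_below_ge0.
- move=> w /=; rewrite gap_above_ge0 /gap_above; case: ifP => [zy|_]; last by rewrite addrC subr_ge0 ltW.
  have := (scale_ext_sign (X w)).2 zy; have := upS (X w).
  rewrite /gap; case: (S (X w)) => [v| |]//=.
  by rewrite !lee_fin => rv vy; rewrite ger0_norm ?subr_ge0//; lra.
- move=> w v /= E; have [u Su] : exists u, S (X w) = u%:E.
    by move: E; case: (S (X w)) => [u| |]//; exists u.
  move: E; rewrite Su /gap_above /gap_below !(gap_real Su) => -[<-].
  have [lo up] := scale_ext_sign (X w); rewrite Su !lee_fin in lo up.
  case: (ltgtP (X w) y%:E) => [/lo h|/up h|zy].
  + by rewrite ler0_norm ?subr_le0//; lra.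
  + by rewrite ger0_norm ?subr_ge0//; lra.
  + by move: Su; rewrite zy scale_ext_start => -[->]; lra.
move=> h1 h2 h3; split => //; apply: filterS h3 => w.
by rewrite fin_numD fin_numN => /andP[].
Qed.

End stopped_moments.

Section paths_to_ends.
Context (R : realType) (I : set R) (y : R) (w : cpath R).
Hypothesis itvI : is_interval I.
Hypothesis Iy : I° y.
Hypothesis w0 : w 0 = y.
Hypothesis wI : forall t, 0 <= t -> I (w t).

Lemma left_limit_reaches_left : (forall v, I v -> (v%:E < right_end I)%E) ->
  (w t)%:E @[t --> +oo] --> left_end I -> reaches_left (left_end I) (right_end I) w.
Proof.
move=> ur cvg.
have [M [_ below]] := cvg_ereal_near_lt cvg (left_end_lt itvI Iy).
pose N := Num.max M 0 + 1.
have N0 : 0 <= N by rewrite addr_ge0// le_max lexx orbT.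
have MN : M < N by rewrite ltr_pwDr// le_max lexx.
have [c /andP[c0 cN] cmax] := path_max w N0.
have [b' cb' b'r] := ereal_real_between (ur _ (wI c0)).
have yb' : y < b' by rewrite -w0; apply: le_lt_trans cb'; apply: cmax; rewrite lexx.
exists b'; split => // a' la'.
have [u [ua' u0]] := filter_ex (filterI (cvg_ereal_near_lt cvg la') (near_pinfty_ge0 R)).
exists u => //; split => // v /andP[v0 vu].
have [vN|Nv] := leP v N; first by apply: le_lt_trans cb'; apply: cmax; rewrite v0.
by apply: lt_trans yb'; apply: below; exact: lt_trans Nv.
Qed.

Lemma right_limit_not_reaches_left : (forall v, I v -> (left_end I < v%:E)%E) ->
  (w t)%:E @[t --> +oo] --> right_end I ->
  \forall n \near \oo, ~ reaches_left (from_above (left_end I) n)%:E (right_end I) w.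
Proof.
move=> lu cvg.
have [M [_ above]] := cvg_ereal_near_gt cvg (right_end_gt itvI Iy).
pose N := Num.max M 0 + 1.
have N0 : 0 <= N by rewrite addr_ge0// le_max lexx orbT.
have MN : M < N by rewrite ltr_pwDr// le_max lexx.
have [c /andP[c0 cN] cmin] := path_min w N0.
have cy : w c <= y by rewrite -w0; apply: cmin; rewrite lexx.
apply: filterS (near_from_above (lu _ (wI c0))) => n an [b' [_ h]].
have [u u0 [uc _]] := h (w c) an.
have [uN|Nu] := leP u N; first by move: uc; rewrite ltNge cmin// u0.
move: uc; rewrite ltNge; apply/negP; rewrite negbK.
by apply: (le_trans cy); apply/ltW/above; exact: lt_trans Nu.
Qed.
End paths_to_ends.

(** * Stopped values avoid ends of infinite scale *)

Section stopped_ends.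
Context d (T : measurableType d) (R : realType) (P : probability T R).
Variables (F : R -> set (set T)) (I : set R) (y : R).
Variables (Y : T -> path_space R) (k : R.-pker R ~> path_space R) (s : R -> R).
Hypothesis filF : filtration F.
Hypothesis diffY : regular_diffusion P F I y Y k.
Hypothesis conts : {within I, continuous s}.
Hypothesis incs : {in I &, {homo s : x z / x < z}}.
Hypothesis lmX : local_martingale P F (fun t w => s (Y w t)).
Let Iy : I° y := start_interior diffY.
Let itvI : is_interval I := state_interval diffY.
Let Jy : I y := interior_subset Iy.
Let ig := inv_gap I y s.

Lemma ae_not_reaches_left : ~ 0 < ig (left_end I) -> ~ 0 < ig (right_end I) ->
  {ae P, forall w, ~ reaches_left (left_end I) (right_end I) (Y w)}.
Proof.
move=> nl nr; have ly := left_end_lt itvI Iy; have yr := right_end_gt itvI Iy.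
have z0 : ig (left_end I) = 0.
  by apply/eqP; rewrite eq_le leNgt; move/negP: nl => ->; exact: inv_gap_ge0.
exists (Y @^-1` reaches_left (left_end I) (right_end I)); split.
- apply: (measurable_path_event filF diffY); apply: measurable_reaches_left.
    exact: lt_trans ly (ltry _).
  exact: lt_trans (ltNyr _) yr.
- rewrite (prob_reaches_left filF diffY conts incs lmX)//.
  by rewrite -/ig z0 mul0r.
- by move=> w /= h; apply: contrapT => nh; apply: h.
Qed.

Lemma ae_reaches_left_interior n : ~ 0 < ig (right_end I) ->
  {ae P, forall w, (from_above (left_end I) n < y /\ I° (from_above (left_end I) n)) ->
    reaches_left (from_above (left_end I) n)%:E (right_end I) (Y w)}.
Proof.
move=> nr; set a := from_above _ n; have yr := right_end_gt itvI Iy.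
have [[ay Ia]|] := pselect (a < y /\ I° a); last by move=> h; apply: aeW.
have z0 : ig (right_end I) = 0.
  by apply/eqP; rewrite eq_le leNgt; move/negP: nr => ->; exact: inv_gap_ge0.
have Ja : I a by exact: interior_subset.
have ga : 0 < ig a%:E by apply: inv_gap_gt0 => //; rewrite lt_eqF.
have m : measurable (Y @^-1` reaches_left a%:E (right_end I)).
  apply: (measurable_path_event filF diffY); apply: measurable_reaches_left.
    exact: ltry.
  exact: lt_trans (ltNyr _) yr.
exists (Y @^-1` (~` reaches_left a%:E (right_end I))); split.
- by rewrite preimage_setC; exact: measurableC.
- rewrite preimage_setC probability_setC//.
  have := prob_reaches_left filF diffY conts incs lmX (left_end_le Ja) _ yr (lexx _).
  rewrite lte_fin -/ig z0 addr0 divff ?gt_eqF// => -> //.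
  by rewrite subee.
- by move=> w /= h rl; apply: h.
Qed.

Variable tau : T -> \bar R.
Hypothesis admtau : admissible P F I Y tau.
Let X := stopped_value Y tau.

(** Only an end that is not a state can have inverse gap 0. If one end has finite scale, the moment
    bound makes S(X) finite almost surely. If both have infinite scale, a path tending to the left
    end would belong to [reaches_left] of the two ends, a null event, and a path tending to the
    right end would miss some interior level on the left, although each is almost surely reached. *)
Lemma ae_stopped_value_proper : {ae P, forall w, state_closure I (X w) /\
  (X w <> y%:E -> 0 < ig (X w))}.
Proof.
have stop : stopping_time F tau := proj1 admtau.
have aecv := ae_stopped_cvg admtau.
have base w : state_closure I (X w) ->
    (X w = left_end I -> ~ (exists2 v, I v & X w = v%:E) -> 0 < ig (left_end I)) ->
    (X w = right_end I -> ~ (exists2 v, I v & X w = v%:E) -> 0 < ig (right_end I)) ->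
    state_closure I (X w) /\ (X w <> y%:E -> 0 < ig (X w)).
  move=> cX hl hr; split => // Xy; have [[v Iv E]|[nI]] := state_closure_cases diffY cX.
    rewrite E; apply: inv_gap_gt0 => //; apply/eqP => vy.
    by apply: Xy; rewrite E vy.
  by case=> E; rewrite {1}E; [exact: hl|exact: hr].
have [posl|nl] := pselect (0 < ig (left_end I)).
  have [_ _ aefin] := left_moment filF diffY conts incs lmX admtau posl.
  apply: filterS2 aecv aefin => w [cX _] fin; apply: base => // E nI.
  apply: contrapT => nr; move: fin; rewrite -/X E.
  by rewrite (inv_gap_right_eq0 diffY incs nr).
have [posr|nr] := pselect (0 < ig (right_end I)).
  have [_ _ aefin] := right_moment filF diffY conts incs lmX admtau posr.
  apply: filterS2 aecv aefin => w [cX _] fin; apply: base => // E nI.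
  by move: fin; rewrite -/X E (inv_gap_left_eq0 diffY incs nl).
(* A state other than y has positive inverse gap, so an end of infinite scale is not a state. *)
have open_l v : I v -> (left_end I < v%:E)%E.
  move=> Iv; rewrite lt_neqAle left_end_le// andbT; apply/eqP => lv.
  apply: nl; rewrite lv; apply: inv_gap_gt0 => //; apply/eqP => vy.
  by have := left_end_lt itvI Iy; rewrite lv vy ltxx.
have open_r v : I v -> (v%:E < right_end I)%E.
  move=> Iv; rewrite lt_neqAle right_end_ge// andbT; apply/eqP => vr.
  apply: nr; rewrite -vr; apply: inv_gap_gt0 => //; apply/eqP => vy.
  by have := right_end_gt itvI Iy; rewrite -vr vy ltxx.
have aer : {ae P, forall w, forall n, 
    (from_above (left_end I) n < y /\ I° (from_above (left_end I) n)) ->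
    reaches_left (from_above (left_end I) n)%:E (right_end I) (Y w)}.
  by apply: ae_forall_nat => n; exact: ae_reaches_left_interior.
apply: filterS3 aecv (ae_not_reaches_left nl nr) aer => w [cX cvg] nrl rl.
have w0 : Y w 0 = y by exact: (starts_at diffY w).
have wI t : 0 <= t -> I (Y w t) by exact: (state_values diffY).
(* A stopped value outside I can only be a limit at infinity, with tau infinite. *)
have unstopped : ~ (exists2 v, I v & X w = v%:E) -> tau w = +oo%E.
  move=> nI; apply/eqP; apply: contrapT => /negP; rewrite -ltey => fin.
  have [E t0] := stopping_fin stop fin.
  apply: nI; exists (Y w (fine (tau w))); first exact: wI.
  by rewrite /X stopped_value_path_at E.
have path_cvg : ~ (exists2 v, I v & X w = v%:E) -> (Y w t)%:E @[t --> +oo] --> X w.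
  move=> /unstopped tw; apply: cvg_trans cvg; apply: near_eq_cvg; apply: nearW => t.
  by rewrite tw min_time_pinfty.
apply: base => // E nI; have := path_cvg nI; rewrite E => cv; exfalso.
- by apply: nrl; exact: (left_limit_reaches_left itvI Iy w0 wI open_r cv).
- have [n [[an Ian] nrn]] := filter_ex (filterI
    (near_from_above_interior itvI Iy (lexx _) (left_end_lt itvI Iy))
    (right_limit_not_reaches_left itvI Iy w0 wI open_l cv)).
  by apply: nrn; exact: rl.
Qed.
End stopped_ends.

(** * Embedding by randomized thresholds *)

Section size_biasing.
Context d (T : measurableType d) (R : realType) (P : probability T R).
Variable U : T -> R.
Hypothesis mU : measurable_fun setT U.
Hypothesis atomless : forall u, P (U @^-1` [set u]) = 0%E.

Lemma integral_indic_preimage d' (T' : measurableType d') (X : T -> T') (D : set T') :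
  measurable_fun setT X -> measurable D ->
  (\int[P]_w (\1_D (X w))%:E = P (X @^-1` D))%E.
Proof.
move=> mX mD; have mXD := measurable_preimageT mX mD.
by rewrite -[in RHS](setIT (X @^-1` D)) -integral_indic.
Qed.

Lemma integral0_ae0 (X : T -> R) : measurable_fun setT X -> (forall w, 0 <= X w) ->
  (\int[P]_w (X w)%:E = 0)%E -> {ae P, forall w, X w = 0}.
Proof.
move=> mX X0 int0.
have mX' : measurable_fun setT (EFin \o X) by exact/measurable_EFinP.
have [h _] := ae_eq_integral_abs P measurableT mX'.
have : (\int[P]_w `|(EFin \o X) w| = 0)%E.
  by rewrite -[RHS]int0; apply: eq_integral => w _; rewrite gee0_abs// lee_fin.
by move=> /h; apply: filterS => w /(_ Logic.I) /= [].
Qed.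

(** The law of f(U) has density phi(X)/C0 under P, completed by an atom of mass (C0 - m)/C0 at e.
    Multiplication by C0 ig undoes the bias, since ig phi is the indicator of K. The atom then
    contributes ig e (C0 - m) = 0: either it is empty or e has infinite scale. *)
Lemma size_biased_transform (X : T -> \bar R) (ig phi : \bar R -> R) (C0 m : R)
    (e : \bar R) (K : set (\bar R)) :
  measurable_fun setT X -> measurable_fun setT ig -> measurable_fun setT phi ->
  measurable K -> (forall z, 0 <= ig z) -> (forall z, 0 <= phi z) ->
  0 < C0 -> m <= C0 -> ig e * (C0 - m) = 0 ->
  (\int[P]_w (phi (X w))%:E = m%:E)%E -> K e ->
  {ae P, forall w, phi (X w) != 0 -> K (X w)} ->
  {ae P, forall w, ig (X w) * phi (X w) = \1_K (X w)} ->
  exists f : R -> \bar R, [/\ measurable_fun setT f,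
    {ae P, forall w, K (f (U w))} &
    forall D, measurable D ->
      (\int[P]_w (C0 * ig (f (U w)) * \1_D (f (U w)))%:E = P (X @^-1` (D `&` K)))%E].
Proof.
move=> mX mig mphi mK ig0 phi0 C00 mC0 ige intphi Ke aeK aeig.
have C0n : C0 != 0 by rewrite gt_eqF.
have mphiX : measurable_fun setT (phi \o X) by exact: measurableT_comp.
pose h w := C0^-1 * phi (X w).
have mh : measurable_fun setT h by apply: measurable_funM => //; exact: measurable_cst.
have h0 w : 0 <= h w by rewrite mulr_ge0// invr_ge0 ltW.
have c0 : 0 <= (C0 - m) / C0 by rewrite divr_ge0 ?subr_ge0// ltW.
have tot : (\int[P]_w (h w)%:E + ((C0 - m) / C0)%:E = 1)%E.
  under eq_integral do rewrite EFinM.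
  rewrite ge0_integralZl//; last 3 first.
  - exact/measurable_EFinP.
  - by move=> w _; rewrite lee_fin.
  - by rewrite lee_fin invr_ge0 ltW.
  by rewrite intphi -EFinM -EFinD; congr (_%:E); field.
have [f mf fP] := mixture_transform mU atomless e mh h0 mX c0 tot.
exists f; split => //.
- pose psi (z : \bar R) : \bar R := (\1_(~` K) z)%:E.
  have mpsi : measurable_fun setT psi.
    by apply/measurable_EFinP/measurable_indic; exact: measurableC.
  have mfU : measurable_fun setT (f \o U) by exact: measurableT_comp.
  have psi0 z : (0 <= psi z)%E by rewrite lee_fin.
  have intK : (\int[P]_w psi (f (U w)) = 0)%E.
    rewrite fP//.
    rewrite {2}/psi indicE memNset ?mule0 ?adde0; last by apply.
    apply: (etrans (y := (\int[P]_w (cst 0%E w))%E)); last exact: integral0.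
    apply: ae_eq_integral => //.
    + apply: emeasurable_funM; last exact/measurable_EFinP.
      by apply: measurableT_comp.
    + apply: filterS aeK => w hK _; rewrite /psi /h indicE.
      have [->|/hK Kw] := eqVneq (phi (X w)) 0; first by rewrite mulr0 mule0.
      by rewrite memNset ?mul0e//; apply.
  have mKU : measurable_fun setT (fun w => \1_(~` K) (f (U w)) : R).
    apply: (measurableT_comp (f := \1_(~` K) : \bar R -> R)) => //.
    by apply: measurable_indic; exact: measurableC.
  have ae0 := integral0_ae0 mKU (fun=> ler0n _ _) intK.
  apply: filterS ae0 => w /eqP; rewrite indicE pnatr_eq0 eqb0 notin_setE => nK.
  exact: contrapT.
- move=> D mD; pose psi (z : \bar R) : \bar R := (C0 * ig z * \1_D z)%:E.
  have mpsi : measurable_fun setT psi.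
    apply/measurable_EFinP; apply: measurable_funM; last exact: measurable_indic.
    by apply: measurable_funM => //; exact: measurable_cst.
  have psi0 z : (0 <= psi z)%E.
    by rewrite lee_fin !mulr_ge0// ltW.
  have := fP psi mpsi psi0; rewrite /psi => ->.
  have -> : (((C0 - m) / C0)%:E * (C0 * ig e * \1_D e)%:E = 0)%E.
    rewrite -EFinM; congr (_%:E).
    have -> : (C0 - m) / C0 * (C0 * ig e * \1_D e) = ig e * (C0 - m) * \1_D e by field.
    by rewrite ige mul0r.
  rewrite adde0 -integral_indic_preimage//; last exact: measurableI.
  apply: ae_eq_integral => //.
  + apply: emeasurable_funM; last exact/measurable_EFinP.
    by apply: (measurableT_comp (f := psi)).
  + apply/measurable_EFinP.
    apply: (measurableT_comp (f := \1_(D `&` K) : \bar R -> R)) => //.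
    by apply: measurable_indic; exact: measurableI.
  + apply: filterS aeig => w hw _; rewrite -EFinM; congr (_%:E).
    have -> : C0 * ig (X w) * \1_D (X w) * h w = \1_D (X w) * (ig (X w) * phi (X w)).
      by rewrite /h; field.
    by rewrite hw indicI.
Qed.
End size_biasing.

Section embedding.
Context d (T : measurableType d) (R : realType) (P : probability T R).
Variables (F : R -> set (set T)) (I : set R) (y : R).
Variables (Y : T -> path_space R) (k : R.-pker R ~> path_space R) (s : R -> R).
Hypothesis filF : filtration F.
Hypothesis diffY : regular_diffusion P F I y Y k.
Hypothesis conts : {within I, continuous s}.
Hypothesis incs : {in I &, {homo s : x z / x < z}}.
Hypothesis lmX : local_martingale P F (fun t w => s (Y w t)).
Let Iy : I° y := start_interior diffY.
Let itvI : is_interval I := state_interval diffY.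
Let Jy : I y := interior_subset Iy.
Let ig := inv_gap I y s.
Variable U : T -> R.
Hypothesis mU : measurable_fun setT U.
Hypothesis atomless : forall u, P (U @^-1` [set u]) = 0%E.
Variable tau : T -> \bar R.
Hypothesis admtau : admissible P F I Y tau.
Let X := stopped_value Y tau.
Let ly : (left_end I < y%:E)%E := left_end_lt itvI Iy.
Let yr : (y%:E < right_end I)%E := right_end_gt itvI Iy.

Let mX : measurable_fun setT X.
Proof. exact: (measurable_stopped_value filF diffY (proj1 admtau)). Qed.

Let exl (ab : \bar R * \bar R) C := exit_law P y Y ab C.

Let exl_ge0 ab C : (0 <= exl ab C)%E. Proof. exact: measure_ge0. Qed.

Lemma measurable_itv_oo (a b : \bar R) : measurable [set z : \bar R | (a < z < b)%E].
Proof.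
rewrite (_ : [set z | _] = [set z | (a < z)%E] `&` [set z | (z < b)%E]).
  apply: measurableI; last first.
    by apply: measurable_down_closed => u v uv /=; exact: le_lt_trans.
  rewrite (_ : [set z | _] = ~` [set z | (z <= a)%E]).
    apply: measurableC; apply: measurable_down_closed => u v uv /=; exact: le_trans.
  by apply/seteqP; split => v /=; rewrite ltNge => /negP.
by apply/seteqP; split => z /= => [/andP|[-> ->]].
Qed.

Lemma proper_start : proper_pairs I y s (y%:E, y%:E).
Proof.
split; last by right => -[/= E _]; move: ly; rewrite -E ltxx.
by apply/(threshold_pairsP diffY); rewrite lexx !ltW.
Qed.

Lemma inv_gap_pair_gt0 (a b : \bar R) : 0 < ig (left_end I) + ig (right_end I) ->
  (left_end I <= a)%E -> (a < y%:E)%E -> (y%:E < b)%E -> (b <= right_end I)%E ->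
  0 < ig a + ig b.
Proof.
move=> pos la ay yb br.
have ig0 z : 0 <= ig z by exact: inv_gap_ge0.
have [{}la|] := ltP (left_end I) a.
  case: a la ay => [v| |] la ay //; last by move: la; rewrite ltNge leNye.
  rewrite ltr_pwDl//; apply: inv_gap_gt0 => //.
    by apply: (interval_left itvI Iy) => //; rewrite ltW -?lte_fin.
  by rewrite lt_eqF// -lte_fin.
move=> al; have -> : a = left_end I by apply/eqP; rewrite eq_le la al.
have [{}br|] := ltP b (right_end I).
  case: b br yb => [v| |] br yb //; first last.
    by move: br; rewrite ltNge leey.
  rewrite ltr_wpDl//; apply: inv_gap_gt0 => //.
    by apply: (interval_right itvI Iy) => //; rewrite ltW -?lte_fin.
  by rewrite gt_eqF// -lte_fin.
by move=> rb; have -> : b = right_end I by apply/eqP; rewrite eq_le br rb.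
Qed.

(* If both ends are at infinite scale distance, the diffusion is recurrent: it
   reaches a given level without meeting the end on the other side. *)
Lemma recurrent_pairs : ~ 0 < ig (left_end I) + ig (right_end I) ->
  exists g : R -> \bar R * \bar R, [/\ measurable_fun setT g,
    forall u, proper_pairs I y s (g u) &
    forall C, measurable C -> (\int[P]_w exl (g (U w)) C = P (X @^-1` C))%E].
Proof.
move=> npos; have ig0 z : 0 <= ig z by exact: inv_gap_ge0.
have [zl zr] : ig (left_end I) = 0 /\ ig (right_end I) = 0.
  by move/negP: npos; rewrite -leNgt; have := ig0 (left_end I); have := ig0 (right_end I); split; lra.
have tot : (\int[P]_w (1 : R)%:E + (0 : R)%:E = 1)%E.
  rewrite adde0 (integral_cst _ measurableT (1 : \bar R)) mul1e; exact: probability_setT.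
have [f mf fP] := mixture_transform mU atomless y%:E
  (measurable_cst (1 : R)) (fun=> ler01) mX (lexx 0) tot.
(* The strict inequalities keep both ends from being paired together, so every pair is proper.
   Values of X at an end are null by [ae_stopped_value_proper], so their fallback to (y, y) is
   harmless. *)
pose g0 (z : \bar R) : \bar R * \bar R :=
  if (left_end I < z < y%:E)%E then (z, right_end I)
  else if (y%:E < z < right_end I)%E then (left_end I, z) else (y%:E, y%:E).
have mg0 : measurable_fun setT g0.
  apply: measurable_fun_ifT; last apply: measurable_fun_ifT.
  - by apply: (@measurable_fun_bool _ _ _ _ true); rewrite setTI; exact: measurable_itv_oo.
  - by apply: measurable_fun_pair => //; exact: measurable_cst.
  - by apply: (@measurable_fun_bool _ _ _ _ true); rewrite setTI; exact: measurable_itv_oo.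
  - by apply: measurable_fun_pair => //; exact: measurable_cst.
  - exact: measurable_cst.
have proper z : proper_pairs I y s (g0 z).
  rewrite /g0; case: ifP => [/andP[lz zy]|_]; last case: ifP => [/andP[yz zr']|_].
  - split; last by right => -[/= E _]; move: lz; rewrite E ltxx.
    by apply/(threshold_pairsP diffY); rewrite /= lexx !ltW.
  - split; last by right => -[/= _ E]; move: zr'; rewrite E ltxx.
    by apply/(threshold_pairsP diffY); rewrite /= lexx !ltW.
  - exact: proper_start.
exists (g0 \o f); split; [exact: measurableT_comp|by move=> u; exact: proper|].
move=> C mC.
have mexl : measurable_fun setT (fun z => exl (g0 z) C).
  by apply: (measurableT_comp (measurable_exit_law filF diffY mC)).
rewrite (fP (fun z => exl (g0 z) C))//.
rewrite mul0e adde0 -integral_indic_preimage//.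
under eq_integral => w _ do rewrite /cst mule1.
apply: ae_eq_integral => //.
- exact: (measurableT_comp mexl mX).
- apply/measurable_EFinP; apply: (measurableT_comp (f := \1_C : \bar R -> R)) => //.
- apply: filterS (ae_stopped_value_proper filF diffY conts incs lmX admtau).
  move=> w [/(state_closureP itvI Iy)/andP[lX Xr] pX] _.
  set z := stopped_value Y tau w in lX Xr pX *; rewrite -/z.
  have [pz _] := proper z; rewrite /g0 in pz *.
  case: (ltgtP z y%:E) => [zy|yz|zy].
  + have zy' : z <> y%:E by move=> E; move: zy; rewrite E ltxx.
    have lz : (left_end I < z)%E.
      rewrite lt_neqAle lX andbT; apply/eqP => E.
      by have := pX zy'; rewrite -E -/ig zl ltxx.
    rewrite lz zy /= in pz *.
    rewrite /exl (exit_lawE filF diffY conts incs lmX C pz)//= -/ig zr.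
      by congr (_%:E); field; rewrite gt_eqF// pX.
    by rewrite addr0 pX.
  + have zy' : z <> y%:E by move=> E; move: yz; rewrite E ltxx.
    have rz : (z < right_end I)%E.
      rewrite lt_neqAle Xr andbT; apply/eqP => E.
      by have := pX zy'; rewrite E -/ig zr ltxx.
    rewrite rz andbF /=; rewrite yz rz (lt_gtF yz) andbF /= in pz.
    rewrite /exl (exit_lawE filF diffY conts incs lmX C pz)//= -/ig zl.
      by congr (_%:E); field; rewrite gt_eqF// pX.
    by rewrite add0r pX.
  + rewrite andbF /= /exl exit_law_degenerate/= ?ltxx//.
    by have -> : X w = y%:E by exact: zy.
Qed.

Let gb := gap_below I y s.
Let ga := gap_above I y s.

Let mig : measurable_fun setT ig. Proof. exact: (measurable_inv_gap s diffY). Qed.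
Let mgb : measurable_fun setT gb. Proof. exact: (measurable_gap_below s diffY). Qed.
Let mga : measurable_fun setT ga. Proof. exact: (measurable_gap_above s diffY). Qed.

Lemma inv_gapK z : (left_end I <= z <= right_end I)%E -> (z <> y%:E -> 0 < ig z) ->
  ig z * gb z = \1_[set z : \bar R | (left_end I <= z < y%:E)%E] z /\
  ig z * ga z = \1_[set z : \bar R | (y%:E < z <= right_end I)%E] z.
Proof.
move=> /andP[lz zr] pz; rewrite !indicE.
have K : z <> y%:E -> ig z * gap I y s z = 1.
  move=> /pz; rewrite /ig inv_gap_gap invr_gt0 => h; by rewrite mulVf// gt_eqF.
rewrite /gb /ga /gap_below /gap_above; case: (ltgtP z y%:E) => [zy|yz|->]; split.
- rewrite K; last by move=> E; move: zy; rewrite E ltxx.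
  by rewrite mem_set//= lz zy.
- by rewrite mulr0 memNset//= (lt_gtF zy).
- by rewrite mulr0 memNset//= (lt_gtF yz) andbF.
- rewrite K; last by move=> E; move: yz; rewrite E ltxx.
  by rewrite mem_set//= yz zr.
- by rewrite mulr0 memNset//= ltxx andbF.
- by rewrite mulr0 memNset//= ltxx.
Qed.

Let below_set := [set z : \bar R | (left_end I <= z < y%:E)%E].
Let above_set := [set z : \bar R | (y%:E < z <= right_end I)%E].

Let mbelow_set : measurable below_set.
Proof.
rewrite (_ : below_set = ~` [set z | (z < left_end I)%E] `&` [set z | (z < y%:E)%E]).
  apply: measurableI; last first.
    by apply: measurable_down_closed => u v uv /=; exact: le_lt_trans.
  apply: measurableC; apply: measurable_down_closed => u v uv /=; exact: le_lt_trans.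
apply/seteqP; split => z /=.
  by move=> /andP[h1 h2]; split => //; apply/negP; rewrite -leNgt.
by move=> [/negP h1 h2]; rewrite /below_set /= leNgt h1 h2.
Qed.

Let mabove_set : measurable above_set.
Proof.
rewrite (_ : above_set = ~` [set z | (z <= y%:E)%E] `&` [set z | (z <= right_end I)%E]).
  apply: measurableI; last first.
    by apply: measurable_down_closed => u v uv /=; exact: le_trans.
  apply: measurableC; apply: measurable_down_closed => u v uv /=; exact: le_trans.
apply/seteqP; split => z /=.
  by move=> /andP[h1 h2]; split => //; apply/negP; rewrite -ltNge.
by move=> [/negP h1 h2]; rewrite /above_set /= ltNge h1 h2.
Qed.

Lemma ae_inv_gapK : {ae P, forall w, ig (X w) * gb (X w) = \1_below_set (X w) /\
  ig (X w) * ga (X w) = \1_above_set (X w)}.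
Proof.
apply: filterS (ae_stopped_value_proper filF diffY conts incs lmX admtau).
by move=> w [/(state_closureP itvI Iy) h1 h2]; exact: inv_gapK.
Qed.

(** An end of finite scale makes the moment on its own side finite and the larger one. So on each
    side the moment equals the maximum or the inverse gap of the end is 0; the two products record
    this in the form used by [size_biased_transform]. *)
Lemma finite_moments : 0 < ig (left_end I) + ig (right_end I) -> exists bm am : R,
  [/\ (\int[P]_w (gb (X w))%:E = bm%:E)%E, (\int[P]_w (ga (X w))%:E = am%:E)%E,
      0 <= bm, 0 <= am &
      ig (left_end I) * (Num.max bm am - bm) = 0 /\
      ig (right_end I) * (Num.max bm am - am) = 0].
Proof.
move=> pos; have ig0 z : 0 <= ig z by exact: inv_gap_ge0.
have b0 : (0 <= \int[P]_w (gb (X w))%:E)%E.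
  by apply: integral_ge0 => w _; rewrite lee_fin; exact: gap_below_ge0.
have a0 : (0 <= \int[P]_w (ga (X w))%:E)%E.
  by apply: integral_ge0 => w _; rewrite lee_fin; exact: gap_above_ge0.
have Lm : 0 < ig (left_end I) -> (\int[P]_w (gb (X w))%:E < +oo)%E /\
    (\int[P]_w (ga (X w))%:E <= \int[P]_w (gb (X w))%:E)%E.
  by move=> /(left_moment filF diffY conts incs lmX admtau)[].
have Rm : 0 < ig (right_end I) -> (\int[P]_w (ga (X w))%:E < +oo)%E /\
    (\int[P]_w (gb (X w))%:E <= \int[P]_w (ga (X w))%:E)%E.
  by move=> /(right_moment filF diffY conts incs lmX admtau)[].
have [fb fa] : (\int[P]_w (gb (X w))%:E < +oo)%E /\ (\int[P]_w (ga (X w))%:E < +oo)%E.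
  have [/Lm[h1 h2]|nl] := pselect (0 < ig (left_end I)).
    by split => //; exact: le_lt_trans h2 h1.
  have [/Rm[h1 h2]|nr] := pselect (0 < ig (right_end I)).
    by split => //; exact: le_lt_trans h2 h1.
  by exfalso; move: pos nl nr => + /negP + /negP; rewrite -!leNgt; lra.
have {fb}Eb : (\int[P]_w (gb (X w))%:E = (fine (\int[P]_w (gb (X w))%:E))%:E)%E.
  by rewrite fineK// ge0_fin_numE.
have {fa}Ea : (\int[P]_w (ga (X w))%:E = (fine (\int[P]_w (ga (X w))%:E))%:E)%E.
  by rewrite fineK// ge0_fin_numE.
move: (fine _) (fine _) Eb Ea => am bm Eb Ea.
rewrite Eb Ea !lee_fin in b0 a0 Lm Rm.
exists bm, am; split => //; split.
- have [/Lm[_ h]|] := pselect (0 < ig (left_end I)).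
    by rewrite max_l// subrr mulr0.
  move=> /negP; rewrite -leNgt => h.
  by have -> : ig (left_end I) = 0; [apply/eqP; rewrite eq_le h ig0|rewrite mul0r].
- have [/Rm[_ h]|] := pselect (0 < ig (right_end I)).
    by rewrite max_r// subrr mulr0.
  move=> /negP; rewrite -leNgt => h.
  by have -> : ig (right_end I) = 0; [apply/eqP; rewrite eq_le h ig0|rewrite mul0r].
Qed.

(* The pairs are (fb v, fa v) for v distributed with density h with respect to U;
   the value +oo of v encodes the degenerate pair (y, y). *)
Lemma transient_pairs : 0 < ig (left_end I) + ig (right_end I) ->
  exists g : R -> \bar R * \bar R, [/\ measurable_fun setT g,
    forall u, proper_pairs I y s (g u) &
    forall C, measurable C -> (\int[P]_w exl (g (U w)) C = P (X @^-1` C))%E].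
Proof.
move=> pos; have ig0 z : 0 <= ig z by exact: inv_gap_ge0.
have [bm [am [Eb Ea bm0 am0 [igl igr]]]] := finite_moments pos.
have gb0 z : 0 <= gb z by exact: gap_below_ge0.
have ga0 z : 0 <= ga z by exact: gap_above_ge0.
have aeK := ae_inv_gapK.
have aeX := ae_stopped_value_proper filF diffY conts incs lmX admtau.
have mgbX : measurable_fun setT (gb \o X) by exact: measurableT_comp.
have mgaX : measurable_fun setT (ga \o X) by exact: measurableT_comp.
(* If both moments vanish there is nothing to normalize. Then X = y almost surely, because inverse
   gap times gap is 1 at every other value of X, and the constant pair (y, y) works. *)
have [C00|] := ltP 0 (Num.max bm am); last first.
  rewrite ge_max => /andP[bm0' am0'].
  have {}bm0 : bm = 0 by apply/eqP; rewrite eq_le bm0 bm0'.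
  have {}am0 : am = 0 by apply/eqP; rewrite eq_le am0 am0'.
  rewrite bm0 in Eb; rewrite am0 in Ea.
  have aeb := integral0_ae0 mgbX (fun=> gb0 _) Eb.
  have aea := integral0_ae0 mgaX (fun=> ga0 _) Ea.
  have aey : {ae P, forall w, X w = y%:E}.
    apply: filterS3 aeX aeK (filterI aeb aea) => w [/(state_closureP itvI Iy)/andP[lX Xr] _] [Kb Ka] [/= gb_0 ga_0].
    apply/eqP; rewrite eq_le !leNgt; apply/andP; split; apply/negP => h.
    - have : \1_above_set (X w) = 1 :> R by rewrite indicE mem_set//; apply/andP; split.
      by rewrite -Ka ga_0 mulr0 => /eqP; rewrite eq_sym oner_eq0.
    - have : \1_below_set (X w) = 1 :> R by rewrite indicE mem_set//; apply/andP; split.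
      by rewrite -Kb gb_0 mulr0 => /eqP; rewrite eq_sym oner_eq0.
  exists (cst (y%:E, y%:E)); split; [exact: measurable_cst|by move=> u; exact: proper_start|].
  move=> C mC; rewrite -integral_indic_preimage//.
  apply: ae_eq_integral => //.
  - exact: (measurable_cst (exl (y%:E, y%:E) C)).
  - apply/measurable_EFinP; exact: (measurableT_comp (f := \1_C : \bar R -> R)).
  - apply: filterS aey => w Xy _; rewrite /exl exit_law_degenerate//= ?ltxx//.
    by rewrite -/X Xy.
have aeKb : {ae P, forall w, gb (X w) != 0 -> below_set (X w)}.
  apply: filterS aeX => w [/(state_closureP itvI Iy)/andP[lX Xr] _].
  by rewrite /gb /gap_below /below_set /=; case: ifP; [rewrite lX|rewrite eqxx].
have aeKa : {ae P, forall w, ga (X w) != 0 -> above_set (X w)}.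
  apply: filterS aeX => w [/(state_closureP itvI Iy)/andP[lX Xr] _].
  by rewrite /ga /gap_above /above_set /=; case: ifP; [rewrite Xr|rewrite eqxx].
have Kl : below_set (left_end I) by rewrite /below_set /= lexx ly.
have Kr : above_set (right_end I) by rewrite /above_set /= lexx yr.
have bmC : bm <= Num.max bm am by rewrite le_max lexx.
have amC : am <= Num.max bm am by rewrite le_max lexx orbT.
set C0 := Num.max bm am in C00 igl igr bmC amC.
have [fb [mfb aefb fbP]] := size_biased_transform mU atomless mX mig mgb mbelow_set
  ig0 gb0 C00 bmC igl Eb Kl aeKb (filterS (fun _ h => proj1 h) aeK).
have [fa [mfa aefa faP]] := size_biased_transform mU atomless mX mig mga mabove_set
  ig0 ga0 C00 amC igr Ea Kr aeKa (filterS (fun _ h => proj2 h) aeK).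
pose py := fine (P (X @^-1` [set y%:E])).
have m1y : measurable (X @^-1` [set y%:E]) by exact: measurable_preimageT.
have Epy : (py%:E = P (X @^-1` [set y%:E]))%E by rewrite fineK// fin_num_measure.
have py0 : 0 <= py by rewrite -lee_fin Epy measure_ge0.
have split_law D : measurable D -> (P (X @^-1` (D `&` below_set)) +
    P (X @^-1` (D `&` above_set)) + P (X @^-1` (D `&` [set y%:E])) = P (X @^-1` D))%E.
  move=> mD; have mI K : measurable K -> measurable (X @^-1` (D `&` K)).
    by move=> mK; apply: measurable_preimageT => //; exact: measurableI.
  rewrite -measureU//; [|exact: mI|exact: mI|]; last first.
    apply/seteqP; split => // w [/= [_ /andP[_ h1]] [_ /andP[h2 _]]].
    by move: (lt_trans h1 h2); rewrite ltxx.
  rewrite -measureU//; [|by apply: measurableU; exact: mI|exact: mI|]; last first.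
    apply/seteqP; split => // w [/= h [_ E]]; case: h => -[_]; rewrite /below_set /above_set /= E.
      by rewrite ltxx andbF.
    by rewrite ltxx.
  apply: ae_measure_eq.
  - by apply: measurableU; [apply: measurableU|]; exact: mI.
  - exact: measurable_preimageT.
  apply: filterS aeX => w [/(state_closureP itvI Iy)/andP[lX Xr] _]; split => /=.
    by move=> [[[]|[]]|[]].
  move=> Dw; case: (ltgtP (X w) y%:E) => h.
  - by left; left; split => //; rewrite /below_set /= lX h.
  - by left; right; split => //; rewrite /above_set /= Xr h.
  - by right.
(* Density of the tilted law. By [parts], its integral is P(X < y) + P(X > y), which leaves exactly
   the mass [py] of {X = y} for the atom. *)
pose h w := C0 * (ig (fb (U w)) + ig (fa (U w))).
have migfb : measurable_fun setT (fun w => ig (fb (U w))).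
  by apply: (measurableT_comp mig); exact: measurableT_comp.
have migfa : measurable_fun setT (fun w => ig (fa (U w))).
  by apply: (measurableT_comp mig); exact: measurableT_comp.
have mh : measurable_fun setT h.
  by apply: measurable_funM; [exact: measurable_cst|exact: measurable_funD].
have h0 w : 0 <= h w by rewrite mulr_ge0 ?addr_ge0// ltW.
have mterm D (f : R -> \bar R) : measurable D -> measurable_fun setT f ->
    measurable_fun setT (fun w => (C0 * ig (f (U w)) * \1_D (f (U w)))%:E).
  move=> mD mf; have mfU : measurable_fun setT (f \o U) by exact: measurableT_comp.
  apply/measurable_EFinP; apply: measurable_funM.
    by apply: measurable_funM; [exact: measurable_cst|exact: (measurableT_comp mig mfU)].
  by apply: (measurableT_comp (f := \1_D : \bar R -> R)).
have parts D : measurable D ->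
    (\int[P]_w (C0 * ig (fb (U w)) * \1_D (fb (U w)) + C0 * ig (fa (U w)) * \1_D (fa (U w)))%:E =
     P (X @^-1` (D `&` below_set)) + P (X @^-1` (D `&` above_set)))%E.
  move=> mD; rewrite -fbP// -faP//; under eq_integral do rewrite EFinD.
  have pterm (f : R -> \bar R) w : (0 <= (C0 * ig (f (U w)) * \1_D (f (U w)))%:E)%E.
    by rewrite lee_fin !mulr_ge0// ltW.
  by rewrite ge0_integralD//; [exact: mterm|exact: mterm].
have tot : (\int[P]_w (h w)%:E + py%:E = 1)%E.
  transitivity (P (X @^-1` setT)); last by rewrite preimage_setT; exact: probability_setT.
  rewrite -split_law// -parts// setTI Epy; congr (_ + _)%E.
  by apply: eq_integral => w _; rewrite !indicT !mulr1 -mulrDr.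
have mUe : measurable_fun setT (EFin \o U) by exact/measurable_EFinP.
(* Here U itself is the variable to be reweighted: q(U) has the tilted law of U, plus the atom at
   +oo. *)
have [q mq qP] := mixture_transform mU atomless +oo%E mh h0 mUe py0 tot.
(* [fb] and [fa] have values on the correct side of y almost surely only; the tests send the
   exceptional arguments to (y, y), so that the pair is proper for every v. *)
pose pair (v : \bar R) : \bar R * \bar R :=
  if [&& (v < +oo)%E, (left_end I <= fb (fine v) < y%:E)%E &
         (y%:E < fa (fine v) <= right_end I)%E]
  then (fb (fine v), fa (fine v)) else (y%:E, y%:E).
have mfine : measurable_fun setT (@fine R) by exact: fine_measurable.
have mfbf : measurable_fun setT (fun v => fb (fine v)) by exact: measurableT_comp.
have mfaf : measurable_fun setT (fun v => fa (fine v)) by exact: measurableT_comp.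
have mpair : measurable_fun setT pair.
  apply: measurable_fun_ifT; last exact: measurable_cst.
    apply: measurable_and; last apply: measurable_and.
    - apply: (@measurable_fun_bool _ _ _ _ true); rewrite setTI.
      by apply: measurable_down_closed => u v uv /=; exact: le_lt_trans.
    - apply: (@measurable_fun_bool _ _ _ _ true); rewrite setTI.
      exact: (measurable_preimageT mfbf mbelow_set).
    - apply: (@measurable_fun_bool _ _ _ _ true); rewrite setTI.
      exact: (measurable_preimageT mfaf mabove_set).
  exact: measurable_fun_pair.
have proper v : proper_pairs I y s (pair v).
  rewrite /pair; case: ifP => [/and3P[_ /andP[lb by_] /andP[ya ar]]|_]; last exact: proper_start.
  split; last by left.
  by apply/(threshold_pairsP diffY); rewrite /= lb ar !ltW.
exists (pair \o q); split; [exact: measurableT_comp|by move=> u; exact: proper|].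
move=> C mC.
have mexl : measurable_fun setT (fun v => exl (pair v) C).
  by apply: (measurableT_comp (measurable_exit_law filF diffY mC)).
rewrite (qP (fun v => exl (pair v) C))// -split_law// -parts//; congr (_ + _)%E; last first.
  rewrite /pair ltxx /= /exl exit_law_degenerate/= ?ltxx// -EFinM indicE.
  have [Cy|nCy] := pselect (C y%:E).
    by rewrite mem_set// mulr1 Epy; congr (P _); apply/seteqP; split => w /=; [move=> ->|case].
  rewrite memNset// mulr0 -[LHS](@measure0 _ _ _ P); congr (P _).
  by apply/seteqP; split => w //= [Cw E]; apply: nCy; rewrite -E.
apply: ae_eq_integral => //.
- apply: emeasurable_funM; last exact/measurable_EFinP.
  exact: (measurableT_comp mexl mUe).
- under eq_fun do rewrite EFinD.
  by apply: emeasurable_funD; exact: mterm.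
apply: filterS2 aefb aefa => w Kb Ka _.
have Epair : pair (U w)%:E = (fb (U w), fa (U w)).
  by rewrite /pair ltry /= ifT//; apply/andP; split.
have [/andP[lb by_] /andP[ya ar]] := (Kb, Ka).
have [pp _] := proper (U w)%:E; rewrite Epair in pp.
have sumpos := inv_gap_pair_gt0 pos lb by_ ya ar.
(* The factor p(fb) + p(fa) in h cancels the denominator of the exit law, leaving the integrand of
   [parts]. *)
rewrite /= Epair /exl (exit_lawE filF diffY conts incs lmX C pp)// -EFinM; congr (_%:E).
by rewrite /h -/ig /=; field; rewrite gt_eqF.
Qed.

End embedding.

Lemma law_eq d d' (T : measurableType d) (T' : measurableType d') (R : realType)
    (P : probability T R) (X Z : T -> T') :
  (forall C, measurable C -> P (X @^-1` C) = P (Z @^-1` C)) -> law P X = law P Z.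
Proof.
move=> XZ; apply/funext => C; rewrite /law !patchE; case: ifPn => // /set_mem mC.
exact: XZ.
Qed.

Lemma randomized_threshold_embedding d (T : measurableType d) (R : realType)
    (P : probability T R) (F : R -> set (set T)) (I : set R) (y : R)
    (Y : T -> path_space R) (k : R.-pker R ~> path_space R) :
  filtration F -> regular_diffusion P F I y Y k -> has_scale P F I Y -> rich P F Y ->
  forall tau, admissible P F I Y tau ->
  exists2 sigma, randomized_threshold P F I y Y sigma &
    law P (stopped_value Y sigma) = law P (stopped_value Y tau).
Proof.
move=> filF diffY [s [conts incs lmX]] [U [wrtU atomless indU]] tau adm.
have mU : measurable_fun setT U.
  by move=> _ B mB; rewrite setTI; exact: (filtration_measurable filF (lexx 0) (wrtU _ mB)).
have [g [mg proper gP]] : exists g : R -> \bar R * \bar R,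
    [/\ measurable_fun setT g, forall u, proper_pairs I y s (g u) &
    forall C, measurable C ->
      (\int[P]_w exit_law P y Y (g (U w)) C = P (stopped_value Y tau @^-1` C))%E].
  have [pos|npos] := pselect (0 < inv_gap I y s (left_end I) + inv_gap I y s (right_end I)).
    exact: (transient_pairs filF diffY conts incs lmX mU atomless adm pos).
  exact: (recurrent_pairs filF diffY conts incs lmX mU atomless adm npos).
have [sigma rsigma lawS] :=
  randomized_threshold_law filF diffY conts incs lmX wrtU indU mg proper.
exists sigma => //; apply: law_eq => C mC; rewrite lawS//; exact: gP.
Qed.

Theorem mainTheorem1 (d : measure_display) (T : measurableType d) (R : realType)
    (P : probability T R) (F : R -> set (set T)) (I : set R) (y : R)
    (Y : T -> path_space R) (k : R.-pker R ~> path_space R)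
    (V : (T -> \bar R) -> R) :
  filtration F ->
  regular_diffusion P F I y Y k ->
  has_scale P F I Y ->
  rich P F Y ->
  law_invariant P F I Y V ->
  (optimal_value V (pure_threshold P F I y Y)
     <= optimal_value V (randomized_threshold P F I y Y))%E /\
  optimal_value V (randomized_threshold P F I y Y)
    = optimal_value V (admissible P F I Y).
Proof.
move=> filF diffY scale richF [H VH].
(* Applied to the pure thresholds this is the inequality, and applied to all admissible times it is
   the nontrivial half of the equality. *)
have le_all (S : set (T -> \bar R)) : S `<=` admissible P F I Y ->
    (optimal_value V S <= optimal_value V (randomized_threshold P F I y Y))%E.
  move=> SA; apply: ge_ereal_sup => _ [tau /SA adm <-].
  have [sigma rsigma E] := randomized_threshold_embedding filF diffY scale richF adm.
  apply: ereal_sup_ubound; exists sigma => //.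
  by rewrite (VH tau)// (VH sigma) ?E//; case: rsigma.
split; first by apply: le_all => tau [].
apply/eqP; rewrite eq_le le_all// andbT; apply: le_ereal_sup => _ [tau [adm _] <-].
by exists tau.
Qed.
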